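(* Let $\mathbf{X}=(\mathbf{X}_t)_{t\in[0,1]}$ be an $\mathbb{R}^d$-valued Lévy process with $\mathbf{X}\in\mathrm{RV}((a_n),m,\overline{\mathbb{D}}_0)$. Then, for every $\varepsilon>0$, $$\lim_{u\to\infty}\mathrm{P}\big(d^\circ(u^{-1}\mathbf{X},u^{-1}\Delta\mathbf{X}_{\tau(\mathbf{X})}1_{[\tau(\mathbf{X}),1]})>\varepsilon\,\big|\,|\mathbf{X}|_\infty>u\big)=0,$$ $$\lim_{u\to\infty}\mathrm{P}\big(d^\circ(u^{-1}\mathbf{X},u^{-1}\Delta\mathbf{X}_{\tau(\mathbf{X})}1_{[\tau(\mathbf{X}),1]})>\varepsilon\,\big|\,|\Delta\mathbf{X}_{\tau(\mathbf{X})}|>u\big)=0,$$ and $\Delta\mathbf{X}_{\tau(\mathbf{X})}1_{[\tau(\mathbf{X}),1]}\in\mathrm{RV}((a_n),m,\overline{\mathbb{D}}_0)$.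
   Context: $|\cdot|$ is the Euclidean norm, $|\mathbf{x}|_\infty=\sup_{t\in[0,1]}|\mathbf{x}_t|$, and $\Delta\mathbf{x}_t=\mathbf{x}_t-\mathbf{x}_{t-}$. For $\mathbf{z}\in\mathbb{R}^d$ and $v\in[0,1]$, $\mathbf{z}1_{[v,1]}$ is the function equal to $\mathbf{0}$ on $[0,v)$ and $\mathbf{z}$ on $[v,1]$. $\mathbb{D}=\mathbb{D}([0,1],\mathbb{R}^d)$ is the space of càdlàg functions $[0,1]\to\mathbb{R}^d$ with Billingsley's complete $J_1$-metric $d^\circ(\mathbf{x},\mathbf{y})=\inf_\lambda\max\{\sup_{s<t}|\log\frac{\lambda(t)-\lambda(s)}{t-s}|,\ \sup_t|\mathbf{x}_t-\mathbf{y}_{\lambda(t)}|\}$, the infimum being over increasing bijections $\lambda$ of $[0,1]$. For $\mathbf{x}\in\mathbb{D}$, $\tau(\mathbf{x})$ is the time of the jump of $\mathbf{x}$ with largest norm, and the first such time if there are several: $\tau(\mathbf{x})=\lim_{\varepsilon\downarrow0}\inf\{t\in(0,1):|\Delta\mathbf{x}_t|=\sup\{|\Delta\mathbf{x}_s|:s\in(0,1),|\Delta\mathbf{x}_s|>\varepsilon\}\}$, with $\tau(\mathbf{x})=1$ if the set is empty (no jump in $(0,1)$). Let $\mathbb{S}_\mathbb{D}=\{\mathbf{x}\in\mathbb{D}:|\mathbf{x}|_\infty=1\}$ and $\overline{\mathbb{D}}_0=(0,\infty]\times\mathbb{S}_\mathbb{D}$ with metric $\max\{|1/x^*-1/y^*|,d^\circ(\widetilde{\mathbf{x}},\widetilde{\mathbf{y}})\}$;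 $\mathbb{D}\setminus\{\mathbf{0}\}$ is identified with $(0,\infty)\times\mathbb{S}_\mathbb{D}$ via $\mathbf{x}\mapsto(|\mathbf{x}|_\infty,\mathbf{x}/|\mathbf{x}|_\infty)$, so that bounded subsets of $\overline{\mathbb{D}}_0$ are those on which $|\mathbf{x}|_\infty$ is bounded away from $0$. Measures $m_n$, finite on bounded sets, satisfy $m_n\xrightarrow{\hat w}m$ if $m_n(B)\to m(B)$ for every bounded Borel set $B$ with $m(\partial B)=0$. $\mathbf{X}\in\mathrm{RV}((a_n),m,\overline{\mathbb{D}}_0)$ means: $\mathbf{X}$ is a process with sample paths in $\mathbb{D}$, $0<a_n\uparrow\infty$, $m$ is a nonzero measure on $\mathcal{B}(\overline{\mathbb{D}}_0)$, finite on bounded sets, with $m(\overline{\mathbb{D}}_0\setminus\mathbb{D})=0$, and $n\mathrm{P}(a_n^{-1}\mathbf{X}\in\cdot)\xrightarrow{\hat w}m(\cdot)$ on $\mathcal{B}(\overline{\mathbb{D}}_0)$. *)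

(* Defs.v *)
From HB Require Import structures.
From mathcomp Require Import all_boot all_order all_algebra.
From mathcomp Require Import all_classical all_reals all_analysis.

Set Implicit Arguments.
Unset Strict Implicit.
Unset Printing Implicit Defensive.

Import Order.TTheory GRing.Theory Num.Theory.
Import numFieldNormedType.Exports.

Local Open Scope classical_set_scope.
Local Open Scope ring_scope.

Notation borel T := (g_sigma_algebraType (@open T)).

(* The library norm on row vectors is the max norm, hence this one. *)
Definition enorm (R : realType) (n : nat) (z : 'rV[R]_n) : R :=
  Num.sqrt (\sum_(i < n) z 0 i ^+ 2).

(* Open sets of a distance function.  They are closed under unions and finite
   intersections without any metric axiom, so the topologies below do not
   depend on proofs of such axioms. *)
Definition dist_open (R : realType) (T : Type) (dist : T -> T -> \bar R) :
    set_system T :=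
  [set U | forall x, U x -> exists2 e : R, 0 < e &
             forall y, (dist x y < e%:E)%E -> U y].

Section dist_open_lemmas.
Variables (R : realType) (T : Type) (dist : T -> T -> \bar R).

Lemma dist_openT : dist_open dist setT.
Proof. by move=> x _; exists 1. Qed.

Lemma dist_openI : setI_closed (dist_open dist).
Proof.
move=> A B oA oB x [/oA[e e0 eA] /oB[f f0 fB]].
exists (Order.min e f); first by rewrite lt_min e0 f0.
by move=> y; rewrite EFin_min lt_min => /andP[? ?]; split; [exact: eA|exact: fB].
Qed.

Lemma dist_open_bigU (I : Type) (f : I -> set T) :
  (forall i, dist_open dist (f i)) -> dist_open dist (\bigcup_i f i).
Proof.
move=> of_ x [i _ /of_[e e0 ef]]; exists e => // y xy.
by exists i => //; exact: ef.
Qed.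
End dist_open_lemmas.

(* Functions on [0,1] are encoded as functions on R vanishing off [0,1], so
   that equality in [skorokhod] is equality of functions on [0,1]. *)
Definition cadlag (R : realType) (n : nat) (x : R -> 'rV[R]_n) : Prop :=
  [/\ forall t, 0 <= t < 1 -> x s @[s --> t^'+] --> x t,
      forall t, 0 < t <= 1 -> cvg (x s @[s --> t^'-])
    & forall t, ~~ (0 <= t <= 1) -> x t = 0].

(* Paths in R^(d+1): in dimension 0 the sphere S_D is empty, and measurable
   types must be inhabited. *)
Record skorokhod (R : realType) (d : nat) := Skorokhod {
  path_of :> R -> 'rV[R]_d.+1 ;
  path_ofP : cadlag path_of }.

Section skorokhod_ops.
Variables (R : realType) (d : nat).
Implicit Types (x y : skorokhod R d) (z : 'rV[R]_d.+1).

Lemma cadlag_scale (c : R) x : cadlag (fun t => c *: x t).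
Proof.
case: x => x [xr xl x0] /=; split => [t /xr xt|t /xl xt|t /x0 ->].
- exact: cvgZl_tmp.
- exact: is_cvgZl_tmp.
- by rewrite scaler0.
Qed.

Definition sk_scale (c : R) x : skorokhod R d := Skorokhod (cadlag_scale c x).

Lemma cadlag_one_jump z (v : R) :
  cadlag (fun t => if (0 <= t <= 1) && (v <= t) then z else 0).
Proof.
split=> [t /andP[t0 t1]|t /andP[t0 t1]|t /negbTE -> //].
- apply: cvg_near_cst; rewrite t0 (ltW t1) /=.
  have [vt|tv] := leP v t.
  + near=> s.
    have ts : t < s by near: s; exact: nbhs_right_gt.
    have s1 : s < 1 by near: s; exact: nbhs_right_lt.
    by rewrite (le_trans t0 (ltW ts)) (ltW s1) (le_trans vt (ltW ts)).
  + near=> s.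
    have sv : s < v by near: s; exact: nbhs_right_lt.
    by rewrite (leNgt v) sv andbF.
- have [vt|tv] := ltP v t.
  + apply: (@is_cvg_near_cst _ _ z); near=> s.
    have vs : v < s by near: s; exact: nbhs_left_gt.
    have s0 : 0 < s by near: s; exact: nbhs_left_gt.
    have st : s < t by near: s; exact: nbhs_left_lt.
    by rewrite (ltW s0) (ltW vs) (le_trans (ltW st) t1).
  + apply: (@is_cvg_near_cst _ _ 0); near=> s.
    have sv : s < t by near: s; exact: nbhs_left_lt.
    by rewrite (leNgt v) (lt_le_trans sv tv) andbF.
Unshelve. all: by end_near. Qed.

(* z 1_[v,1] *)
Definition one_jump z (v : R) : skorokhod R d :=
  Skorokhod (cadlag_one_jump z v).

Definition supnorm x : \bar R :=
  ereal_sup [set (enorm (x t))%:E | t in `[0, 1]].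

(* Increasing bijections of [0,1]; the values off [0,1] are irrelevant. *)
Definition time_change (lam : R -> R) : Prop :=
  {in `[0, 1] &, {homo lam : s t / s < t}} /\
  set_bij `[0, 1] `[0, 1] lam.

Definition log_slope (lam : R -> R) : \bar R :=
  ereal_sup [set (`|ln ((lam p.2 - lam p.1) / (p.2 - p.1))|)%:E |
             p in [set p : R * R | [/\ 0 <= p.1, p.1 < p.2 & p.2 <= 1]]].

(* Billingsley's metric. *)
Definition J1dist x y : \bar R :=
  ereal_inf [set Order.max (log_slope lam)
                   (ereal_sup [set (enorm (x t - y (lam t)))%:E | t in `[0, 1]]) |
             lam in time_change].

Definition jump x (t : R) : 'rV[R]_d.+1 := x t - lim (x s @[s --> t^'-]).

(* If no jump exceeds e, the supremum is -oo and this set is empty. *)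
Definition max_jump_times x (e : R) : set R :=
  [set t | 0 < t < 1 /\
    (enorm (jump x t))%:E =
      ereal_sup [set (enorm (jump x s))%:E |
                 s in [set s | 0 < s < 1 /\ e < enorm (jump x s)]]].

Definition tau_above x (e : R) : R :=
  if `[< max_jump_times x e = set0 >] then 1 else inf (max_jump_times x e).

Definition tau x : R := lim (tau_above x e @[e --> 0^'+]).

(* x |-> (Delta x_tau) 1_[tau,1] *)
Definition largest_jump x : skorokhod R d := one_jump (jump x (tau x)) (tau x).

End skorokhod_ops.

HB.instance Definition _ R d := gen_eqMixin (skorokhod R d).
HB.instance Definition _ R d := gen_choiceMixin (skorokhod R d).
HB.instance Definition _ (R : realType) d :=
  isPointed.Build (skorokhod R d) (one_jump 0 0).
HB.instance Definition _ (R : realType) d :=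
  isOpenTopological.Build (skorokhod R d)
    (dist_openT _) (@dist_openI _ _ (@J1dist R d)) (@dist_open_bigU _ _ _).

(* (0,+oo] x S_D *)
Record polar (R : realType) (d : nat) := Polar {
  radius : \bar R ;
  direction : skorokhod R d ;
  radius_gt0 : (0 < radius)%E ;
  direction_unit : supnorm direction = 1%E }.

Section polar_space.
Variables (R : realType) (d : nat).

Lemma enorm_delta : enorm (delta_mx 0 0 : 'rV[R]_d.+1) = 1.
Proof.
rewrite /enorm (bigD1 ord0) //= big1 ?addr0 ?mxE ?eqxx ?expr1n ?sqrtr1 //.
by move=> i /negbTE i0; rewrite mxE i0 andbF expr0n.
Qed.

Lemma supnorm_unit :
  supnorm (one_jump (delta_mx 0 0 : 'rV[R]_d.+1) 0) = 1%E.
Proof.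
rewrite /supnorm (_ : [set _ | _ in _] = [set 1%E]) ?ereal_sup1 //.
apply/seteqP; split => r /=.
  by move=> [t]; rewrite in_itv /= => /[dup] /andP[t0 _] -> <-; rewrite t0 enorm_delta.
by move=> ->; exists 0; rewrite ?in_itv /= ?lexx ?ler01 //= enorm_delta.
Qed.

Definition polar_point : polar R d := Polar lte01 supnorm_unit.

(* (+oo)^-1 = 0 in \bar R. *)
Definition polar_dist (p q : polar R d) : \bar R :=
  Order.max `|(radius p)^-1 - (radius q)^-1|%E
            (J1dist (direction p) (direction q)).

Definition polar_bounded (B : set (polar R d)) : Prop :=
  exists M : R, forall p q, B p -> B q -> (polar_dist p q <= M%:E)%E.

(* p is the image of x under x |-> (|x|, x / |x|). *)
Definition polar_of (x : skorokhod R d) (p : polar R d) : Prop :=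
  radius p = supnorm x /\ direction p = sk_scale (fine (supnorm x))^-1 x.

(* The part of B in D \ {0}. *)
Definition polar_trace (B : set (polar R d)) : set (skorokhod R d) :=
  [set x | exists2 p, B p & polar_of x p].

End polar_space.

HB.instance Definition _ R d := gen_eqMixin (polar R d).
HB.instance Definition _ R d := gen_choiceMixin (polar R d).
HB.instance Definition _ (R : realType) d :=
  isPointed.Build (polar R d) (polar_point R d).
HB.instance Definition _ (R : realType) d :=
  isOpenTopological.Build (polar R d)
    (dist_openT _) (@dist_openI _ _ (@polar_dist R d)) (@dist_open_bigU _ _ _).

Section regular_variation.
Variables (R : realType) (d : nat).

Definition hatw_cvg (mu_ : nat -> set (polar R d) -> \bar R)
    (mu : set (polar R d) -> \bar R) : Prop :=
  forall B : set (polar R d),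
    measurable (B : set (borel (polar R d))) -> polar_bounded B ->
    mu (closure B `\` interior B) = 0%E ->
    mu_ n B @[n --> \oo] --> mu B.

Variables (disp : measure_display) (Omega : measurableType disp).
Variable P : probability Omega R.

(* The first clause says that X is a random element of D for the Borel sets of
   J1, which the evaluations generate; it makes n P(X / a_n \in .) a measure on
   the Borel sets of the polar space. *)
Definition RV (X : Omega -> skorokhod R d) (a : nat -> R)
    (m : {measure set (borel (polar R d)) -> \bar R}) : Prop :=
  [/\ measurable_fun setT (X : Omega -> borel (skorokhod R d)),
      (forall n, 0 < a n) /\ nondecreasing_seq a /\ a n @[n --> \oo] --> +oo,
      m setT <> 0%E /\
      (forall B : set (polar R d), measurable (B : set (borel (polar R d))) ->
         polar_bounded B -> (m B < +oo)%E),
      m [set p | radius p = +oo%E] = 0%E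
    & hatw_cvg (fun n B =>
        n%:R%:E * P [set w | polar_trace B (sk_scale (a n)^-1 (X w))])%E m].

Definition increment (X : Omega -> skorokhod R d) (s t : R) (w : Omega) :
  borel 'rV[R]_d.+1 := X w t - X w s.

(* Time is restricted to [0,1]; X w t is the value X_t(w). *)
Definition levy (X : Omega -> skorokhod R d) : Prop :=
  (forall t, 0 <= t <= 1 ->
     measurable_fun setT (fun w => X w t : borel 'rV[R]_d.+1)) /\
  P [set w | X w 0 = 0] = 1%E /\
  (forall (n : nat) (t : nat -> R) (B : nat -> set (borel 'rV[R]_d.+1)),
     (forall i, (i <= n)%N -> 0 <= t i <= 1) ->
     (forall i, (i < n)%N -> t i <= t i.+1) ->
     (forall i, measurable (B i)) ->
     P (\bigcap_(i < n) (increment X (t i) (t i.+1) @^-1` B i)) =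
     (\prod_(i < n) P (increment X (t i) (t i.+1) @^-1` B i))%E) /\
  (forall (s t : R) (B : set (borel 'rV[R]_d.+1)),
     0 <= s -> 0 <= t -> s + t <= 1 -> measurable B ->
     P (increment X s (s + t) @^-1` B) = P [set w | B (X w t)]) /\
  (forall t e : R, 0 <= t <= 1 -> 0 < e ->
     P [set w | e < enorm (X w s - X w t)]
       @[s --> within `[0, 1] (nbhs t)] --> 0%E).

(* P(A | B), with the value 0 when P B = 0. *)
Definition cond_prob (A B : set Omega) : \bar R := (P (A `&` B) / P B)%E.

End regular_variation.

(* Main.v *)
Require Import Defs.
From HB Require Import structures.
From mathcomp Require Import all_boot all_order all_algebra.
From mathcomp Require Import all_classical all_reals all_analysis.
From mathcomp Require Import measurable_realfun ring lra.

Set Implicit Arguments.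
Unset Strict Implicit.
Unset Printing Implicit Defensive.

Import Order.TTheory GRing.Theory Num.Theory.
Import numFieldNormedType.Exports.
Local Open Scope classical_set_scope.
Local Open Scope ring_scope.

(** Why the theorem holds: independence of the increments leaves room for only one
    big jump.

    Stop the path when its norm first exceeds [a].  What follows is independent
    of the past, so the probability that the path exceeds [a] and afterwards
    moves by more than [a] once again is at most a product of two tails of the
    uniform norm.  On finite grids this is [two_moves_le], the decomposition
    being over the grid time of first passage; the bound does not depend on the
    grid, so it passes to the limit along dyadic grids ([exceptional_le]), where
    right continuity makes dyadic times sufficient ([single_move_dyadic]).

    A path that does not make two such moves is close to zero before the first
    passage [T] and close to its value at [T] afterwards.  If it starts at 0 and
    does not jump at time 1, it is within [6 a] of its largest jump in uniform
    norm, hence in the Skorokhod distance ([single_move_close],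
    [not_exceptional_close]).  Continuity in probability excludes a jump at 1
    ([levy_jump_at1]).

    Let [V] be the tail of the norm of the process.  At scale [u] the event where
    the path is far from its largest jump has probability at most a square
    [V (c u) ^ 2].  Regular variation gives [V (c u) = O(V u)] ([tail_O]); the
    point is that the limit measure charges the complement of every ball of paths
    around the zero path ([Q_gt0]).  So the square is negligible with respect to
    [V u], which is the probability of the first condition, and of the same order
    as that of the second one ([largest_jump_tail]); both conditional statements
    follow ([cond_far_cvg]).  At scale [a n] the square is [o(1/n)]
    ([exceptional_seq]), and the limit measure of the largest jump is that of the
    process by the usual sandwich: a set with null boundary lies between the
    complement of a thickening of its complement and a thickening of itself, with
    almost the same mass and again with null boundaries ([outer_approx],
    [inner_approx], [largest_jump_cvg]).

    The events involved have to be measurable.  For the time and the size of the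
    largest jump this rests on a compactness argument that describes jumps by
    increments over short rational intervals ([has_jumpE], [tau_inE]); for the
    Skorokhod distance to the largest jump, on the countably many one-jump paths
    with rational data ([measurable_J1dist_one_jump]). *)

(** * The Euclidean norm *)

Section enorm_theory.
Context {R : realType} {n : nat}.
Implicit Types (x y z : 'rV[R]_n).

Lemma sum_sqr_ge0 x : 0 <= \sum_(i < n) x 0 i ^+ 2.
Proof. by apply: sumr_ge0 => i _; exact: sqr_ge0. Qed.

Lemma enorm_ge0 x : 0 <= enorm x.
Proof. exact: sqrtr_ge0. Qed.

Lemma enorm0 : enorm (0 : 'rV[R]_n) = 0.
Proof. by rewrite /enorm big1 ?sqrtr0 // => i _; rewrite mxE expr0n. Qed.

Lemma enorm_sqr x : enorm x ^+ 2 = \sum_(i < n) x 0 i ^+ 2.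
Proof. by rewrite sqr_sqrtr ?sum_sqr_ge0. Qed.

Lemma enormZ (c : R) x : enorm (c *: x) = `|c| * enorm x.
Proof.
rewrite /enorm -sqrtr_sqr -sqrtrM ?sqr_ge0 // mulr_sumr; congr Num.sqrt.
by apply: eq_bigr => i _; rewrite mxE exprMn.
Qed.

Lemma enormN x : enorm (- x) = enorm x.
Proof. by rewrite -scaleN1r enormZ normrN1 mul1r. Qed.

Lemma enormB x y : enorm (x - y) = enorm (y - x).
Proof. by rewrite -enormN opprB. Qed.

Lemma enorm_CauchySchwarz x y :
  (\sum_(i < n) x 0 i * y 0 i) ^+ 2 <= enorm x ^+ 2 * enorm y ^+ 2.
Proof.
rewrite !enorm_sqr.
set A := \sum_i x 0 i ^+ 2; set B := \sum_i y 0 i ^+ 2; set C := \sum_i _.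
have B0 : 0 <= B by exact: sum_sqr_ge0.
have h : 0 <= B * (A * B - C ^+ 2).
  (* the square of the component of x orthogonal to y, up to the factor B *)
  have -> : B * (A * B - C ^+ 2) = \sum_i (B * x 0 i - C * y 0 i) ^+ 2.
    rewrite (eq_bigr (fun i => B ^+ 2 * x 0 i ^+ 2
      - (2 * B * C) * (x 0 i * y 0 i) + C ^+ 2 * y 0 i ^+ 2)); last first.
      by move=> i _; ring.
    by rewrite big_split /= sumrB -!mulr_sumr -/A -/B -/C; ring.
  by apply: sumr_ge0 => i _; exact: sqr_ge0.
have [B_eq0|Bn0] := eqVneq B 0.
  have y0 i : y 0 i = 0.
    apply/eqP; rewrite -sqrf_eq0; apply/eqP.
    exact: (psumr_eq0P (fun j _ => sqr_ge0 (y 0 j)) B_eq0).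
  by rewrite B_eq0 mulr0 /C big1 ?expr0n // => i _; rewrite y0 mulr0.
by move: h; rewrite pmulr_rge0 ?subr_ge0 // lt_def Bn0.
Qed.

Lemma ler_enormD x y : enorm (x + y) <= enorm x + enorm y.
Proof.
rewrite -(@ler_pXn2r _ 2) ?nnegrE ?addr_ge0 ?enorm_ge0 //.
rewrite sqrrD enorm_sqr; under eq_bigr do rewrite mxE sqrrD.
rewrite !big_split /= -!enorm_sqr lerD2r lerD2l -mulr2n.
rewrite -[leLHS]mulr_natr -[leRHS]mulr_natr ler_wpM2r //.
apply: (le_trans (ler_norm _)).
rewrite -(@ler_pXn2r _ 2) ?nnegrE ?mulr_ge0 ?enorm_ge0 //.
by rewrite real_normK ?num_real // exprMn; exact: enorm_CauchySchwarz.
Qed.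

Lemma ler_enormB x y : enorm (x - y) <= enorm x + enorm y.
Proof. by rewrite -[enorm y]enormN ler_enormD. Qed.

Lemma ler_enorm_dist (z x y : 'rV[R]_n) :
  enorm (x - y) <= enorm (x - z) + enorm (z - y).
Proof. by rewrite -[x - y](subrKA z) ler_enormD. Qed.

Lemma enorm_tri_le (z x y : 'rV[R]_n) a b c :
  enorm (x - z) <= a -> enorm (z - y) <= b -> a + b <= c -> enorm (x - y) <= c.
Proof.
move=> xz zy; apply: le_trans; apply: le_trans (ler_enorm_dist z x y) _.
exact: lerD.
Qed.

Lemma enorm_tri_lt (z x y : 'rV[R]_n) a b c :
  enorm (x - z) <= a -> enorm (z - y) <= b -> a + b < c -> enorm (x - y) < c.
Proof.
move=> xz zy; apply: le_lt_trans; apply: le_trans (ler_enorm_dist z x y) _.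
exact: lerD.
Qed.

Lemma lerB_enorm x y : enorm x - enorm y <= enorm (x - y).
Proof. by rewrite lerBlDr -[in enorm x](subrK y x) ler_enormD. Qed.

Lemma enorm_coord x i : `|x 0 i| <= enorm x.
Proof.
rewrite -(@ler_pXn2r _ 2) ?nnegrE ?enorm_ge0 // real_normK ?num_real //.
by rewrite enorm_sqr (bigD1 i) //= lerDl sumr_ge0 // => j _; exact: sqr_ge0.
Qed.

Lemma enorm_eq0 x : enorm x = 0 -> x = 0.
Proof.
move=> x0; apply/rowP => i; rewrite mxE; apply/eqP.
by rewrite -normr_le0 -x0 enorm_coord.
Qed.

Lemma norm_le_enorm x : `|x| <= enorm x.
Proof.
rewrite /Num.norm/= mx_normrE; apply/bigmax_leP; split=> [|[i j] _ /=].
  exact: enorm_ge0.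
by rewrite ord1 enorm_coord.
Qed.

Lemma enorm_le_norm x : enorm x <= n%:R * `|x|.
Proof.
rewrite -(@ler_pXn2r _ 2) ?nnegrE ?enorm_ge0 ?mulr_ge0 // enorm_sqr.
have coord i : x 0 i ^+ 2 <= `|x| ^+ 2.
  rewrite -[leLHS]real_normK ?num_real // ler_pXn2r ?nnegrE //.
  rewrite [leRHS]/Num.norm/= mx_normrE.
  exact: (le_bigmax _ (fun ij : 'I_1 * 'I_n => `|x ij.1 ij.2|) (0, i)).
apply: (@le_trans _ _ (\sum_(i < n) `|x| ^+ 2)).
  by apply: ler_sum => i _; exact: coord.
rewrite sumr_const card_ord exprMn -[leLHS]mulr_natl ler_wpM2r ?sqr_ge0 //.
by rewrite -natrX ler_nat; case: (n) => // k; rewrite leq_pmulr.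
Qed.

(** In finite dimension the maximum norm and the Euclidean norm induce the same
    topology. *)
Lemma cvg_enormP {T : Type} (F : set_system T) {FF : Filter F}
    (f : T -> 'rV[R]_n) (l : 'rV[R]_n) :
  f @ F --> l <-> forall e, 0 < e -> \forall t \near F, enorm (f t - l) < e.
Proof.
split=> [/cvgrPdist_lt fl e e0|h].
  have e'0 : 0 < e / n.+1%:R by rewrite divr_gt0.
  apply: filterS (fl _ e'0) => t; rewrite ltr_pdivlMr // => lft.
  rewrite enormB; apply: le_lt_trans (enorm_le_norm _) _.
  by apply: le_lt_trans lft; rewrite mulrC ler_wpM2l // ler_nat.
apply/cvgrPdist_lt => e e0; apply: filterS (h _ e0) => t.
by rewrite enormB; apply: le_lt_trans; exact: norm_le_enorm.
Qed.

End enorm_theory.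

(** * Local behaviour and jumps of a path *)

(** Locked, so that two limits are never compared by unfolding them. *)
HB.lock Definition left_lim (R : realType) (d : nat) (x : skorokhod R d) (t : R)
  : 'rV[R]_d.+1 := lim (x s @[s --> t^'-]).

(** A locked copy of [jump], for the same reason. *)
HB.lock Definition jmp (R : realType) (d : nat) (x : skorokhod R d) (t : R)
  : 'rV[R]_d.+1 := jump x t.

Section path_theory.
Context {R : realType} {d : nat}.
Implicit Types (x y : skorokhod R d) (t s e : R).

Lemma left_limP x t : 0 < t <= 1 -> x s @[s --> t^'-] --> left_lim x t.
Proof. by rewrite left_lim.unlock; have [_ xl _] := path_ofP x => /xl. Qed.

Lemma path_right x t : 0 <= t < 1 -> x s @[s --> t^'+] --> x t.
Proof. by have [xr _ _] := path_ofP x => /xr. Qed.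

(** Both one-sided limits, read on [0,1] only.  Off [0,1] the path is zero by
    convention, which has nothing to do with its limits. *)
Lemma path_local x t e : 0 < e -> exists2 D, 0 < D &
  forall s, 0 <= s <= 1 -> `|s - t| < D ->
    (s < t -> enorm (x s - left_lim x t) < e) /\
    (t <= s -> enorm (x s - x t) < e).
Proof.
move=> e0.
have [D1 D10 h1] : exists2 D, 0 < D & forall s, 0 <= s <= 1 ->
    `|s - t| < D -> s < t -> enorm (x s - left_lim x t) < e.
  have [t0|t0] := leP t 0.
    by exists 1 => // s /andP[s0 _] _; rewrite ltNge (le_trans t0 s0).
  have [t1|t1] := leP t 1; last first.
    exists (t - 1); rewrite ?subr_gt0 // => s /andP[_ s1] + st.
    by rewrite distrC ger0_norm ?subr_ge0 ?(ltW st) // => h; lra.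
  have t01 : 0 < t <= 1 by rewrite t0.
  have /cvg_enormP /(_ _ e0) := @left_limP x t t01.
  rewrite near_withinE => /nbhs_ballP[D /= D0 hD].
  by exists D => // s _ sD st; apply: hD => //; rewrite /ball/= distrC.
have [D2 D20 h2] : exists2 D, 0 < D & forall s, 0 <= s <= 1 ->
    `|s - t| < D -> t <= s -> enorm (x s - x t) < e.
  have tt : enorm (x t - x t) < e by rewrite subrr enorm0.
  have [t1|t1] := leP 1 t.
    exists 1 => // s /andP[_ s1] _ ts.
    by have -> : s = t by apply/le_anti; rewrite ts (le_trans s1 t1).
  have [t0|t0] := leP 0 t; last first.
    exists (- t); rewrite ?oppr_gt0 // => s /andP[s0 _] + st.
    by rewrite ger0_norm ?subr_ge0 // => h; lra.
  have t01 : 0 <= t < 1 by rewrite t0.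
  have /cvg_enormP /(_ _ e0) := @path_right x t t01.
  rewrite near_withinE => /nbhs_ballP[D /= D0 hD].
  exists D => // s _ sD; rewrite le_eqVlt => /predU1P[<-//|ts].
  by apply: hD => //; rewrite /ball/= distrC.
exists (Num.min D1 D2); first by rewrite lt_min D10.
by move=> s s01; rewrite lt_min => /andP[? ?]; split; [exact: h1|exact: h2].
Qed.

(** Locally bounded by the one-sided limits, hence bounded by compactness. *)
Lemma path_bounded x : exists M, forall t, 0 <= t <= 1 -> enorm (x t) <= M.
Proof.
have := @segment_compact R 0 1.
move=> /compact_near_coveringP /near_covering_withinP.
move=> /(_ nat \oo (fun n t => enorm (x t) <= n%:R)) h.
have [|n _ hn] := h _.
  move=> t; rewrite /= in_itv /= => t01.
  have [D D0 hD] := path_local x t ltr01.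
  pose M := enorm (x t) + enorm (left_lim x t) + 1.
  exists (ball t D, [set n | M <= n%:R]) => /=.
    split; first exact: nbhsx_ballx.
    exists (Num.truncn M).+1 => // n /= Mn.
    apply: (@le_trans _ _ (Num.truncn M).+1%:R); last by rewrite ler_nat.
    by apply/ltW; exact: truncnS_gt.
  move=> [s n] [/= st Mn]; rewrite in_itv /= => s01.
  apply: le_trans Mn; rewrite /M.
  have /hD : 0 <= s <= 1 by [].
  rewrite distrC => /(_ st)[hl hr].
  have [ts|ts] := leP t s.
    have := ler_enormD (x s - x t) (x t); rewrite subrK.
    by move: (hr ts) (enorm_ge0 (left_lim x t)); lra.
  have := ler_enormD (x s - left_lim x t) (left_lim x t); rewrite subrK.
  by move: (hl ts) (enorm_ge0 (x t)); lra.
by exists n%:R => t t01; apply: (hn n) => //=; rewrite in_itv.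
Qed.

Lemma jump_jmp x : jump x = jmp x.
Proof. by rewrite jmp.unlock. Qed.

Lemma jmpE x t : jmp x t = x t - left_lim x t.
Proof. by rewrite jmp.unlock left_lim.unlock. Qed.

(** One-sided limits preserve large inequalities. *)
Lemma left_lim_le x t (z : 'rV[R]_d.+1) b : 0 < t <= 1 ->
  (exists2 r, r < t & forall s, 0 <= s <= 1 -> r < s < t -> enorm (x s - z) <= b) ->
  enorm (left_lim x t - z) <= b.
Proof.
move=> /andP[t0 t1] [r rt h]; apply/ler_addgt0Pr => e e0.
have [D D0 hD] := path_local x t e0.
pose m := Num.max (Num.max 0 r) (t - D).
have mt : m < t by rewrite !gt_max t0 rt ltrBlDr ltrDl D0.
have [m0 mr mD] : [/\ 0 <= m, r <= m & t - D <= m].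
  by split; rewrite /m !le_max lexx ?orbT.
pose s := (m + t) / 2.
have [ms st] : m < s /\ s < t by rewrite /s; clear -mt; split; lra.
have s01 : 0 <= s <= 1 by apply/andP; split; lra.
have sD : `|s - t| < D by rewrite distrC ger0_norm; lra.
have [/(_ st) h1 _] := hD s s01 sD.
have := ler_enorm_dist (x s) (left_lim x t) z.
rewrite (enormB (left_lim x t) (x s)).
have := h s s01; rewrite st andbT => /(_ (le_lt_trans mr ms)).
by move: h1; lra.
Qed.

Lemma right_lim_le x t (z : 'rV[R]_d.+1) b : 0 <= t < 1 ->
  (forall D, 0 < D -> exists2 s, 0 <= s <= 1 & t <= s < t + D /\ enorm (x s - z) <= b) ->
  enorm (x t - z) <= b.
Proof.
move=> /andP[t0 t1] h; apply/ler_addgt0Pr => e e0.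
have [D D0 hD] := path_local x t e0.
have [s s01 [/andP[ts sD] hs]] := h _ D0.
have sD' : `|s - t| < D by rewrite ger0_norm; lra.
have [_ /(_ ts) h1] := hD s s01 sD'.
have := ler_enorm_dist (x s) (x t) z.
by rewrite (enormB (x t) (x s)); move: h1 hs; lra.
Qed.

(** Close to [t], but away from it, the path and its left limit are close to the
    same one-sided limit at [t]. *)
Lemma jump_local x t e : 0 < e -> exists2 D, 0 < D &
  forall s, 0 < s <= 1 -> `|s - t| < D -> s != t -> enorm (jmp x s) < e.
Proof.
move=> e0; have e4 : 0 < e / 4 by rewrite divr_gt0.
have e44 : e / 4 + e / 4 < e by lra.
have [D D0 hD] := path_local x t e4; exists D => // s /andP[s0 s1] sD sNt.
have s01 : 0 <= s <= 1 by rewrite ltW.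
rewrite jmpE; have [hl hr] := hD s s01 sD.
move: sNt sD; rewrite neq_lt => /orP[st|ts] sD.
- have h1 : enorm (left_lim x s - left_lim x t) <= e / 4.
    apply: left_lim_le; first by rewrite s0.
    exists (t - D); first by move: sD; rewrite distrC ger0_norm; lra.
    move=> r r01 /andP[r1 r2].
    have rD : `|r - t| < D by rewrite distrC ger0_norm; lra.
    by have [/(_ (lt_trans r2 st)) /ltW] := hD r r01 rD.
  apply: (enorm_tri_lt (ltW (hl st)) _ e44).
  by rewrite enormB.
- have h1 : enorm (left_lim x s - x t) <= e / 4.
    apply: left_lim_le; first by rewrite s0.
    exists t => // r r01 /andP[r1 r2].
    have rD : `|r - t| < D.
      by rewrite ger0_norm; move: sD; rewrite ger0_norm; lra.
    by have [_ /(_ (ltW r1)) /ltW] := hD r r01 rD.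
  apply: (enorm_tri_lt (ltW (hr (ltW ts))) _ e44).
  by rewrite enormB.
Qed.

Definition big_jumps x e : set R := [set t | 0 < t < 1 /\ e <= enorm (jmp x t)].

(** By [jump_local] big jumps have no accumulation point. *)
Lemma finite_big_jumps x e : 0 < e -> finite_set (big_jumps x e).
Proof.
move=> e0; apply: contrapT => inf.
have [|l /limit_point_infinite_setP hl] :=
    infinite_bounded_limit_point_nonempty inf.
  exists 1; split=> // M M1 t [/andP[t0 t1] _].
  by rewrite /= ger0_norm ?(ltW t0) // ltW // (lt_trans t1).
have [D D0 hD] := jump_local x l e0.
apply: (hl (ball l D)); first exact: nbhsx_ballx.
apply: (sub_finite_set _ (finite_set1 l)) => t [tl [/andP[t0 t1] et]] /=.
apply: contrapT => /eqP tNl; suff : enorm (jmp x t) < e by rewrite ltNge et.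
by apply: hD; rewrite ?t0 ?(ltW t1) // distrC.
Qed.

End path_theory.

(** * The time of the largest jump *)

Lemma finite_set_argmax {R : realType} {T : choiceType} (A : set T) (f : T -> R) :
  finite_set A -> A !=set0 -> exists2 t, A t & forall s, A s -> f s <= f t.
Proof.
move=> /finite_seqP[B ->] [a /= aB].
have hs (s : seq T) : s != [::] ->
    exists2 t, t \in s & forall u, u \in s -> f u <= f t.
  elim: s => // b [_ _|c s /(_ isT)[t ts ht] _].
    by exists b; rewrite ?mem_head // => u; rewrite inE => /eqP ->.
  have [bt|tb] := leP (f b) (f t).
    by exists t => [|u]; rewrite in_cons ?ts ?orbT // => /predU1P[->|/ht].
  exists b => [|u]; rewrite ?mem_head // in_cons => /predU1P[->//|/ht].
  by move/le_trans; apply; exact: ltW.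
by have [|t] := hs B; [apply/eqP => B0; rewrite B0 in aB|exists t].
Qed.

Section tau_theory.
Context {R : realType} {d : nat}.
Implicit Types (x y : skorokhod R d) (t s e : R).

(** What [tau x] is meant to be when the path jumps in (0,1). *)
Definition first_max_jump x t :=
  [/\ 0 < t < 1, 0 < enorm (jmp x t),
      forall s, 0 < s < 1 -> enorm (jmp x s) <= enorm (jmp x t) &
      forall s, 0 < s < t -> enorm (jmp x s) < enorm (jmp x t)].

(** Finitely many jumps are as large as a given one, so the maximal size is
    attained, at finitely many times. *)
Lemma first_max_jump_exists x s :
  0 < s < 1 -> jmp x s <> 0 -> exists t, first_max_jump x t.
Proof.
move=> s01 js.
have es : 0 < enorm (jmp x s).
  by rewrite lt_def enorm_ge0 andbT; apply/eqP => /enorm_eq0.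
have [|t1 [t101 et1] ht1] := finite_set_argmax (fun t => enorm (jmp x t))
  (finite_big_jumps x es); first by exists s; split.
have [||t [[t01 _] jt] ht] := @finite_set_argmax R R
  (big_jumps x (enorm (jmp x s)) `&`
     [set t | enorm (jmp x t) = enorm (jmp x t1)]) (fun t => - t).
- exact/finite_setIl/finite_big_jumps.
- by exists t1.
have le1 r : 0 < r < 1 -> enorm (jmp x r) <= enorm (jmp x t1).
  move=> r01; case/orP: (le_total (enorm (jmp x s)) (enorm (jmp x r))) => h.
    by apply: ht1.
  exact: le_trans h et1.
exists t; split => //.
- by rewrite jt (lt_le_trans es).
- by move=> r r01; rewrite jt le1.
- move=> r /andP[r0 rt]; rewrite jt lt_neqAle.
  have r01 : 0 < r < 1 by rewrite r0 (lt_trans rt) //; case/andP: t01.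
  rewrite le1 // andbT; apply/eqP => jr.
  suff : - r <= - t by rewrite lerN2 leNgt rt.
  by apply: ht; split; [split; rewrite // jr|].
Qed.

Lemma lim_at_right_cst (f : R -> R) (a c e0 : R) : 0 < e0 ->
  (forall e, 0 < e < e0 -> f e = c) -> lim (f e @[e --> 0^'+]) = c.
Proof.
move=> e00 h; apply/cvg_lim => //; apply: cvg_near_cst.
near=> e; apply: h; apply/andP; split; near: e.
  exact: nbhs_right_gt.
exact: nbhs_right_lt.
Unshelve. all: by end_near. Qed.

Lemma max_jump_timesE x e : max_jump_times x e = [set t | 0 < t < 1 /\
  (enorm (jmp x t))%:E = ereal_sup [set (enorm (jmp x s))%:E |
      s in [set s | 0 < s < 1 /\ e < enorm (jmp x s)]]].
Proof. by rewrite /max_jump_times jump_jmp. Qed.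

Lemma tau_nojump x : (forall s, 0 < s < 1 -> jmp x s = 0) -> tau x = 1.
Proof.
move=> h; rewrite /tau /tau_above.
apply: (@lim_at_right_cst _ 0 _ 1) => // e /andP[e0 _].
rewrite max_jump_timesE; case: asboolP => // /eqP/set0P[t [t01]].
rewrite (_ : [set _ | _ in _] = set0) ?ereal_sup0 //.
by apply/seteqP; split => // _ /= [s [/h -> + _]]; rewrite enorm0 ltNge (ltW e0).
Qed.

(** Below the size of the largest jump the threshold [e] does not change the
    supremum, so [tau_above x] is constant near 0. *)
Lemma tau_first_max_jump x t : first_max_jump x t -> tau x = t.
Proof.
move=> [t01 jt ht ht']; rewrite /tau /tau_above.
apply: (@lim_at_right_cst _ 0 _ _ jt) => e /andP[e0 et]; rewrite max_jump_timesE.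
have supE : ereal_sup [set (enorm (jmp x s))%:E |
    s in [set s | 0 < s < 1 /\ e < enorm (jmp x s)]] = (enorm (jmp x t))%:E.
  apply/le_anti/andP; split.
    by apply/ereal_supP => _ [s [s01 _] <-]; rewrite lee_fin ht.
  by apply: ereal_sup_ubound; exists t.
rewrite supE; set A := [set t | _].
have At : A t by [].
case: asboolP => [h|_]; first by rewrite h in At.
apply/le_anti/andP; split.
  apply: ge_inf => //; exists 0 => s [/andP[/ltW]] //.
apply: lb_le_inf; first by exists t.
move=> s [/andP[s0 s1]] [js]; rewrite leNgt; apply/negP => st.
by have := ht' s; rewrite s0 st js ltxx => /(_ isT).
Qed.

Variant tau_spec x : R -> Prop :=
| TauNone of (forall s, 0 < s < 1 -> jmp x s = 0) : tau_spec x 1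
| TauSome t of first_max_jump x t : tau_spec x t.

Lemma tauP x : tau_spec x (tau x).
Proof.
have [h|] := pselect (forall s, 0 < s < 1 -> jmp x s = 0).
  by rewrite (tau_nojump h); constructor.
move=> /existsNP[s /not_implyP[s01 js]].
have [t h] := first_max_jump_exists s01 js.
by rewrite (tau_first_max_jump h); constructor.
Qed.

Lemma tau_itv x : 0 < tau x <= 1.
Proof. by case: tauP => [_|t [/andP[t0 /ltW t1] _ _ _]]; rewrite ?t0 // ltr01 lexx. Qed.

End tau_theory.

(** * The uniform norm and the Skorokhod distance *)

Section sup_norm.
Context {R : realType} {d : nat}.
Implicit Types (x y : skorokhod R d) (t s e : R).

Definition snorm x : R := fine (supnorm x).

Lemma itv01 (t : R) : `[0, 1]%classic t = (0 <= t <= 1) :> Prop.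
Proof. by rewrite /= in_itv. Qed.

Lemma supnorm_le x (M : R) :
  (supnorm x <= M%:E)%E <-> forall t, 0 <= t <= 1 -> enorm (x t) <= M.
Proof.
split=> [/ereal_supP h t t01|h].
  by rewrite -lee_fin; apply: h; exists t; rewrite // itv01.
by apply/ereal_supP => _ [t + <-]; rewrite itv01 lee_fin; exact: h.
Qed.

Lemma supnorm_ge0 x : (0 <= supnorm x)%E.
Proof.
apply: (@le_trans _ _ (enorm (x 0))%:E); first by rewrite lee_fin enorm_ge0.
by apply: ereal_sup_ubound; exists 0 => //; rewrite itv01 lexx ler01.
Qed.

Lemma supnormE x : supnorm x = (snorm x)%:E.
Proof.
have [M] := path_bounded x; move=> /supnorm_le xM.
rewrite fineK // ge0_fin_numE ?supnorm_ge0 //.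
exact: le_lt_trans xM (ltry _).
Qed.

Lemma snorm_ge0 x : 0 <= snorm x.
Proof. by rewrite -lee_fin -supnormE supnorm_ge0. Qed.

Lemma snorm_le x M : snorm x <= M <-> forall t, 0 <= t <= 1 -> enorm (x t) <= M.
Proof. by rewrite -lee_fin -supnormE; exact: supnorm_le. Qed.

Lemma enorm_le_snorm x t : 0 <= t <= 1 -> enorm (x t) <= snorm x.
Proof. by move: t; apply/snorm_le. Qed.

Lemma snorm_scale c x : snorm (sk_scale c x) = `|c| * snorm x.
Proof.
apply/le_anti/andP; split.
  apply/snorm_le => t t01; rewrite /= enormZ ler_wpM2l //.
  exact: enorm_le_snorm.
have [->|c0] := eqVneq c 0; first by rewrite normr0 mul0r snorm_ge0.
have c0' : 0 < `|c| by rewrite normr_gt0.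
rewrite mulrC -ler_pdivlMr //; apply/snorm_le => t t01.
by rewrite ler_pdivlMr // mulrC -enormZ (enorm_le_snorm (sk_scale c x)).
Qed.

Lemma snorm_one_jump z v : 0 <= v <= 1 -> snorm (@one_jump R d z v) = enorm z.
Proof.
move=> v01; apply/le_anti/andP; split.
  by apply/snorm_le => t _ /=; case: ifP; rewrite ?enorm0 ?enorm_ge0.
by have := enorm_le_snorm (one_jump z v) v01; rewrite /= v01 lexx.
Qed.

Lemma sk_scale_one_jump c z v :
  sk_scale c (@one_jump R d z v) = one_jump (c *: z) v.
Proof.
have h : forall x y : skorokhod R d, path_of x = path_of y -> x = y.
  case=> [x px] [y py] /= xy; rewrite xy in px *.
  by rewrite (Prop_irrelevance px py).
by apply: h; apply/funext => t /=; case: ifP; rewrite ?scaler0.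
Qed.

End sup_norm.

Section time_changes.
Context {R : realType}.
Implicit Types (lam mu : R -> R).

Lemma time_change_itv lam t : time_change lam -> 0 <= t <= 1 -> 0 <= lam t <= 1.
Proof. by move=> [_ [+ _ _]] t01 => /(_ t); rewrite !itv01 => ->. Qed.

Lemma time_change_lt lam s t :
  time_change lam -> 0 <= s -> s < t -> t <= 1 -> lam s < lam t.
Proof.
move=> [h _] s0 st t1; apply: h; rewrite // in_itv /=; apply/andP; split => //.
- exact: le_trans (ltW st) t1.
- exact: le_trans s0 (ltW st).
Qed.

Lemma time_change_ltE lam s t : time_change lam ->
  0 <= s <= 1 -> 0 <= t <= 1 -> (lam s < lam t) = (s < t).
Proof.
move=> h /andP[s0 s1] /andP[t0 t1]; apply/idP/idP => [|st]; last first.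
  exact: time_change_lt.
rewrite ltNge (ltNge s t); apply: contra; rewrite le_eqVlt => /predU1P[->//|ts].
exact/ltW/time_change_lt.
Qed.

Lemma time_change_id : time_change (@id R).
Proof. by split => //; split=> // t t01; exists t. Qed.

Lemma time_change_comp lam mu :
  time_change lam -> time_change mu -> time_change (mu \o lam).
Proof.
move=> hl hm; split=> [s t|].
  rewrite !in_itv /= => s01 t01 st.
  by rewrite (time_change_ltE hm) ?(time_change_ltE hl) // (time_change_itv hl).
by case: hl hm => [_ bl] [_ bm]; exact: set_bij_comp bl bm.
Qed.

Lemma time_change_inv lam : time_change lam -> exists mu, [/\ time_change mu,
  forall t, 0 <= t <= 1 -> lam (mu t) = t & forall t, 0 <= t <= 1 -> mu (lam t) = t].
Proof.
move=> hl; have [h [hf hi hs]] := hl.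
have [mu hmu] : exists mu, forall t, 0 <= t <= 1 -> 0 <= mu t <= 1 /\ lam (mu t) = t.
  suff : forall t, exists s, 0 <= t <= 1 -> 0 <= s <= 1 /\ lam s = t.
    by move=> /choice[mu hmu]; exists mu.
  move=> t; have [t01|] := boolP (0 <= t <= 1); last by exists 0.
  by have := hs t; rewrite itv01 => /(_ t01)[s]; rewrite itv01 => s01 <-; exists s.
have lm t : 0 <= t <= 1 -> lam (mu t) = t by move=> /hmu[].
have m01 t : 0 <= t <= 1 -> 0 <= mu t <= 1 by move=> /hmu[].
have ml t : 0 <= t <= 1 -> mu (lam t) = t.
  move=> t01; have l01 := time_change_itv hl t01.
  by apply: hi; rewrite ?lm ?inE ?itv01 ?m01.
exists mu; split => //; split.
  move=> s t; rewrite !in_itv /= => s01 t01 st.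
  by rewrite -(time_change_ltE hl) ?m01 // !lm.
split.
- by move=> t; rewrite !itv01; exact: m01.
- move=> s t; rewrite !inE !itv01 => s01 t01 /(congr1 lam).
  by rewrite !lm.
- move=> t; rewrite itv01 => t01; exists (lam t); last exact: ml.
  by rewrite itv01 (time_change_itv hl).
Qed.

End time_changes.

Section J1_theory.
Context {R : realType} {d : nat}.
Implicit Types (x y z : skorokhod R d) (t s e : R).

(** Billingsley's distance is an infimum of extended reals; all estimates are
    made on real bounds attained by a time change. *)
Definition J1witness (D : R) (lam : R -> R) x y :=
  [/\ time_change lam,
      forall s t, 0 <= s -> s < t -> t <= 1 ->
        `|ln ((lam t - lam s) / (t - s))| <= D &
      forall t, 0 <= t <= 1 -> enorm (x t - y (lam t)) <= D].

Definition J1close (D : R) x y := exists lam, J1witness D lam x y.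

Lemma J1witnessP D lam x y : time_change lam ->
  J1witness D lam x y <->
  (Order.max (log_slope lam)
    (ereal_sup [set (enorm (x t - y (lam t)))%:E | t in `[0%R, 1%R]]) <= D%:E)%E.
Proof.
move=> hl; rewrite ge_max; split=> [[_ h1 h2]|/andP[/ereal_supP h1 /ereal_supP h2]].
  apply/andP; split; apply/ereal_supP.
    by move=> _ [[s t] /= [s0 st t1] <-]; rewrite lee_fin h1.
  by move=> _ [t + <-]; rewrite itv01 lee_fin; exact: h2.
split=> // [s t s0 st t1|t t01]; rewrite -lee_fin.
  by apply: h1; exists (s, t).
by apply: h2; exists t; rewrite // itv01.
Qed.

Lemma J1close_dist_le D x y : J1close D x y -> (J1dist x y <= D%:E)%E.
Proof.
move=> [lam h]; have [hl _ _] := h; move/(J1witnessP _ _ _ hl): h.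
by apply: le_trans; apply: ereal_inf_lbound; exists lam.
Qed.

Lemma J1close_ge0 D x y : J1close D x y -> 0 <= D.
Proof.
move=> [lam [_ _ h]]; apply: le_trans (enorm_ge0 _) (h 0 _).
by rewrite lexx ler01.
Qed.

(** The quantities in the infimum are nonnegative, so those below a real bound
    are real. *)
Lemma J1dist_ltP x y e :
  (J1dist x y < e%:E)%E <-> exists2 D, D < e & J1close D x y.
Proof.
split=> [/ereal_inf_ltP[_ [lam hl <-]]|[D De] /J1close_dist_le]; last first.
  by move/le_lt_trans; apply; rewrite lte_fin.
set v := Order.max _ _ => ve.
have v0 : (0 <= v)%E.
  rewrite le_max; apply/orP; right.
  apply: (@le_trans _ _ (enorm (x 0 - y (lam 0)))%:E); first by rewrite lee_fin enorm_ge0.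
  by apply: ereal_sup_ubound; exists 0 => //; rewrite itv01 lexx ler01.
have vfin : v \is a fin_num by rewrite ge0_fin_numE // (lt_trans ve) ?ltry.
exists (fine v); first by rewrite -lte_fin fineK.
by exists lam; apply/J1witnessP; rewrite // fineK.
Qed.

Lemma J1dist_ge0 x y : (0 <= J1dist x y)%E.
Proof.
rewrite leNgt; apply/negP => /J1dist_ltP[D D0 /J1close_ge0].
by rewrite leNgt D0.
Qed.

Lemma J1close_uniform D x y :
  0 <= D -> (forall t, 0 <= t <= 1 -> enorm (x t - y t) <= D) -> J1close D x y.
Proof.
move=> D0 h; exists id; split=> //; first exact: time_change_id.
by move=> s t _ st _; rewrite divff ?ln1 ?normr0 // subr_eq0 gt_eqF.
Qed.

Lemma J1close_refl D x : 0 <= D -> J1close D x x.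
Proof. by move=> D0; apply: J1close_uniform => // t _; rewrite subrr enorm0. Qed.

Lemma J1close_le (D D' : R) (x y : skorokhod R d) : D <= D' -> J1close D x y -> J1close D' x y.
Proof.
move=> DD' [lam [hl h1 h2]]; exists lam.
by split=> // *; apply: le_trans DD'; auto.
Qed.

(** Inverting a time change inverts its chord slopes, which changes only the sign
    of their logarithms. *)
Lemma J1close_sym D x y : J1close D x y -> J1close D y x.
Proof.
move=> [lam [hl h1 h2]]; have [mu [hm lm ml]] := time_change_inv hl.
exists mu; split=> // [s t s0 st t1|t t01]; last first.
  by rewrite enormB -{2}(lm t t01) h2 // (time_change_itv hm).
have s01 : 0 <= s <= 1 by rewrite s0 (le_trans (ltW st)).
have t01 : 0 <= t <= 1 by rewrite t1 (le_trans s0 (ltW st)).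
have /andP[ms0 ms1] := time_change_itv hm s01.
have /andP[mt0 mt1] := time_change_itv hm t01.
have mst := time_change_lt hm s0 st t1.
have := h1 _ _ ms0 mst mt1; rewrite !lm // -invf_div lnV ?normrN //.
by rewrite posrE divr_gt0 // subr_gt0.
Qed.

(** Chord slopes multiply under composition, so their logarithms add up. *)
Lemma J1close_trans D E x y z :
  J1close D x y -> J1close E y z -> J1close (D + E) x z.
Proof.
move=> [lam [hl h1 h2]] [mu [hm k1 k2]]; exists (mu \o lam); split.
- exact: time_change_comp.
- move=> s t s0 st t1 /=.
  have s01 : 0 <= s <= 1 by rewrite s0 (le_trans (ltW st)).
  have t01 : 0 <= t <= 1 by rewrite t1 (le_trans s0 (ltW st)).
  have /andP[ls0 _] := time_change_itv hl s01.
  have /andP[_ lt1] := time_change_itv hl t01.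
  have lst := time_change_lt hl s0 st t1.
  have mst := time_change_lt hm ls0 lst lt1.
  have -> : (mu (lam t) - mu (lam s)) / (t - s) =
      ((mu (lam t) - mu (lam s)) / (lam t - lam s)) * ((lam t - lam s) / (t - s)).
    by rewrite mulrA divfK // subr_eq0 gt_eqF.
  rewrite lnM ?posrE ?divr_gt0 ?subr_gt0 // addrC.
  by apply: le_trans (ler_normD _ _) _; rewrite lerD ?h1 ?k1.
- move=> t t01 /=; apply: (enorm_tri_le (h2 t t01)) (lexx _).
  by apply: k2; exact: time_change_itv.
Qed.

Lemma J1dist_sym x y : J1dist x y = J1dist y x.
Proof.
suff h (u v : skorokhod R d) : (J1dist u v <= J1dist v u)%E by apply/le_anti/andP; split; exact: h.
rewrite leNgt; apply/negP => vu.
have vufin : J1dist v u \is a fin_num.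
  by rewrite ge0_fin_numE ?J1dist_ge0 // (lt_le_trans vu) // leey.
pose D := fine (J1dist v u).
have [e De eu] : exists2 e, D < e & (e%:E < J1dist u v)%E.
  have : (D%:E < J1dist u v)%E by rewrite fineK.
  case: (J1dist u v) => [r| |//].
    rewrite lte_fin => Dr; exists ((D + r) / 2); rewrite ?lte_fin; lra.
  by move=> _; exists (D + 1); rewrite ?ltry // ltrDl.
have /J1dist_ltP[D' D'e /J1close_sym/J1close_dist_le] : (J1dist v u < e%:E)%E.
  by rewrite -(fineK vufin) lte_fin.
by move=> /(lt_le_trans eu); rewrite lte_fin ltNge (ltW D'e).
Qed.

Lemma J1dist_lt_trans x y z a b : (J1dist x y < a%:E)%E ->
  (J1dist y z < b%:E)%E -> (J1dist x z < (a + b)%:E)%E.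
Proof.
move=> /J1dist_ltP[D Da xy] /J1dist_ltP[E Eb yz]; apply/J1dist_ltP.
by exists (D + E); [exact: ltrD|exact: J1close_trans xy yz].
Qed.

Lemma J1dist_self x : J1dist x x = 0%E.
Proof.
by apply/le_anti; rewrite J1dist_ge0 andbT; apply/J1close_dist_le/J1close_refl.
Qed.

Lemma J1ball_open x e : open [set y | (J1dist x y < e%:E)%E].
Proof.
move=> y /= /J1dist_ltP[D De xy]; exists (e - D); first by rewrite subr_gt0.
move=> z /J1dist_ltP[E Ee yz]; apply/J1dist_ltP.
by exists (D + E); [lra|exact: J1close_trans xy yz].
Qed.

Lemma J1close_snorm D x y : J1close D x y -> snorm x <= snorm y + D.
Proof.
move=> [lam [hl _ h]]; apply/snorm_le => t t01.
have := lerB_enorm (x t) (y (lam t)); rewrite lerBlDr => /le_trans; apply.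
by rewrite addrC lerD ?h // enorm_le_snorm // (time_change_itv hl).
Qed.

Lemma J1close_scale D c x y : J1close D x y ->
  J1close (Num.max 1 `|c| * D) (sk_scale c x) (sk_scale c y).
Proof.
move=> xy; have D0 := J1close_ge0 xy; case: xy => lam [hl h1 h2].
exists lam; split=> // [s t s0 st t1|t t01].
  apply: le_trans (h1 s t s0 st t1) _.
  by rewrite -[leLHS]mul1r ler_wpM2r // le_max lexx.
rewrite /= -scalerBr enormZ ler_pM ?enorm_ge0 ?h2 //.
by rewrite le_max lexx orbT.
Qed.

Lemma J1close_unit x y : snorm x = 1 -> snorm y = 1 -> J1close 2 x y.
Proof.
move=> x1 y1; apply: J1close_uniform => // t t01.
apply: le_trans (ler_enormB _ _) _.
by rewrite (_ : 2 = snorm x + snorm y) ?lerD ?enorm_le_snorm // x1 y1.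
Qed.

End J1_theory.

(** * Continuity of one-jump paths in the jump and its time *)

Section one_jump_continuity.
Context {R : realType} {d : nat}.

(** The piecewise linear bijection of [0,1] carrying [v] to [v'], for [v] and
    [v'] inside (0,1). *)
Definition carry (v v' t : R) : R :=
  if t <= v then t * (v' / v) else v' + (t - v) * ((1 - v') / (1 - v)).

Section carry.
Variables v v' : R.
Hypotheses (v01 : 0 < v < 1) (v'01 : 0 < v' < 1).

Lemma carry_le_iff t : (v' <= carry v v' t) = (v <= t).
Proof.
move: v01 v'01 => /andP[v0 v1] /andP[v'0 v'1].
have a0 : 0 < v' / v by rewrite divr_gt0.
have b0 : 0 < (1 - v') / (1 - v) by rewrite divr_gt0 ?subr_gt0.
rewrite /carry; case: ifPn => [tv|]; last first.
  rewrite -ltNge => vt; rewrite (ltW vt) lerDl.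
  by rewrite mulr_ge0 ?(ltW b0) // subr_ge0 ltW.
by rewrite mulrCA -ler_pdivrMl // mulrC divff ?gt_eqF // ler_pdivlMr // mul1r.
Qed.

(** A chord slope is an average of the slopes of the two pieces. *)
Lemma carry_slope (lo hi : R) s t : lo <= v' / v <= hi ->
  lo <= (1 - v') / (1 - v) <= hi -> s < t ->
  lo * (t - s) <= carry v v' t - carry v v' s <= hi * (t - s).
Proof.
move: v01 => /andP[v0 v1]; rewrite /carry.
have va : v * (v' / v) = v' by rewrite mulrC divfK // gt_eqF.
set a := v' / v in va *; set b := (1 - v') / (1 - v).
move=> /andP[la ah] /andP[lb bh] st.
case: ifPn => tv; case: ifPn => sv.
- have -> : t * a - s * a = a * (t - s) by ring.
  by rewrite !ler_wpM2r // subr_ge0 ltW.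
- by move: tv sv; rewrite -ltNge => ? ?; lra.
- rewrite -ltNge in tv.
  have -> : v' + (t - v) * b - s * a = b * (t - v) + a * (v - s).
    by rewrite -va; ring.
  have -> : t - s = (t - v) + (v - s) by ring.
  rewrite (mulrDr lo) (mulrDr hi).
  by rewrite !lerD // ler_wpM2r // subr_ge0 // ltW.
- have -> : v' + (t - v) * b - (v' + (s - v) * b) = b * (t - s) by ring.
  by rewrite !ler_wpM2r // subr_ge0 ltW.
Qed.

Lemma carry_time_change : time_change (carry v v').
Proof.
move: (v01) (v'01) => /andP[v0 v1] /andP[v'0 v'1].
have a0 : 0 < v' / v by rewrite divr_gt0.
have b0 : 0 < (1 - v') / (1 - v) by rewrite divr_gt0 ?subr_gt0.
pose lo := Num.min (v' / v) ((1 - v') / (1 - v)).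
pose hi := Num.max (v' / v) ((1 - v') / (1 - v)).
have lo0 : 0 < lo by rewrite lt_min a0.
have incr s t : s < t -> carry v v' s < carry v v' t.
  move=> st; have /andP[h _] : lo * (t - s) <= carry v v' t - carry v v' s <= hi * (t - s).
    by apply: carry_slope; rewrite // /lo /hi ge_min le_max lexx ?orbT.
  by rewrite -subr_gt0; apply: lt_le_trans h; rewrite mulr_gt0 // subr_gt0.
have c0 : carry v v' 0 = 0 by rewrite /carry (ltW v0) mul0r.
have c1 : carry v v' 1 = 1.
  by rewrite /carry leNgt v1 /= mulrC divfK ?gt_eqF ?subr_gt0 // subrKC.
have mono s t : s <= t -> carry v v' s <= carry v v' t.
  by rewrite le_eqVlt => /predU1P[->//|/incr/ltW].
split=> [s t _ _ /incr //|]; split.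
- move=> t; rewrite !itv01 => /andP[t0 t1].
  by have := mono _ _ t0; have := mono _ _ t1; rewrite c0 c1 => -> ->.
- move=> s t _ _ st; case: (ltgtP s t) => // /incr; by rewrite st ltxx.
- move=> s; rewrite itv01 => /andP[s0 s1].
  have [sv|sv] := leP s v'.
    have h : s / (v' / v) <= v.
      by rewrite ler_pdivrMr // mulrC divfK // gt_eqF.
    exists (s / (v' / v)); last by rewrite /carry h divfK // gt_eqF.
    by rewrite itv01 divr_ge0 ?(ltW a0) //= (le_trans h) // ltW.
  have h : 0 < (s - v') / ((1 - v') / (1 - v)) by rewrite divr_gt0 // subr_gt0.
  exists (v + (s - v') / ((1 - v') / (1 - v))).
    rewrite itv01 addr_ge0 ?(ltW v0) ?(ltW h) //= -lerBrDl ler_pdivrMr //.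
    by rewrite mulrC divfK ?gt_eqF ?subr_gt0 // lerD2r.
  rewrite /carry leNgt ltrDl h /= addrAC subrr add0r divfK ?gt_eqF //.
  by rewrite subrKC.
Qed.

End carry.

Lemma one_jump_close (v v' D : R) (z z' : 'rV[R]_d.+1) :
  0 < v < 1 -> 0 < v' < 1 -> `|ln (v' / v)| <= D ->
  `|ln ((1 - v') / (1 - v))| <= D -> enorm (z - z') <= D ->
  J1close D (one_jump z v) (one_jump z' v').
Proof.
move=> v01 v'01 ha hb hz.
have bounds r : 0 < r -> `|ln r| <= D -> expR (- D) <= r <= expR D.
  move=> r0; rewrite ler_norml => /andP[h1 h2].
  have rE : r = expR (ln r) by rewrite lnK.
  by rewrite rE !ler_expR h1.
move: (v01) (v'01) => /andP[v0 v1] /andP[v'0 v'1].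
have hc := carry_time_change v01 v'01.
exists (carry v v'); split=> // [s t s0 st t1|t t01].
  have /andP[] : expR (- D) * (t - s) <= carry v v' t - carry v v' s <= expR D * (t - s).
    by apply: carry_slope => //; apply: bounds => //; rewrite divr_gt0 ?subr_gt0.
  have ts : 0 < t - s by rewrite subr_gt0.
  rewrite -(ler_pdivlMr _ _ ts) -(ler_pdivrMr _ _ ts) => h1 h2.
  have q0 := lt_le_trans (expR_gt0 _) h1.
  rewrite ler_norml -[X in X <= _](expRK (- D)) -[X in _ && (_ <= X)](expRK D).
  by rewrite !ler_ln ?posrE ?expR_gt0 // h1 h2.
rewrite /= t01 carry_le_iff // (time_change_itv hc t01) /=.
by case: ifP; rewrite // subr0 enorm0 (le_trans (enorm_ge0 _) hz).
Qed.

Lemma one_jump_near (v e : R) (z : 'rV[R]_d.+1) : 0 < v < 1 -> 0 < e ->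
  exists2 D, 0 < D & forall v' z', 0 < v' < 1 -> `|v' - v| < D ->
    enorm (z' - z) < D -> (J1dist (one_jump z v) (one_jump z' v') < e%:E)%E.
Proof.
move=> /andP[v0 v1] e0; have e20 : 0 < e / 2 by rewrite divr_gt0.
have cont (f : R -> R) : f v = 1 -> {for v, continuous f} ->
    \forall v' \near v, `|ln (f v')| < e / 2.
  move=> f1 cf.
  have : {for v, continuous (@ln R \o f)}.
    by apply: continuous_comp => //; apply: continuous_ln; rewrite f1.
  move=> /cvgrPdist_lt/(_ _ e20); rewrite /= f1 ln1.
  by apply: filterS => v'; rewrite sub0r normrN.
have h1 : \forall v' \near v, `|ln (v' / v)| < e / 2.
  apply: (cont (fun v' => v' / v)); first by rewrite divff // gt_eqF.
  by apply: cvgMr_tmp; exact: cvg_id.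
have h2 : \forall v' \near v, `|ln ((1 - v') / (1 - v))| < e / 2.
  apply: (cont (fun v' => (1 - v') / (1 - v))).
    by rewrite divff // subr_eq0 gt_eqF.
  by apply: cvgMr_tmp; apply: cvgB; [exact: cvg_cst|exact: cvg_id].
have [D /= D0 hD] := (nbhs_ballP _ _).1 (filterI h1 h2).
exists (Num.min D (e / 2)); first by rewrite lt_min D0.
move=> v' z' v'01; rewrite !lt_min => /andP[vD _] /andP[_ zz'].
have [] := hD v'; first by rewrite /ball/= distrC.
move=> l1 l2; apply/J1dist_ltP; exists (e / 2); first by lra.
by apply: one_jump_close; rewrite ?v0 // 1?enormB ltW.
Qed.

Lemma one_jump_same_time (v e : R) (z z' : 'rV[R]_d.+1) : 0 < e ->
  enorm (z' - z) < e -> (J1dist (one_jump z v) (one_jump z' v) < e%:E)%E.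
Proof.
move=> e0 zz'; apply/J1dist_ltP; exists (enorm (z' - z)) => //.
apply: J1close_uniform; first exact: enorm_ge0.
move=> t _ /=; case: ifP; rewrite ?(enormB z) // subrr enorm0 enorm_ge0 //.
Qed.

End one_jump_continuity.

(** * The polar space *)

Section polar_theory.
Context {R : realType} {d : nat}.
Implicit Types (p q : polar R d) (x y : skorokhod R d) (B : set (polar R d)).

(** The coordinate used by [polar_dist]; it is 0 at infinite radius. *)
Definition inv_radius p : R := fine (Defs.radius p)^-1.

Lemma inv_radiusE p : ((Defs.radius p)^-1 = (inv_radius p)%:E)%E.
Proof.
rewrite /inv_radius; have := Defs.radius_gt0 p; case: (Defs.radius p) => [r| |] //.
by rewrite lte_fin => r0; rewrite inver gt_eqF.
Qed.

Lemma inv_radius_ge0 p : 0 <= inv_radius p.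
Proof.
rewrite /inv_radius; have := Defs.radius_gt0 p; case: (Defs.radius p) => [s| |] //.
by rewrite lte_fin => s0; rewrite inver gt_eqF //= invr_ge0 ltW.
Qed.

Lemma polar_dist_ltP p q e : (polar_dist p q < e%:E)%E <->
  `|inv_radius p - inv_radius q| < e /\ (J1dist (direction p) (direction q) < e%:E)%E.
Proof.
rewrite /polar_dist !inv_radiusE gt_max -EFinB abse_EFin lte_fin.
by split=> [/andP|[-> ->]].
Qed.

Lemma polar_dist_le p q e : `|inv_radius p - inv_radius q| <= e ->
  (J1dist (direction p) (direction q) <= e%:E)%E -> (polar_dist p q <= e%:E)%E.
Proof.
by move=> h1 h2; rewrite /polar_dist !inv_radiusE ge_max -EFinB abse_EFin lee_fin h1.
Qed.

Lemma polar_dist_sym p q : polar_dist p q = polar_dist q p.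
Proof. by rewrite /polar_dist !inv_radiusE J1dist_sym -!EFinB !abse_EFin distrC. Qed.

Lemma polar_dist_lt_trans p q r a b : (polar_dist p q < a%:E)%E ->
  (polar_dist q r < b%:E)%E -> (polar_dist p r < (a + b)%:E)%E.
Proof.
move=> /polar_dist_ltP[h1 h2] /polar_dist_ltP[k1 k2]; apply/polar_dist_ltP.
split; last exact: J1dist_lt_trans h2 k2.
by rewrite (le_lt_trans (ler_distD (inv_radius q) _ _)) // ltrD.
Qed.

Lemma polar_dist_self p e : 0 < e -> (polar_dist p p < e%:E)%E.
Proof.
move=> e0; apply/polar_dist_ltP.
by rewrite subrr normr0 J1dist_self lte_fin.
Qed.

(** Two unit paths are at distance at most 2, so only the radius matters for
    boundedness. *)
Lemma polar_boundedP B : polar_bounded B <-> exists C, forall p, B p -> inv_radius p <= C.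
Proof.
split=> [[M hM]|[C hC]].
  have [->|/set0P[q Bq]] := eqVneq B set0; first by exists 0.
  exists (M + inv_radius q) => p Bp; have := hM p q Bp Bq.
  rewrite /polar_dist !inv_radiusE ge_max -EFinB abse_EFin lee_fin => /andP[h _].
  by rewrite -lerBlDr (le_trans (ler_norm _)).
exists (Num.max C 2) => p q Bp Bq; apply: polar_dist_le.
  rewrite le_max; apply/orP; left.
  have := hC p Bp; have := hC q Bq; have := inv_radius_ge0 p; have := inv_radius_ge0 q.
  by rewrite ler_norml => *; lra.
apply: (@le_trans _ _ 2%:E); last by rewrite lee_fin le_max lexx orbT.
have unit u : snorm (direction u) = 1 by rewrite /snorm direction_unit.
exact/J1close_dist_le/J1close_unit.
Qed.

(** ** The polar image of a path *)

Lemma polar_of_snorm x p : polar_of x p -> 0 < snorm x.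
Proof. by move=> [h _]; have := Defs.radius_gt0 p; rewrite h supnormE. Qed.

Lemma polar_of_exists x : 0 < snorm x -> exists p, polar_of x p.
Proof.
move=> x0.
have r0 : (0 < supnorm x)%E by rewrite supnormE.
have u1 : supnorm (sk_scale (fine (supnorm x))^-1 x) = 1%E.
  rewrite supnormE snorm_scale -/(snorm x) ger0_norm ?invr_ge0 ?(ltW x0) //.
  by rewrite mulVf // gt_eqF.
by exists (Polar r0 u1).
Qed.

Lemma polar_of_inj x p q : polar_of x p -> polar_of x q -> p = q.
Proof.
move=> [er eu] [fr fu]; have := etrans eu (esym fu); have := etrans er (esym fr).
case: p q {er eu fr fu} => [r u r0 u1] [r' u' r'0 u'1] /= er eu.
subst r' u'; rewrite (Prop_irrelevance r0 r'0).
by rewrite (Prop_irrelevance u1 u'1).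
Qed.

Lemma inv_radius_polar_of x p : polar_of x p -> inv_radius p = (snorm x)^-1.
Proof.
move=> xp; have x0 := polar_of_snorm xp; rewrite /inv_radius.
by case: xp => -> _; rewrite supnormE inver gt_eqF.
Qed.

(** Away from the origin, the map from a path to its norm and direction is
    uniformly continuous. *)
Lemma polar_of_close (r e : R) : 0 < r -> 0 < e -> exists2 D, 0 < D &
  forall x y p q, r <= snorm x -> J1close D x y ->
    polar_of x p -> polar_of y q -> (polar_dist p q < e%:E)%E.
Proof.
move=> r0 e0; pose D := Num.min (r / 2) (Num.min (e / 2) (Num.min (e * r / 4) (e * r ^+ 2 / 4))).
have [Dr De Der Derr] : [/\ D <= r / 2, D <= e / 2, D <= e * r / 4 & D <= e * r ^+ 2 / 4].
  by split; rewrite /D !ge_min lexx ?orbT.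
have D0 : 0 < D by rewrite !lt_min !(divr_gt0, mulr_gt0, exprn_gt0).
exists D => // x y p q rx xy xp yq.
have a0 := polar_of_snorm xp; have b0 := polar_of_snorm yq.
have ab := J1close_snorm xy; have ba := J1close_snorm (J1close_sym xy).
have inv_radii : `|(snorm x)^-1 - (snorm y)^-1| <= D / (snorm x * snorm y).
  have -> : (snorm x)^-1 - (snorm y)^-1 = (snorm y - snorm x) / (snorm x * snorm y).
    by field; rewrite !gt_eqF.
  rewrite normrM normfV (ger0_norm (ltW (mulr_gt0 a0 b0))).
  rewrite ler_wpM2r // ?invr_ge0 ?mulr_ge0 ?snorm_ge0 // ler_norml; apply/andP.
  by move: ab ba; clear; move: (snorm x) (snorm y) => a b; split; lra.
have yr : r / 2 <= snorm y.
  by move: ab rx Dr; clear; move: (snorm x) (snorm y) => a b *; lra.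
apply/polar_dist_ltP; split.
  rewrite (inv_radius_polar_of xp) (inv_radius_polar_of yq).
  apply: le_lt_trans inv_radii _; rewrite ltr_pdivrMr ?mulr_gt0 //.
  have h : r * (r / 2) <= snorm x * snorm y.
    by rewrite ler_pM // ltW // divr_gt0.
  apply: (@lt_le_trans _ _ (e * (r * (r / 2)))); last by rewrite ler_wpM2l // ltW.
  apply: le_lt_trans Derr _; rewrite -mulrA ltr_pM2l //.
  by have := mulr_gt0 r0 r0; rewrite expr2 mulrA; move: (r * r) => c c0; lra.
apply/J1dist_ltP; exists (e / 2); first by lra.
case: xp yq => _ -> [_ ->]; rewrite -/(snorm x) -/(snorm y).
case: xy => lam [hl h1 h2]; exists lam; split=> // [s t s0 st t1|t t01].
  exact: le_trans (h1 s t s0 st t1) De.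
have l01 := time_change_itv hl t01.
apply: (@enorm_tri_le _ _ ((snorm x)^-1 *: y (lam t)) _ _ (D / r) (D / r)).
- rewrite /= -scalerBr enormZ normfV (ger0_norm (ltW a0)) mulrC.
  by rewrite ler_pM ?enorm_ge0 ?h2 ?invr_ge0 ?(ltW a0) // lef_pV2 ?posrE.
- rewrite /= -scalerBl enormZ.
  apply: (@le_trans _ _ (D / (snorm x * snorm y) * snorm y)).
    by rewrite ler_pM ?enorm_ge0 ?enorm_le_snorm.
  rewrite invfM mulrA divfK ?gt_eqF //.
  by rewrite ler_pM2l // lef_pV2 ?posrE.
- rewrite -mulrDl ler_pdivrMr //.
  have -> : e / 2 * r = e * r / 2 by ring.
  by move: Der; move: (e * r) => c; clear; lra.
Qed.

(** Points of the polar space that are not too close to the origin can be moved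
    along uniformly close paths. *)
Lemma polar_of_transfer (r e : R) : 0 < r -> 0 < e -> exists2 D, 0 < D &
  forall (x y : skorokhod R d) p, J1close D x y -> polar_of x p ->
    inv_radius p <= r^-1 -> exists2 q, polar_of y q & (polar_dist p q < e%:E)%E.
Proof.
move=> r0 e0; have [D D0 hD] := polar_of_close r0 e0.
exists (Num.min D (r / 2)); first by rewrite lt_min D0 divr_gt0.
move=> x y p xy xp pr; have x0 := polar_of_snorm xp.
have rx : r <= snorm x.
  by move: pr; rewrite (inv_radius_polar_of xp) lef_pV2 ?posrE.
have [m1 m2] : Num.min D (r / 2) <= D /\ Num.min D (r / 2) <= r / 2.
  by rewrite !ge_min !lexx orbT.
have y0 : 0 < snorm y.
  have := J1close_snorm xy; move: m2 rx r0; clear.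
  by move: (Num.min _ _) (snorm x) (snorm y) => c1 c2 c3 *; lra.
have [q yq] := polar_of_exists y0; exists q => //.
by apply: hD rx _ xp yq; exact: J1close_le xy.
Qed.

Lemma skorokhod_openP (U : set (skorokhod R d)) : open U <-> (forall x, U x ->
  exists2 e : R, 0 < e & forall y, (J1dist x y < e%:E)%E -> U y).
Proof. by []. Qed.

Lemma polar_openP B : open B <-> (forall p, B p ->
  exists2 e : R, 0 < e & forall q, (polar_dist p q < e%:E)%E -> B q).
Proof. by []. Qed.

Lemma open_polar_trace B : open B -> open (polar_trace B).
Proof.
move=> /polar_openP oB; apply/skorokhod_openP => x [p Bp xp]; have a0 := polar_of_snorm xp.
have [e e0 he] := oB p Bp.
have [D D0 hD] := polar_of_close a0 e0.
have m0 : 0 < Num.min D (snorm x / 2) by rewrite lt_min D0 divr_gt0.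
exists (Num.min D (snorm x / 2)) => // y /J1dist_ltP[D']; rewrite lt_min.
move=> /andP[D'D D'x] xy.
have y0 : 0 < snorm y.
  have := J1close_snorm xy; move: a0 D'x; clear.
  by move: (snorm x) (snorm y) => a b *; lra.
have [q yq] := polar_of_exists y0; exists q => //.
apply: he; apply: (hD x y) => //.
by case: xy => lam [hl h1 h2]; exists lam; split=> // *; apply: le_trans (ltW D'D); auto.
Qed.

Lemma open_snorm_gt r : open [set x : skorokhod R d | r < snorm x].
Proof.
apply/skorokhod_openP => x /= rx; exists (snorm x - r); first by rewrite subr_gt0.
move=> y /J1dist_ltP[D De /J1close_snorm]; move: De; clear.
by move: (snorm x) (snorm y) => a b *; lra.
Qed.

Lemma open_measurable_skorokhod (A : set (skorokhod R d)) :
  open A -> measurable (A : set (borel (skorokhod R d))).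
Proof. exact: sub_sigma_algebra. Qed.

Lemma open_measurable_polar B : open B -> measurable (B : set (borel (polar R d))).
Proof. exact: sub_sigma_algebra. Qed.

(** The trace is a preimage under a map which is continuous on the nonzero paths;
    injectivity of [polar_of] makes traces commute with complements. *)
Lemma measurable_polar_trace B : measurable (B : set (borel (polar R d))) ->
  measurable (polar_trace B : set (borel (skorokhod R d))).
Proof.
move: B; apply: smallest_sub; last first.
  by move=> B oB; apply: open_measurable_skorokhod; apply: open_polar_trace.
split=> /=.
- by rewrite (_ : polar_trace set0 = set0) // -subset0 => x [].
- move=> B mB; rewrite (_ : polar_trace _ =
    [set x : skorokhod R d | 0 < snorm x] `\` polar_trace B).
    apply: measurableD => //.
    by apply: open_measurable_skorokhod; exact: open_snorm_gt.
  apply/seteqP; split=> x.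
    move=> [p [_ nBp] xp]; split; first exact: polar_of_snorm xp.
    by move=> [q Bq xq]; apply: nBp; rewrite (polar_of_inj xp xq).
  move=> [/= /polar_of_exists[p xp] nx]; exists p => //; split=> // Bp.
  by apply: nx; exists p.
- move=> B mB; rewrite (_ : polar_trace _ = \bigcup_k polar_trace (B k)).
    exact: bigcup_measurable.
  apply/seteqP; split=> x.
    by move=> [p [k _ Bkp] xp]; exists k => //; exists p.
  by move=> [k _ [p Bkp xp]]; exists p => //; exists k.
Qed.

Lemma polar_trace_radius (r : R) x : 0 < r ->
  polar_trace [set p | inv_radius p < r^-1] x <-> r < snorm x.
Proof.
move=> r0; split=> [[p /= + xp]|rx].
  by rewrite (inv_radius_polar_of xp) ltf_pV2 ?posrE // (polar_of_snorm xp).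
have x0 := lt_trans r0 rx; have [p xp] := polar_of_exists x0; exists p => //=.
by rewrite (inv_radius_polar_of xp) ltf_pV2 ?posrE.
Qed.

Lemma polar_ball_open p e : open [set q | (polar_dist p q < e%:E)%E].
Proof.
apply/polar_openP => q /= pq.
have [D De pqD] : exists2 D, D < e & (polar_dist p q < D%:E)%E.
  move/polar_dist_ltP: pq => [h /J1dist_ltP[D De /J1close_dist_le hD]].
  pose m := Num.max `|inv_radius p - inv_radius q| D.
  have me : m < e by rewrite gt_max h.
  have [mh mD] : `|inv_radius p - inv_radius q| <= m /\ D <= m.
    by rewrite /m !le_max !lexx orbT.
  have mm : m < (m + e) / 2 by clear -me; lra.
  exists ((m + e) / 2); first by clear -me; lra.
  apply/polar_dist_ltP; split; first exact: le_lt_trans mm.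
  by apply: le_lt_trans hD _; rewrite lte_fin; exact: le_lt_trans mm.
exists (e - D); first by rewrite subr_gt0.
by move=> r qr; have := polar_dist_lt_trans pqD qr; rewrite subrKC.
Qed.

Lemma open_radius (r : R) : open [set p : polar R d | inv_radius p < r].
Proof.
apply/polar_openP => p /= pr; exists (r - inv_radius p); first by rewrite subr_gt0.
move=> q /polar_dist_ltP[+ _] /=; rewrite distrC => /(le_lt_trans (ler_norm _)).
by rewrite ltrBlDr subrK.
Qed.

End polar_theory.

(** * Measurable events *)

Section events.
Context {disp : measure_display} {T : measurableType disp} {R : realType}.

Lemma event_cst (A : Prop) : measurable [set w : T | A].
Proof.
have [a|na] := pselect A.
  by rewrite (_ : [set _ | _] = setT) //; apply/seteqP; split.
by rewrite (_ : [set _ | _] = set0) //; apply/seteqP; split.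
Qed.

Lemma event_and (P Q : T -> Prop) : measurable [set w | P w] ->
  measurable [set w | Q w] -> measurable [set w | P w /\ Q w].
Proof. exact: measurableI. Qed.

Lemma event_or (P Q : T -> Prop) : measurable [set w | P w] ->
  measurable [set w | Q w] -> measurable [set w | P w \/ Q w].
Proof. exact: measurableU. Qed.

Lemma event_not (P : T -> Prop) : measurable [set w | P w] ->
  measurable [set w | ~ P w].
Proof. exact: measurableC. Qed.

Lemma event_imp (P Q : T -> Prop) : measurable [set w | P w] ->
  measurable [set w | Q w] -> measurable [set w | P w -> Q w].
Proof.
move=> mP mQ; rewrite (_ : [set _ | _] = [set w | ~ P w \/ Q w]).
  by apply: event_or => //; exact: event_not.
apply/seteqP; split=> w /= h; last by move=> Pw; case: h.
by have [/h|] := pselect (P w); [right|left].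
Qed.

Lemma event_ex (I : countType) (P : I -> T -> Prop) :
  (forall i, measurable [set w | P i w]) -> measurable [set w | exists i, P i w].
Proof.
move=> mP; rewrite (_ : [set _ | _] = \bigcup_i [set w | P i w]).
  by apply: countable_bigcupT_measurable => //; exact: countableP.
by apply/seteqP; split=> w /= => [[i Pi]|[i _ Pi]]; exists i.
Qed.

Lemma event_all (I : countType) (P : I -> T -> Prop) :
  (forall i, measurable [set w | P i w]) -> measurable [set w | forall i, P i w].
Proof.
move=> mP; rewrite (_ : [set _ | _] = ~` [set w | exists i, ~ P i w]).
  by apply: measurableC; apply: event_ex => i; exact: event_not.
apply/seteqP; split=> w /= => [h [i]|h i]; first by apply.
by apply: contrapT => nP; apply: h; exists i.
Qed.

Lemma event_lt (f g : T -> R) : measurable_fun setT f -> measurable_fun setT g ->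
  measurable [set w | f w < g w].
Proof.
move=> mf mg; have := measurable_fun_ltr mf mg.
by move=> /(_ measurableT [set true] I); rewrite setTI preimage_true.
Qed.

Lemma event_le (f g : T -> R) : measurable_fun setT f -> measurable_fun setT g ->
  measurable [set w | f w <= g w].
Proof.
move=> mf mg; have := measurable_fun_ler mf mg.
by move=> /(_ measurableT [set true] I); rewrite setTI preimage_true.
Qed.

End events.

(** Sums and norms of random vectors are measurable because their coordinates
    are real random variables. *)
Definition measurable_coords {disp : measure_display} {T : measurableType disp}
    {R : realType} {n : nat} (f : T -> 'rV[R]_n) :=
  forall i, measurable_fun setT (fun w => f w 0 i).

Section coords.
Context {disp : measure_display} {T : measurableType disp} {R : realType} {n : nat}.
Implicit Types f g : T -> 'rV[R]_n.

Lemma measurable_coords_borel f :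
  measurable_fun setT (f : T -> borel 'rV[R]_n) -> measurable_coords f.
Proof.
move=> mf i; apply: (measurability _ (RGenOpens.measurableE R)).
move=> _ [_ [a [b ->] <-]].
rewrite setTI (_ : _ @^-1` _ = f @^-1` [set z | `]a, b[%classic (z 0 i)]) //.
rewrite -[X in measurable X]setTI; apply: mf => //; apply: sub_sigma_algebra.
apply: (@open_comp _ _ (fun z : 'rV[R]_n => z 0 i) `]a, b[%classic).
  by move=> z _; exact: coord_continuous.
exact: interval_open.
Qed.

Lemma measurable_coordsB f g : measurable_coords f -> measurable_coords g ->
  measurable_coords (fun w => f w - g w).
Proof.
move=> mf mg i; rewrite (_ : (fun w => _) = (fun w => f w 0 i) \- (fun w => g w 0 i)).
  exact: measurable_funB.
by apply/funext => w /=; rewrite !mxE.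
Qed.

Lemma measurable_coords_cst (z : 'rV[R]_n) : measurable_coords (fun _ : T => z).
Proof. by move=> i; exact: measurable_cst. Qed.

Lemma measurable_enorm f : measurable_coords f ->
  measurable_fun setT (fun w => enorm (f w)).
Proof.
move=> mf; apply: (@measurableT_comp _ _ _ _ _ _ (@Num.sqrt R)).
  by apply: continuous_measurable_fun; exact: sqrt_continuous.
by apply: measurable_sum => i; apply: measurable_funX; exact: mf.
Qed.

End coords.

(** * Jump events in terms of countably many evaluations *)

Section jump_events.
Context {R : realType} {d : nat}.
Implicit Types (x y : skorokhod R d) (t s e : R) (z : 'rV[R]_d.+1).

Definition has_jump x (p q c r : R) z := exists t, p < t < q /\
  c <= enorm (jmp x t) /\ r <= enorm (jmp x t - z).

(** The trace that a jump as in [has_jump] leaves on rational times, up to an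
    error vanishing with [n]. *)
Definition near_jump x (p q c r : R) z (n : nat) (s t : rat) :=
  (p <= ratr s /\ (ratr s : R) < ratr t /\ ratr t <= q /\ ratr t - ratr s < n.+1%:R^-1 :> R) /\
  (c - n.+1%:R^-1 < enorm (x (ratr t) - x (ratr s)) /\
   r - n.+1%:R^-1 < enorm (x (ratr t) - x (ratr s) - z)).

Lemma invn_lt (e : R) : 0 < e -> exists n : nat, n.+1%:R^-1 < e.
Proof.
move=> e0; exists (Num.truncn e^-1).
by rewrite invf_plt ?posrE // truncnS_gt.
Qed.

(** It depends on whether the two times lie on the same side of [t] or not. *)
Lemma increment_local x t e : 0 < e -> exists2 D, 0 < D &
  forall s u, 0 <= s <= 1 -> 0 <= u <= 1 -> s < u ->
    `|s - t| < D -> `|u - t| < D ->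
    enorm (x u - x s) < e \/ enorm (x u - x s - jmp x t) < e.
Proof.
move=> e0; have e20 : 0 < e / 2 by rewrite divr_gt0.
have ee : e / 2 + e / 2 = e by lra.
have [D D0 hD] := path_local x t e20; exists D => // s u s01 u01 su sD uD.
have [ls rs] := hD s s01 sD; have [lu ru] := hD u u01 uD.
have sum2 (a b : 'rV[R]_d.+1) : enorm a < e / 2 -> enorm b < e / 2 ->
    enorm (a - b) < e.
  by move=> ha hb; rewrite (le_lt_trans (ler_enormB _ _)) // -ee ltrD.
have [ut|tu] := ltP u t.
  left; have := sum2 _ _ (lu ut) (ls (lt_trans su ut)).
  by congr (enorm _ < _); apply/rowP => i; rewrite !mxE; ring.
have [st|ts] := ltP s t.
  right; have := sum2 _ _ (ru tu) (ls st).
  by congr (enorm _ < _); rewrite jmpE; apply/rowP => i; rewrite !mxE; ring.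
left; have := sum2 _ _ (ru tu) (rs ts).
by congr (enorm _ < _); apply/rowP => i; rewrite !mxE; ring.
Qed.

(** By compactness, pairs of times at vanishing distance accumulate at some [t].
    Their increments are not small, so by [increment_local] they are close to the
    jump at [t]. *)
Lemma near_jump_has_jump x (p q c r : R) z : 0 <= p -> q <= 1 -> 0 < c ->
  (forall n, exists s t : rat, near_jump x p q c r z n s t) ->
  exists t, p <= t <= q /\ c <= enorm (jmp x t) /\ r <= enorm (jmp x t - z).
Proof.
move=> p0 q1 c0 h; apply: contrapT => nh.
have := @segment_compact R p q.
move=> /compact_near_coveringP /near_covering_withinP.
move=> /(_ nat \oo (fun n s => forall s' t' : rat, ratr s' = s ->
  ~ near_jump x p q c r z n s' t')) cov.
have [|n _ hn] := cov _; last first.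
  have [s [t hst]] := h n; apply: (hn n _ (ratr s) _ s t) => //=.
  by rewrite in_itv /=; case: hst => [[-> [st [tq _]]] _]; rewrite (le_trans (ltW st)).
move=> t; rewrite /= in_itv /= => tpq.
have [e e0 he] : exists2 e, 0 < e & forall v, enorm v < e \/ enorm (v - jmp x t) < e ->
    enorm v <= c - e \/ enorm (v - z) <= r - e.
  have [ct|tc] := ltP (enorm (jmp x t)) c.
    exists (Num.min (c / 2) ((c - enorm (jmp x t)) / 2)).
      by rewrite lt_min !divr_gt0 // subr_gt0.
    set e := Num.min _ _ => v hv; left.
    have [e1 e2] : e <= c / 2 /\ e <= (c - enorm (jmp x t)) / 2.
      by rewrite /e !ge_min !lexx orbT.
    case: hv => hv.
      by move: hv e1; clear; move: (enorm v) => a; lra.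
    have := lerB_enorm v (jmp x t); move: hv e2; clear.
    by move: (enorm v) (enorm (jmp x t)) (enorm (v - _)) => a b w; lra.
  have [rt|tr] := ltP (enorm (jmp x t - z)) r; last by exfalso; apply: nh; exists t.
  exists (Num.min (c / 2) ((r - enorm (jmp x t - z)) / 2)).
    by rewrite lt_min !divr_gt0 // subr_gt0.
  set e := Num.min _ _ => v hv.
  have [e1 e2] : e <= c / 2 /\ e <= (r - enorm (jmp x t - z)) / 2.
    by rewrite /e !ge_min !lexx orbT.
  case: hv => hv; [left|right].
    by move: hv e1; clear; move: (enorm v) => a; lra.
  apply: (enorm_tri_le (ltW hv) (lexx _)); move: e2; clear.
  by move: (enorm _) => a; lra.
have [D D0 hD] := increment_local x t e0.
have D20 : 0 < D / 2 by rewrite divr_gt0.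
have [n1 hn1] := invn_lt e0; have [n2 hn2] := invn_lt D20.
exists (ball t (D / 2), [set n | (maxn n1 n2 <= n)%N]) => /=.
  by split; [exact: nbhsx_ballx|exists (maxn n1 n2)].
move=> [u n] /= [tu]; rewrite geq_max => /andP[n1n n2n] _ s' t' us.
move=> [[ps [st [tq dst]]] [hc hr]].
have le_n k : (k <= n)%N -> n.+1%:R^-1 <= k.+1%:R^-1 :> R.
  by move=> kn; rewrite lef_pV2 ?posrE // ler_nat.
have de : n.+1%:R^-1 < e := le_lt_trans (le_n _ n1n) hn1.
have dD : n.+1%:R^-1 < D / 2 := le_lt_trans (le_n _ n2n) hn2.
have s01 : 0 <= (ratr s' : R) <= 1.
  by rewrite (le_trans p0 ps) (le_trans (ltW st) (le_trans tq q1)).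
have t01 : 0 <= (ratr t' : R) <= 1.
  by rewrite (le_trans p0 (le_trans ps (ltW st))) (le_trans tq q1).
have sD2 : `|ratr s' - t| < D / 2 by rewrite us distrC.
have sD : `|ratr s' - t| < D by apply: lt_trans sD2 _; clear -D0; lra.
have tD : `|ratr t' - t| < D.
  rewrite -(subrKA (ratr s')) (le_lt_trans (ler_normD _ _)) //.
  have -> : D = D / 2 + D / 2 by clear; lra.
  by rewrite ltrD // ger0_norm ?subr_ge0 ?(ltW st) // (lt_trans dst).
have := he _ (hD _ _ s01 t01 st sD tD).
move=> [h1|h1]; [move: hc h1|move: hr h1]; move: de; clear;
  by move: (enorm _) (n.+1%:R^-1) => a b; lra.
Qed.

Lemma has_jump_near_jump x t (p q c r : R) z n : 0 <= p -> q <= 1 -> p < t < q ->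
  c <= enorm (jmp x t) -> r <= enorm (jmp x t - z) ->
  exists s u : rat, near_jump x p q c r z n s u.
Proof.
move=> p0 q1 /andP[pt tq] hc hr; pose e : R := n.+1%:R^-1.
have e0 : 0 < e by rewrite invr_gt0.
have e20 : 0 < e / 2 by rewrite divr_gt0.
have ee : e / 2 + e / 2 = e by lra.
have [D D0 hD] := path_local x t e20.
pose m := Num.max (t - e / 2) (Num.max (t - D) p).
have mt : m < t by rewrite !gt_max pt !ltrBlDr !ltrDl D0 e20.
pose M := Num.min (t + e / 2) (Num.min (t + D) q).
have tM : t < M by rewrite !lt_min tq !ltrDl D0 e20.
have [s] := rat_in_itvoo mt; rewrite in_itv /= !gt_max => /andP[/and3P[se sD ps] st].
have [u] := rat_in_itvoo tM; rewrite in_itv /= !lt_min => /andP[tu /and3P[ue uD uq]].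
have su := lt_trans st tu.
exists s, u; split.
  split; first exact: ltW.
  split=> //; split; first exact: ltW.
  by rewrite -/e; clear -se ue; lra.
have s01 : 0 <= (ratr s : R) <= 1.
  by rewrite (le_trans p0 (ltW ps)) (le_trans (ltW (lt_trans su uq)) q1).
have u01 : 0 <= (ratr u : R) <= 1.
  by rewrite (le_trans p0 (ltW (lt_trans ps su))) (le_trans (ltW uq) q1).
have sD' : `|ratr s - t| < D by rewrite distrC ger0_norm; clear -sD st; lra.
have uD' : `|ratr u - t| < D by rewrite ger0_norm; clear -uD tu; lra.
have [/(_ st) ls _] := hD _ s01 sD'.
have [_ /(_ (ltW tu)) ru] := hD _ u01 uD'.
have hv : enorm (jmp x t - (x (ratr u) - x (ratr s))) < e.
  have -> : jmp x t - (x (ratr u) - x (ratr s)) =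
      (x (ratr s) - left_lim x t) - (x (ratr u) - x t).
    by rewrite jmpE; apply/rowP => i; rewrite !mxE; ring.
  by rewrite (le_lt_trans (ler_enormB _ _)) // -ee ltrD.
rewrite -/e; split.
  have := lerB_enorm (jmp x t) (x (ratr u) - x (ratr s)); move: hc hv; clear.
  by move: (enorm _) (enorm _) (enorm _) => a b w; lra.
have := ler_enorm_dist (x (ratr u) - x (ratr s)) (jmp x t) z; move: hr hv; clear.
by move: (enorm _) (enorm _) (enorm _) => a b w; lra.
Qed.

(** Shrinking (p, q) to rational end points turns the uncountable union over
    jump times into countable operations on increments. *)
Lemma has_jumpE x (p q c r : R) z : 0 <= p -> q <= 1 -> 0 < c ->
  has_jump x p q c r z <-> exists pq : rat * rat,
    (p < ratr pq.1 /\ ratr pq.2 < q) /\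
    forall n, exists st : rat * rat,
      near_jump x (ratr pq.1) (ratr pq.2) c r z n st.1 st.2.
Proof.
move=> p0 q1 c0; split=> [[t [/andP[pt tq] [hc hr]]]|[[p' q'] /= [[pp' q'q] h]]].
  have [p'] := rat_in_itvoo pt; rewrite in_itv /= => /andP[pp' p't].
  have [q'] := rat_in_itvoo tq; rewrite in_itv /= => /andP[tq' q'q].
  exists (p', q'); split => //= n.
  have [|||s [u h]] := @has_jump_near_jump x t (ratr p') (ratr q') c r z n _ _ _ hc hr.
  - exact: le_trans p0 (ltW pp').
  - exact: le_trans (ltW q'q) q1.
  - by rewrite p't.
  by exists (s, u).
have [|||t [/andP[pt tq] ht]] := @near_jump_has_jump x (ratr p') (ratr q') c r z _ _ c0.
- exact: le_trans p0 (ltW pp').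
- exact: le_trans (ltW q'q) q1.
- by move=> n; have [[s u] hsu] := h n; exists s, u.
by exists t; split => //; rewrite (lt_le_trans pp' pt) (le_lt_trans tq q'q).
Qed.

Context {disp : measure_display} {T : measurableType disp}.
Variable X : T -> skorokhod R d.
Hypothesis mX : forall t, 0 <= t <= 1 -> measurable_coords (fun w => X w t).

Lemma measurable_has_jump (p q c r : R) z : 0 <= p -> q <= 1 -> 0 < c ->
  measurable [set w | has_jump (X w) p q c r z].
Proof.
move=> p0 q1 c0; rewrite (_ : [set _ | _] = [set w | exists pq : rat * rat,
    (p < ratr pq.1 /\ ratr pq.2 < q) /\
    forall n, exists st : rat * rat,
      near_jump (X w) (ratr pq.1) (ratr pq.2) c r z n st.1 st.2]); last first.
  by apply/seteqP; split=> w /=; rewrite has_jumpE.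
apply: event_ex => -[p' q'] /=.
have [[pp' q'q]|] := pselect (p < ratr p' /\ ratr q' < q); last first.
  move=> h; rewrite (_ : [set _ | _] = set0) //.
  by rewrite -subset0 => w [/h].
apply: event_and; first exact: event_cst.
apply: event_all => n; apply: event_ex => -[s t] /=.
have [a|na] := pselect (ratr p' <= ratr s :> R /\ ratr s < ratr t :> R /\
    ratr t <= ratr q' :> R /\ ratr t - ratr s < n.+1%:R^-1 :> R); last first.
  rewrite (_ : [set _ | _] = set0) //.
  by rewrite -subset0 => w /= [a _]; case: (na a).
apply: event_and; first exact: event_cst.
case: a => ps [st [tq _]].
have s01 : 0 <= (ratr s : R) <= 1.
  by rewrite (le_trans p0 (le_trans (ltW pp') ps)) (le_trans (ltW st) (le_trans tq (le_trans (ltW q'q) q1))).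
have t01 : 0 <= (ratr t : R) <= 1.
  by rewrite (le_trans p0 (le_trans (ltW pp') (le_trans ps (ltW st)))) (le_trans tq (le_trans (ltW q'q) q1)).
have mi := measurable_coordsB (mX t01) (mX s01).
apply: event_and; apply: event_lt; try exact: measurable_cst.
  exact: measurable_enorm.
by apply: measurable_enorm; apply: measurable_coordsB.
Qed.

End jump_events.

(** * Measurability of the largest jump *)

Section largest_jump_measurable.
Context {R : realType} {d : nat}.
Implicit Types (x y : skorokhod R d) (t s e : R) (z : 'rV[R]_d.+1).

Definition tau_in x (p q r : R) z := exists t, [/\ first_max_jump x t,
  p < t < q & enorm (jmp x t - z) < r].

Lemma has_jump0 x (p q c : R) : has_jump x p q c 0 0 <->
  exists t, p < t < q /\ c <= enorm (jmp x t).
Proof.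
split=> [[t [pq [h _]]]|[t [pq h]]]; exists t => //; split => //.
by split => //; exact: enorm_ge0.
Qed.

(** The rational [c] separates the size of the largest jump from the sizes of the
    earlier jumps, and (a, e) isolates the time of the largest jump among the jumps
    of size at least [c].  Conversely no jump before [b] has size [c], while the
    largest jump size is attained in (a, e): so [tau x] is in [b, e). *)
Lemma tau_inE x (p q r : R) z : 0 <= p -> q <= 1 ->
  tau_in x p q r z <-> exists abec : (rat * rat) * (rat * rat),
    [/\ p < ratr abec.1.1, ratr abec.1.1 < ratr abec.1.2 :> R, ratr abec.1.2 < q,
        ratr abec.2.1 < q & 0 < ratr abec.2.2 :> R] /\
    (~ has_jump x 0 (ratr abec.1.2) (ratr abec.2.2) 0 0) /\
    has_jump x (ratr abec.1.1) (ratr abec.2.1) (ratr abec.2.2) 0 0 /\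
    (~ has_jump x (ratr abec.1.1) (ratr abec.2.1) (ratr abec.2.2) r z) /\
    (forall c' : rat, 0 < ratr c' :> R -> has_jump x 0 1 (ratr c') 0 0 ->
      has_jump x (ratr abec.1.1) (ratr abec.2.1) (ratr c') 0 0).
Proof.
move=> p0 q1; split.
  move=> [t [[t01 jt maxt firstt] /andP[pt tq] jz]].
  pose M := enorm (jmp x t).
  have M20 : 0 < M / 2 by rewrite divr_gt0.
  (* jumps before t stay bounded away from the maximal size, because only
     finitely many of them exceed half of it *)
  have [m [Mm mM hm]] : exists m, [/\ M / 2 <= m, m < M &
      forall s, 0 < s < t -> enorm (jmp x s) <= m].
    pose A := big_jumps x (M / 2) `&` [set s | s < t].
    have finA : finite_set A by apply: finite_setIl; exact: finite_big_jumps.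
    have small s : ~ A s -> 0 < s < t -> enorm (jmp x s) <= M / 2.
      move=> nA /andP[s0 st]; case/orP: (le_total (enorm (jmp x s)) (M / 2)) => // h.
      exfalso; apply: nA; split => //; split => //.
      by rewrite s0 (lt_trans st) //; case/andP: t01.
    have [A0|/set0P A0] := eqVneq A set0.
      exists (M / 2); split => //; first by rewrite /M; clear -jt; move: (enorm _) jt => a; lra.
      by move=> s; apply: small; rewrite A0.
    have [s0 [[/andP[s00 _] As0] s0t] hs0] := finite_set_argmax (fun s => enorm (jmp x s)) finA A0.
    exists (enorm (jmp x s0)); split => //; first by apply: firstt; rewrite s00.
    move=> s s0t'; have [/hs0 //|/small h] := pselect (A s).
    exact: le_trans (h s0t') As0.
  have [c] := rat_in_itvoo mM; rewrite in_itv /= => /andP[mc cM].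
  have c0 : 0 < (ratr c : R) by apply: lt_trans mc; exact: lt_le_trans Mm.
  have [D D0 hD] := jump_local x t c0.
  have lt_a : Num.max p (t - D) < t by rewrite gt_max pt ltrBlDr ltrDl.
  have lt_e : t < Num.min q (t + D) by rewrite lt_min tq ltrDl.
  have [a] := rat_in_itvoo lt_a; rewrite in_itv /= gt_max => /andP[/andP[pa Da] at_].
  have [b] := rat_in_itvoo at_; rewrite in_itv /= => /andP[ab bt].
  have [e] := rat_in_itvoo lt_e; rewrite in_itv /= lt_min => /andP[te /andP[eq_ eD]].
  have only s : ratr a < s < ratr e -> ratr c <= enorm (jmp x s) -> s = t.
    move=> /andP[as_ se] cs; apply: contrapT => /eqP st.
    have : enorm (jmp x s) < ratr c.
      apply: hD => //.
        rewrite (le_lt_trans p0 (lt_trans pa as_)).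
        by rewrite (le_trans (ltW (lt_trans se eq_)) q1).
      by rewrite ltr_distl; apply/andP; split; [exact: lt_trans as_|exact: lt_trans eD].
    by rewrite ltNge cs.
  exists ((a, b), (e, c)); split.
    by split => //=; exact: lt_trans tq.
  split; last split; last split.
  - move=> /has_jump0[s [/andP[s0 sb] cs]].
    have : enorm (jmp x s) <= m by apply: hm; rewrite s0 (lt_trans sb).
    by rewrite leNgt (lt_le_trans mc).
  - by apply/has_jump0; exists t; rewrite at_ te; split => //; exact: ltW.
  - move=> [s [sae [cs rs]]]; move: rs; rewrite (only s sae cs).
    by rewrite leNgt jz.
  - move=> c' c'0 /has_jump0[s [s01 c's]]; apply/has_jump0; exists t.
    by rewrite at_ te; split => //; exact: le_trans c's (maxt s s01).
move=> [[[a b] [e c]] /= [[pa ab bq eq_ c0] [before [/has_jump0[s0 [s0ae cs0]] [near_z attained]]]]].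
have ae01 s : ratr a < s < ratr e -> 0 < s < 1.
  move=> /andP[as_ se]; rewrite (le_lt_trans p0 (lt_trans pa as_)).
  by rewrite (lt_le_trans (lt_trans se eq_) q1).
have [|t ht] := @first_max_jump_exists _ _ x s0 (ae01 _ s0ae).
  by move=> j0; move: cs0; rewrite j0 enorm0 leNgt c0.
have [t01 jt maxt firstt] := ht.
have ct : ratr c <= enorm (jmp x t) := le_trans cs0 (maxt s0 (ae01 _ s0ae)).
have bt : ratr b <= t.
  rewrite leNgt; apply/negP => tb; apply: before; apply/has_jump0; exists t.
  by rewrite tb; case/andP: t01 => ->.
(* the maximal size is attained in (a, e), and not only approached *)
have [s sae js] : exists2 s, ratr a < s < ratr e & enorm (jmp x t) <= enorm (jmp x s).
  pose A := big_jumps x (ratr c) `&` [set s | ratr a < s < ratr e].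
  have [||s [[s01 cs] sae] hs] := @finite_set_argmax R R A (fun s => enorm (jmp x s)).
  - exact/finite_setIl/finite_big_jumps.
  - by exists s0; split => //; split => //; exact: ae01.
  exists s => //; case/orP: (le_total (enorm (jmp x t)) (enorm (jmp x s))) => // st.
  rewrite leNgt; apply/negP => {}st.
  have [c'] := rat_in_itvoo st; rewrite in_itv /= => /andP[sc' c't].
  have c'0 : 0 < (ratr c' : R) := lt_trans (lt_le_trans c0 cs) sc'.
  have /attained : (0 : R) < ratr c' by [].
  have h01 : has_jump x 0 1 (ratr c') 0 0.
    by apply/has_jump0; exists t; split => //; exact: ltW.
  move=> /(_ h01)/has_jump0[u [uae c'u]].
  have : enorm (jmp x u) <= enorm (jmp x s).
    apply: hs; split => //; split; first exact: ae01.
    by apply: le_trans c'u; apply: le_trans cs (ltW sc').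
  by rewrite leNgt (lt_le_trans sc').
have ts : t <= s.
  rewrite leNgt; apply/negP => st.
  have := firstt s; case/andP: (ae01 _ sae) => -> _; rewrite st.
  by move=> /(_ isT); rewrite ltNge js.
have tae : ratr a < t < ratr e.
  by rewrite (lt_le_trans ab bt) (le_lt_trans ts) //; case/andP: sae.
exists t; split => //.
  by case/andP: tae => h1 h2; rewrite (lt_trans pa h1) (lt_trans h2).
rewrite ltNge; apply/negP => rz; apply: near_z.
by exists t.
Qed.

Context {disp : measure_display} {T : measurableType disp}.
Variable X : T -> skorokhod R d.
Hypothesis mX : forall t, 0 <= t <= 1 -> measurable_coords (fun w => X w t).

Lemma measurable_tau_in (p q r : R) z : 0 <= p -> q <= 1 ->
  measurable [set w | tau_in (X w) p q r z].
Proof.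
move=> p0 q1; rewrite (_ : [set _ | _] = [set w | exists abec : (rat * rat) * (rat * rat),
    [/\ p < ratr abec.1.1, ratr abec.1.1 < ratr abec.1.2 :> R, ratr abec.1.2 < q,
        ratr abec.2.1 < q & 0 < ratr abec.2.2 :> R] /\
    (~ has_jump (X w) 0 (ratr abec.1.2) (ratr abec.2.2) 0 0) /\
    has_jump (X w) (ratr abec.1.1) (ratr abec.2.1) (ratr abec.2.2) 0 0 /\
    (~ has_jump (X w) (ratr abec.1.1) (ratr abec.2.1) (ratr abec.2.2) r z) /\
    (forall c' : rat, 0 < ratr c' :> R -> has_jump (X w) 0 1 (ratr c') 0 0 ->
      has_jump (X w) (ratr abec.1.1) (ratr abec.2.1) (ratr c') 0 0)]); last first.
  by apply/seteqP; split=> w /=; rewrite tau_inE.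
apply: event_ex => -[[a b] [e c]] /=.
have [C|nC] := pselect [/\ p < ratr a, ratr a < ratr b :> R, ratr b < q,
        ratr e < q & 0 < ratr c :> R]; last first.
  rewrite (_ : [set _ | _] = set0) //.
  by rewrite -subset0 => w /= [h _]; case: (nC h).
apply: event_and; first exact: event_cst.
case: C => pa ab bq eq_ c0.
have a0 : 0 <= (ratr a : R) by rewrite (le_trans p0) // ltW.
have b1 : (ratr b : R) <= 1 by rewrite (le_trans (ltW bq)).
have e1 : (ratr e : R) <= 1 by rewrite (le_trans (ltW eq_)).
apply: event_and; first by apply: event_not; apply: measurable_has_jump.
apply: event_and; first by apply: measurable_has_jump.
apply: event_and; first by apply: event_not; apply: measurable_has_jump.
apply: event_all => c'.
have [c'0|c'0] := ltP 0 (ratr c' : R); last first.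
  rewrite (_ : [set _ | _] = setT) //; apply/seteqP; split=> // w _ /=.
apply: event_imp; first exact: event_cst.
by apply: event_imp; apply: measurable_has_jump.
Qed.

Definition no_jump x := forall s, 0 < s < 1 -> jmp x s = 0.

Lemma no_jumpE x : no_jump x <->
  forall c : rat, 0 < ratr c :> R -> ~ has_jump x 0 1 (ratr c) 0 0.
Proof.
split=> [h c c0 /has_jump0[s [s01]]|h s s01].
  by rewrite h // enorm0 leNgt c0.
apply: contrapT => js; have es : 0 < enorm (jmp x s).
  by rewrite lt_def enorm_ge0 andbT; apply/eqP => /enorm_eq0.
have [c] := rat_in_itvoo es; rewrite in_itv /= => /andP[c0 ce].
by apply: (h c c0); apply/has_jump0; exists s; split => //; exact: ltW.
Qed.

Lemma measurable_no_jump : measurable [set w | no_jump (X w)].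
Proof.
rewrite (_ : [set _ | _] = [set w | forall c : rat, 0 < ratr c :> R ->
    ~ has_jump (X w) 0 1 (ratr c) 0 0]); last first.
  by apply/seteqP; split=> w /=; rewrite no_jumpE.
apply: event_all => c; have [c0|c0] := ltP 0 (ratr c : R); last first.
  by rewrite (_ : [set _ | _] = setT) //; apply/seteqP; split.
by apply: event_imp; [exact: event_cst|apply: event_not; apply: measurable_has_jump].
Qed.

Definition before1 (n : nat) : R := 1 - n.+1%:R^-1.

Lemma before1_itv n : 0 <= before1 n <= 1.
Proof.
by rewrite /before1 subr_ge0 invf_le1 ?ler1n //=.
Qed.

Lemma before1_lt n : before1 n < 1.
Proof. by rewrite /before1 ltrBlDr ltrDl invr_gt0. Qed.

Lemma increment_before1 x e : 0 < e -> exists N, forall n, (N <= n)%N ->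
  enorm (x 1 - x (before1 n) - jmp x 1) < e.
Proof.
move=> e0; have [D D0 hD] := path_local x 1 e0.
have [N hN] := invn_lt D0; exists N => n Nn.
have nD : `|before1 n - 1| < D.
  rewrite distrC ger0_norm ?subr_ge0 ?(ltW (before1_lt n)) // /before1 subKr.
  by apply: le_lt_trans hN; rewrite lef_pV2 ?posrE // ler_nat.
have [/(_ (before1_lt n)) h _] := hD _ (before1_itv n) nD.
have -> : x 1 - x (before1 n) - jmp x 1 = - (x (before1 n) - left_lim x 1).
  by rewrite jmpE; apply/rowP => i; rewrite !mxE; ring.
by rewrite enormN.
Qed.

Lemma jump_at1E x z r : enorm (jmp x 1 - z) < r <-> exists kN : nat * nat,
  forall n, (kN.2 <= n)%N ->
    enorm (x 1 - x (before1 n) - z) <= r - kN.1.+1%:R^-1.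
Proof.
split=> [jr|[[k N] /= h]].
  have e0 : 0 < (r - enorm (jmp x 1 - z)) / 2 by rewrite divr_gt0 // subr_gt0.
  have [k hk] := invn_lt e0; have [N hN] := increment_before1 x e0.
  exists (k, N) => n /hN/ltW h /=; apply: (enorm_tri_le h (lexx _)).
  by move: hk; clear; move: (enorm _) (_^-1) => a b; lra.
have k0 : 0 < k.+1%:R^-1 :> R by rewrite invr_gt0.
have [M hM] := increment_before1 x k0.
have h2 := h _ (leq_maxr M N).
apply: le_lt_trans (ler_enorm_dist (x 1 - x (before1 (maxn M N))) _ _) _.
have := hM _ (leq_maxl M N); rewrite enormB; move: h2; clear.
by move: (enorm _) (enorm _) (_^-1) => a b c *; lra.
Qed.

Lemma measurable_jump_at1 z r : measurable [set w | enorm (jmp (X w) 1 - z) < r].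
Proof.
rewrite (_ : [set _ | _] = [set w | exists kN : nat * nat,
    forall n, (kN.2 <= n)%N ->
    enorm (X w 1 - X w (before1 n) - z) <= r - kN.1.+1%:R^-1]); last first.
  by apply/seteqP; split=> w /=; rewrite jump_at1E.
apply: event_ex => -[k N]; apply: event_all => n /=.
apply: event_imp; first exact: event_cst.
apply: event_le; last exact: measurable_cst.
apply: measurable_enorm; apply: measurable_coordsB; last exact: measurable_coords_cst.
by apply: measurable_coordsB; apply: mX; rewrite ?before1_itv // ler01 lexx.
Qed.

End largest_jump_measurable.

(** ** Random paths and rational data *)

Section rational_vectors.
Context {R : realType} {n : nat}.

Lemma rat_vector (z : 'rV[R]_n) (e : R) : 0 < e ->
  exists q : 'rV[rat]_n, enorm (z - map_mx ratr q) < e.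
Proof.
move=> e0; have e'0 : 0 < e / n.+1%:R by rewrite divr_gt0.
have h i : exists q : rat, `|z 0 i - ratr q| < e / n.+1%:R.
  have zz : z 0 i - e / n.+1%:R < z 0 i + e / n.+1%:R.
    by rewrite (@lt_trans _ _ (z 0 i)) // ?ltrDl // gtrBl.
  have [q] := rat_in_itvoo zz.
  rewrite in_itv /= => /andP[h1 h2]; exists q.
  by rewrite ltr_distlC h1.
have [f hf] := choice h; exists (\row_i f i).
set v := z - _.
have hv : `|v| <= e / n.+1%:R.
  rewrite [leLHS]/Num.norm/= mx_normrE; apply/bigmax_leP; split=> [|[i j] _ /=].
    exact: ltW.
  by rewrite ord1 !mxE ltW.
apply: le_lt_trans (enorm_le_norm v) _.
apply: (@le_lt_trans _ _ (n%:R * (e / n.+1%:R))); first by rewrite ler_wpM2l.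
rewrite mulrCA -[ltRHS]mulr1 ltr_pM2l // ltr_pdivrMr // mul1r ltr_nat.
by [].
Qed.

End rational_vectors.

Section random_elements.
Context {R : realType} {d : nat}.
Context {disp : measure_display} {T : measurableType disp}.

Lemma measurable_skorokhod_map (X : T -> skorokhod R d) :
  (forall U : set (skorokhod R d), open U -> measurable (X @^-1` U)) ->
  measurable_fun setT (X : T -> borel (skorokhod R d)).
Proof.
move=> h; apply: (@measurability _ _ T (borel (skorokhod R d)) setT X
  (@open (skorokhod R d))) => //.
by move=> _ [U oU <-]; rewrite setTI; exact: h.
Qed.

Lemma measurable_skorokhod_open (X : T -> skorokhod R d) (U : set (skorokhod R d)) :
  measurable_fun setT (X : T -> borel (skorokhod R d)) -> open U ->
  measurable (X @^-1` U).
Proof.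
move=> mX oU; rewrite -[X in measurable X]setTI; apply: mX => //.
exact: open_measurable_skorokhod.
Qed.

Lemma measurable_sk_scale (X : T -> skorokhod R d) (c : R) :
  measurable_fun setT (X : T -> borel (skorokhod R d)) ->
  measurable_fun setT ((fun w => sk_scale c (X w)) : T -> borel (skorokhod R d)).
Proof.
move=> mX; apply: measurable_skorokhod_map => U /skorokhod_openP oU.
rewrite (_ : _ @^-1` U = X @^-1` [set x | U (sk_scale c x)]) //.
apply: measurable_skorokhod_open => //; apply/skorokhod_openP => x /= /oU[e e0 he].
have m0 : 0 < Num.max 1 `|c| by rewrite lt_max ltr01.
exists (e / Num.max 1 `|c|); first by rewrite divr_gt0.
move=> y /J1dist_ltP[D De /(J1close_scale c) xy]; apply/he/J1dist_ltP.
by exists (Num.max 1 `|c| * D) => //; rewrite mulrC -ltr_pdivlMr.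
Qed.

Lemma measurable_snorm (X : T -> skorokhod R d) r :
  measurable_fun setT (X : T -> borel (skorokhod R d)) ->
  measurable [set w | r < snorm (X w)].
Proof.
move=> mX; apply: (measurable_skorokhod_open (U := [set x | r < snorm x])) => //.
exact: open_snorm_gt.
Qed.

(** A jump at time 1 cannot be moved inside (0,1), but 1 is rational. *)
Lemma one_jump_dense (z : 'rV[R]_d.+1) (v e : R) : 0 < v <= 1 -> 0 < e ->
  exists (q : 'rV[rat]_d.+1) (u : rat),
    (J1dist (one_jump z v) (one_jump (map_mx ratr q) (ratr u)) < e%:E)%E.
Proof.
move=> /andP[v0]; rewrite le_eqVlt => /predU1P[->|v1] e0.
  have [q hq] := rat_vector z e0; exists q, 1%Q; rewrite rmorph1.
  by apply: one_jump_same_time; rewrite // enormB.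
have v01 : 0 < v < 1 by rewrite v0.
have [D D0 hD] := one_jump_near z v01 e0.
have [q hq] := rat_vector z D0.
have lt_u : v < Num.min 1 (v + D) by rewrite lt_min v1 ltrDl.
have [u] := rat_in_itvoo lt_u; rewrite in_itv /= lt_min => /andP[vu /andP[u1 uD]].
exists q, u; apply: hD; last by rewrite enormB.
- by rewrite (lt_trans v0 vu).
- by rewrite ger0_norm ?subr_ge0 ?(ltW vu) // ltrBlDl.
Qed.

(** The distance to a random one-jump path is tested against the countably many
    one-jump paths with rational data, which are dense among one-jump paths. *)
Lemma measurable_J1dist_one_jump (X : T -> skorokhod R d) (Z : T -> 'rV[R]_d.+1)
    (V : T -> R) (e : R) :
  measurable_fun setT (X : T -> borel (skorokhod R d)) ->
  measurable_fun setT ((fun w => one_jump (Z w) (V w)) : T -> borel (skorokhod R d)) ->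
  (forall w, 0 < V w <= 1) ->
  measurable [set w | (J1dist (X w) (one_jump (Z w) (V w)) < e%:E)%E].
Proof.
move=> mX mY hV; rewrite (_ : [set _ | _] =
   [set w | exists quab : ('rV[rat]_d.+1 * rat) * rat,
     (J1dist (one_jump (map_mx ratr quab.1.1) (ratr quab.1.2)) (X w)
       < (e - ratr quab.2)%:E)%E /\
     (J1dist (one_jump (map_mx ratr quab.1.1) (ratr quab.1.2)) (one_jump (Z w) (V w))
       < (ratr quab.2)%:E)%E]).
  apply: event_ex => -[[q u] b] /=; apply: event_and.
    apply: (measurable_skorokhod_open (U := [set x | (J1dist _ x < _%:E)%E])) => //.
    exact: J1ball_open.
  apply: (measurable_skorokhod_open (X := fun w => one_jump (Z w) (V w))
    (U := [set x | (J1dist _ x < _%:E)%E])) => //.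
  exact: J1ball_open.
apply/seteqP; split=> w /=.
  move=> /J1dist_ltP[D De hD].
  have lt_b : 0 < (e - D) / 4 by rewrite divr_gt0 // subr_gt0.
  have [b] := rat_in_itvoo lt_b; rewrite in_itv /= => /andP[b0 bD].
  have [q [u hqu]] := one_jump_dense (Z w) (hV w) b0.
  exists ((q, u), b) => /=; split; last by rewrite J1dist_sym.
  rewrite J1dist_sym.
  have h : (J1dist (X w) (one_jump (Z w) (V w)) < ((e + D) / 2)%:E)%E.
    by apply/J1dist_ltP; exists D => //; clear -De; lra.
  apply: lt_le_trans (J1dist_lt_trans h hqu) _; rewrite lee_fin.
  by clear -bD De; move: (ratr b) bD => c bD; lra.
move=> [[[q u] b] /= [h1 h2]]; rewrite J1dist_sym in h1.
by have := J1dist_lt_trans h1 h2; rewrite subrK.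
Qed.

End random_elements.

Section largest_jump_random.
Context {R : realType} {d : nat}.
Context {disp : measure_display} {T : measurableType disp}.
Variable X : T -> skorokhod R d.
Hypothesis mX : forall t, 0 <= t <= 1 -> measurable_coords (fun w => X w t).

Lemma largest_jumpE (x : skorokhod R d) :
  largest_jump x = one_jump (jmp x (tau x)) (tau x).
Proof. by rewrite /largest_jump jump_jmp. Qed.

(** An open set of one-jump paths is a countable union of boxes with rational
    data in the (jump, time) coordinates. *)
Lemma largest_jump_in_open (U : set (skorokhod R d)) (x : skorokhod R d) : open U ->
  U (largest_jump x) <->
  (exists zpqr : ('rV[rat]_d.+1 * rat) * (rat * rat),
    [/\ 0 <= ratr zpqr.1.2 :> R, ratr zpqr.2.1 <= 1 :> R &
     forall v z, ratr zpqr.1.2 < v < ratr zpqr.2.1 ->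
      enorm (z - map_mx ratr zpqr.1.1) < ratr zpqr.2.2 -> U (one_jump z v)] /\
    tau_in x (ratr zpqr.1.2) (ratr zpqr.2.1) (ratr zpqr.2.2) (map_mx ratr zpqr.1.1)) \/
  (no_jump x /\ exists zr : 'rV[rat]_d.+1 * rat,
    (forall z, enorm (z - map_mx ratr zr.1) < ratr zr.2 -> U (one_jump z 1)) /\
    enorm (jmp x 1 - map_mx ratr zr.1) < ratr zr.2).
Proof.
move=> /skorokhod_openP oU; rewrite largest_jumpE; split; last first.
  move=> [[[[z p] [q r]] /= [[p0 q1 hU] [t [ht pq zr]]]]|[nj [[z r] /= [hU zr]]]].
    by rewrite (tau_first_max_jump ht); exact: hU.
  by rewrite (tau_nojump nj); exact: hU.
case: tauP => [nj|t ht] /oU[e e0 he]; [right|left].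
  split=> //; have [r] := rat_in_itvoo e0; rewrite in_itv /= => /andP[r0 re].
  have r20 : 0 < ratr r / 2 :> R by rewrite divr_gt0.
  have [z hz] := rat_vector (jmp x 1) r20.
  have [r'] := rat_in_itvoo r20; rewrite in_itv /= => /andP[r'0 r'r].
  have [z' hz'] := rat_vector (jmp x 1) r'0.
  exists (z', r'); split => //= y hy; apply: he.
  apply: one_jump_same_time => //.
  rewrite enormB in hz'.
  apply: (enorm_tri_lt (ltW hy) (ltW hz')).
  by clear -re r'r r'0; move: (ratr r) (ratr r') re r'r r'0 => a b *; lra.
have [t01 _ _ _] := ht.
have [D D0 hD] := one_jump_near (jmp x t) t01 e0.
have D20 : 0 < D / 2 by rewrite divr_gt0.
have [r] := rat_in_itvoo D20; rewrite in_itv /= => /andP[r0 rD].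
have [z hz] := rat_vector (jmp x t) r0.
move: (t01) => /andP[t0 t1].
have lt_p : Num.max 0 (t - D) < t by rewrite gt_max t0 ltrBlDr ltrDl.
have lt_q : t < Num.min 1 (t + D) by rewrite lt_min t1 ltrDl.
have [p] := rat_in_itvoo lt_p; rewrite in_itv /= gt_max => /andP[/andP[p0 pD] pt].
have [q] := rat_in_itvoo lt_q; rewrite in_itv /= lt_min => /andP[tq /andP[q1 qD]].
exists ((z, p), (q, r)) => /=; split; last first.
  by exists t; rewrite pt tq.
split=> [||v y /andP[pv vq] hy]; [exact: ltW|exact: ltW|].
apply/he/hD.
- by rewrite (lt_trans p0 pv) (lt_trans vq q1).
- by rewrite ltr_distl; apply/andP; split; [exact: lt_trans pv|exact: lt_trans qD].
- rewrite enormB in hz; apply: (enorm_tri_lt (ltW hy) (ltW hz)).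
  by clear -rD; move: (ratr r) rD => a *; lra.
Qed.

Lemma measurable_largest_jump : measurable_fun setT
  ((fun w => largest_jump (X w)) : T -> borel (skorokhod R d)).
Proof.
apply: measurable_skorokhod_map => U oU.
rewrite (_ : _ @^-1` U = [set w | (exists zpqr : ('rV[rat]_d.+1 * rat) * (rat * rat),
    [/\ 0 <= ratr zpqr.1.2 :> R, ratr zpqr.2.1 <= 1 :> R &
     forall v z, ratr zpqr.1.2 < v < ratr zpqr.2.1 ->
      enorm (z - map_mx ratr zpqr.1.1) < ratr zpqr.2.2 -> U (one_jump z v)] /\
    tau_in (X w) (ratr zpqr.1.2) (ratr zpqr.2.1) (ratr zpqr.2.2) (map_mx ratr zpqr.1.1)) \/
  (no_jump (X w) /\ exists zr : 'rV[rat]_d.+1 * rat,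
    (forall z, enorm (z - map_mx ratr zr.1) < ratr zr.2 -> U (one_jump z 1)) /\
    enorm (jmp (X w) 1 - map_mx ratr zr.1) < ratr zr.2)]); last first.
  by apply/seteqP; split=> w /=; rewrite largest_jump_in_open.
apply: event_or.
  apply: event_ex => -[[z p] [q r]] /=; set A := [/\ _, _ & _].
  have [[p0 q1 hU]|nA] := pselect A; last first.
    rewrite (_ : [set _ | _] = set0) // -subset0 => w /= [h _]; exact: nA.
  by apply: event_and; [exact: event_cst|exact: measurable_tau_in].
apply: event_and; first exact: measurable_no_jump.
apply: event_ex => -[z r] /=; apply: event_and; first exact: event_cst.
exact: measurable_jump_at1.
Qed.

Lemma measurable_J1dist_largest_jump (c e : R) :
  measurable_fun setT (X : T -> borel (skorokhod R d)) ->
  measurable [set w | (e%:E < J1dist (sk_scale c (X w)) (sk_scale c (largest_jump (X w))))%E].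
Proof.
move=> mX'; pose V w := tau (X w); pose Z w := c *: jmp (X w) (tau (X w)).
have YE w : sk_scale c (largest_jump (X w)) = one_jump (Z w) (V w).
  by rewrite largest_jumpE sk_scale_one_jump.
have mY : measurable_fun setT ((fun w => one_jump (Z w) (V w)) : T -> borel (skorokhod R d)).
  rewrite (_ : (fun w => _) = (fun w => sk_scale c (largest_jump (X w)))).
    by apply: measurable_sk_scale; exact: measurable_largest_jump.
  by apply/funext => w; rewrite YE.
rewrite (_ : [set _ | _] = [set w | exists n : nat,
    ~ (J1dist (sk_scale c (X w)) (one_jump (Z w) (V w)) < (e + n.+1%:R^-1)%:E)%E]).
  apply: event_ex => n; apply: event_not; apply: measurable_J1dist_one_jump => //.
    exact: measurable_sk_scale.
  by move=> w; exact: tau_itv.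
apply/seteqP; split=> w /=; rewrite YE; last first.
  move=> [n /negP]; rewrite -leNgt; apply: lt_le_trans.
  by rewrite lte_fin ltrDl invr_gt0.
move=> eJ; apply: contrapT => h.
have small (n : nat) : (J1dist (sk_scale c (X w)) (one_jump (Z w) (V w)) < (e + n.+1%:R^-1)%:E)%E.
  by apply: contrapT => h'; apply: h; exists n.
have [D eD hD] : exists2 D, e < D & (D%:E < J1dist (sk_scale c (X w)) (one_jump (Z w) (V w)))%E.
  move: eJ; case: (J1dist _ _) => [r| |//].
    by rewrite lte_fin => er; exists ((e + r) / 2); rewrite ?lte_fin !(midf_lt er).
  by move=> _; exists (e + 1); rewrite ?ltry // ltrDl.
have De0 : 0 < D - e by rewrite subr_gt0.
have [n hn] := invn_lt De0.
have := lt_trans hD (small n); rewrite lte_fin ltNge => /negP; apply.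
by rewrite -lerBrDl ltW.
Qed.

End largest_jump_random.

(** * Independence of past and future increments *)

Section independence.
Context {disp : measure_display} {T : measurableType disp} {R : realType}.
Variable P : probability T R.
Local Open Scope ereal_scope.

Lemma dynkin_independent (B : set T) : measurable B ->
  dynkin [set A | measurable A /\ P (A `&` B) = P A * P B].
Proof.
move=> mB; split.
- by split; rewrite ?setTI ?probability_setT ?mul1e.
- move=> A [mA AB]; split; first exact: measurableC.
  have -> : ~` A `&` B = B `\` A by rewrite setDE setIC.
  have -> : P (B `\` A) = P B - P A * P B.
    rewrite -AB setIC; apply: measureD => //.
    exact: le_lt_trans (probability_le1 _ mB) (ltry _).
  rewrite probability_setC // -(fineK (fin_num_measure P _ mA)).
  rewrite -(fineK (fin_num_measure P _ mB)).
  by move: (fine _) (fine _) => b a; rewrite -EFinB -EFinM; congr EFin; ring.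
- move=> F tF FB; have mF n : measurable (F n) by case: (FB n).
  split; first exact: bigcupT_measurable.
  rewrite setI_bigcupl measure_bigcup //; last first.
  - exact: trivIset_setIr.
  - by move=> n _; exact: measurableI.
  rewrite measure_bigcup // [RHS]muleC -(fineK (fin_num_measure P _ mB)).
  rewrite -nneseriesZl //; apply: eq_eseriesr => n _; rewrite fineK ?fin_num_measure //.
  by have [_ h] := FB n; apply: etrans h _; rewrite muleC.
Qed.

(** The pi-lambda theorem, once in each of the two events. *)
Lemma independent_sigma (G1 G2 : set (set T)) :
  G1 `<=` measurable -> G2 `<=` measurable ->
  setI_closed G1 -> setI_closed G2 ->
  (forall A B, G1 A -> G2 B -> P (A `&` B) = P A * P B) ->
  forall A B, <<s G1 >> A -> <<s G2 >> B -> P (A `&` B) = P A * P B.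
Proof.
move=> mG1 mG2 iG1 iG2 ind.
have half (G : set (set T)) (B : set T) : G `<=` measurable -> setI_closed G ->
    measurable B -> (forall A, G A -> P (A `&` B) = P A * P B) ->
    forall A, <<s G >> A -> measurable A /\ P (A `&` B) = P A * P B.
  move=> mG iG mB GB; apply: lambda_system_subset => //.
    by apply/dynkin_lambda_system; exact: dynkin_independent.
  by move=> A GA; split; [exact: mG|exact: GB].
have step1 A B : <<s G1 >> A -> G2 B -> measurable A /\ P (A `&` B) = P A * P B.
  move=> sA GB; apply: (half G1) => //; first exact: mG2.
  by move=> A' GA'; exact: ind.
move=> A B sA sB.
have mA : measurable A.
  have : <<s G1 >> `<=` measurable by apply: smallest_sub => //; exact: sigma_algebra_measurable.
  exact.
rewrite setIC muleC; apply: (half G2 A _ _ _ _ B sB).2 => //.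
by move=> B' GB'; rewrite setIC muleC; exact: (step1 A B' sA GB').2.
Qed.

End independence.

Section increments.
Context {R : realType} {d : nat} {disp : measure_display} {Omega : measurableType disp}.
Variables (P : probability Omega R) (X : Omega -> skorokhod R d).
Hypothesis X_levy : levy P X.
Variables (n : nat) (t : nat -> R).
Hypotheses (t01 : forall i, (i <= n)%N -> 0 <= t i <= 1)
           (t_incr : forall i, (i < n)%N -> t i <= t i.+1).

Let D i := increment X (t i) (t i.+1).

(** A pi-system generating the sigma-algebra of the increments with indices in
    [S]. *)
Definition rectangles (S : pred nat) : set (set Omega) :=
  [set A | exists B : nat -> set (borel 'rV[R]_d.+1),
    [/\ forall i, measurable (B i), forall i, ~~ S i -> B i = setT &
      A = \bigcap_(i < n) (D i @^-1` B i)]].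

Lemma levy_coords s : 0 <= s <= 1 -> measurable_coords (fun w => X w s).
Proof. by case: X_levy => mX _ s01; apply: measurable_coords_borel; exact: mX. Qed.

Lemma measurable_increment i : (i < n)%N -> measurable_fun setT (D i).
Proof.
move=> lt_in.
have mc : measurable_coords (fun w => X w (t i.+1) - X w (t i)).
  by apply: measurable_coordsB; apply: levy_coords; apply: t01; rewrite // ltnW.
apply: (@measurability _ _ Omega (borel 'rV[R]_d.+1) setT _ (@open 'rV[R]_d.+1)) => //.
move=> _ [U oU <-]; rewrite setTI.
(* U is a countable union of rational balls *)
rewrite (_ : _ @^-1` U = [set w | exists qr : 'rV[rat]_d.+1 * rat,
    (forall z, enorm (z - map_mx ratr qr.1) < ratr qr.2 -> U z) /\
    enorm (X w (t i.+1) - X w (t i) - map_mx ratr qr.1) < ratr qr.2]).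
  apply: event_ex => -[q r] /=; apply: event_and; first exact: event_cst.
  apply: event_lt; last exact: measurable_cst.
  by apply: measurable_enorm; apply: measurable_coordsB => //; exact: measurable_coords_cst.
apply/seteqP; split=> w /=; last by move=> [[q r] /= [hU]]; exact: hU.
rewrite /D /increment; set v := X w _ - X w _ => Uv.
have : nbhs v U by apply: open_nbhs_nbhs; split.
move=> /nbhs_normP[e /= e0 he].
have e20 : 0 < e / 2 by rewrite divr_gt0.
have [r] := rat_in_itvoo e20; rewrite in_itv /= => /andP[r0 re].
have [q hq] := rat_vector v r0; exists (q, r) => /=; split => // z hz.
apply: he => /=.
apply: le_lt_trans (norm_le_enorm _) _.
apply: (enorm_tri_lt (ltW hq) (ltW _)); first by rewrite enormB; exact: hz.
by rewrite [ltRHS]splitr ltrD.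
Qed.

Lemma rectangles_measurable S : rectangles S `<=` measurable.
Proof.
move=> _ [B [mB _ ->]]; apply: bigcap_measurableType => i lt_in.
by rewrite -[X in measurable X]setTI; apply: measurable_increment.
Qed.

Lemma rectangles_setI S : setI_closed (rectangles S).
Proof.
move=> _ _ [A [mA SA ->]] [B [mB SB ->]]; exists (fun i => A i `&` B i); split.
- by move=> i; exact: measurableI.
- by move=> i Si; rewrite SA // SB // setTI.
- by rewrite -bigcapI; apply: eq_bigcapr => i _; rewrite preimage_setI.
Qed.

Lemma rectangles_independent S1 S2 A B : (forall i, ~~ (S1 i && S2 i)) ->
  rectangles S1 A -> rectangles S2 B -> P (A `&` B) = (P A * P B)%E.
Proof.
move=> S12 [A' [mA SA ->]] [B' [mB SB ->]].
case: X_levy => _ [_ [ind _]].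
have -> : \bigcap_(i < n) (D i @^-1` A' i) `&` \bigcap_(i < n) (D i @^-1` B' i) =
    \bigcap_(i < n) (D i @^-1` (A' i `&` B' i)).
  by rewrite -bigcapI; apply: eq_bigcapr => i _; rewrite preimage_setI.
rewrite !ind // -?big_split /=; last first.
  by move=> i; exact: measurableI.
apply: eq_bigr => i _; have := S12 i; rewrite negb_and => /orP[/SA ->|/SB ->].
  by rewrite setTI preimage_setT probability_setT mul1e.
by rewrite setIT preimage_setT probability_setT mule1.
Qed.

Lemma increment_sigma (S : pred nat) i : (i < n)%N -> S i ->
  measurable_coords (D i : g_sigma_algebraType (rectangles S) -> 'rV[R]_d.+1).
Proof.
move=> lt_in Si; apply: measurable_coords_borel => _ A mA; rewrite setTI.
apply: sub_sigma_algebra; exists (fun j => if j == i then A else setT); split.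
- by move=> j; case: ifP.
- by move=> j nSj; case: eqP => // ji; rewrite ji Si in nSj.
- apply/seteqP; split=> w /=.
    by move=> Aw j _; case: eqP => [->//|_].
  by move=> /(_ i lt_in); rewrite /= eqxx.
Qed.

Lemma path_increment_sigma (S : pred nat) k l : (k <= l <= n)%N ->
  (forall i, (k <= i < l)%N -> S i) ->
  measurable_coords ((fun w => X w (t l) - X w (t k)) :
    g_sigma_algebraType (rectangles S) -> 'rV[R]_d.+1).
Proof.
move=> /andP[kl ln] hS; elim: l kl ln hS => [|l ih].
  rewrite leqn0 => /eqP -> _ _ i.
  rewrite (_ : (fun w => _) = cst 0); first exact: measurable_cst.
  by apply/funext => w; rewrite subrr mxE.
rewrite leq_eqVlt => /predU1P[<- _ _ i|].
  rewrite (_ : (fun w => _) = cst 0); first exact: measurable_cst.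
  by apply/funext => w; rewrite subrr mxE.
rewrite ltnS => kl ln hS.
have mD : measurable_coords (D l : g_sigma_algebraType (rectangles S) -> 'rV[R]_d.+1).
  by apply: increment_sigma => //; apply: hS; rewrite kl ltnSn.
have mI := ih kl (ltnW ln).
move=> i; rewrite (_ : (fun w => _) =
  (fun w => (X w (t l) - X w (t k)) 0 i) \+ (fun w => D l w 0 i)).
  apply: measurable_funD; last exact: mD.
  by apply: mI => j /andP[kj jl]; apply: hS; rewrite kj ltnS ltnW.
by apply/funext => w; rewrite /= /D /increment !mxE; ring.
Qed.

End increments.

(** * Two large oscillations are unlikely *)

Section two_oscillations.
Context {R : realType} {d : nat} {disp : measure_display} {Omega : measurableType disp}.
Variables (P : probability Omega R) (X : Omega -> skorokhod R d).
Hypothesis X_levy : levy P X.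
Hypothesis mX : measurable_fun setT (X : Omega -> borel (skorokhod R d)).

Definition tail (r : R) : \bar R := P [set w | r < snorm (X w)].

Definition two_moves (n : nat) (t : nat -> R) (a b : R) : set Omega :=
  [set w | exists kl : nat * nat, (kl.1 < kl.2 <= n)%N /\
     (a < enorm (X w (t kl.1) - X w (t 0)) /\
      b < enorm (X w (t kl.2) - X w (t kl.1)))].

Lemma move_snorm w s t b : 0 <= s <= 1 -> 0 <= t <= 1 ->
  b < enorm (X w t - X w s) -> b / 2 < snorm (X w).
Proof.
move=> s01 t01 h; have := ler_enormB (X w t) (X w s).
have := enorm_le_snorm (X w) s01; have := enorm_le_snorm (X w) t01.
move: h; move: (enorm _) (enorm _) (enorm _) (snorm _) => a1 a2 a3 a4 *; lra.
Qed.

Section grid.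
Variables (n : nat) (t : nat -> R) (a b : R).
Hypotheses (t01 : forall i, (i <= n)%N -> 0 <= t i <= 1)
           (t_incr : forall i, (i < n)%N -> t i <= t i.+1) (b0 : 0 <= b).

Let past k : set Omega := [set w | (forall j, (j < k)%N ->
    enorm (X w (t j) - X w (t 0)) <= a) /\ a < enorm (X w (t k) - X w (t 0))].
Let future k : set Omega := [set w | exists l, (k < l <= n)%N /\
    b / 2 < enorm (X w (t l) - X w (t k))].

Let past_sigma k : (k <= n)%N -> <<s rectangles X n t (fun i => (i < k)%N) >> (past k).
Proof.
move=> kn; pose TT := g_sigma_algebraType (rectangles X n t (fun i => (i < k)%N)).
have m j : (j <= k)%N -> measurable_coords ((fun w => X w (t j) - X w (t 0)) : TT -> _).
  move=> jk; apply: path_increment_sigma.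
    by rewrite /= (leq_trans jk).
  by move=> i /andP[_ ij]; exact: leq_trans jk.
apply: (@event_and _ TT); last first.
  by apply: event_lt; [exact: measurable_cst|apply: measurable_enorm; exact: m].
apply: (@event_all _ TT) => j; have [jk|jk] := ltnP j k; last first.
  by rewrite (_ : [set _ | _] = setT) //; apply/seteqP; split.
apply: (@event_imp _ TT); first exact: event_cst.
by apply: event_le; [apply: measurable_enorm; apply: m; exact: ltnW|exact: measurable_cst].
Qed.

Let future_sigma k : <<s rectangles X n t (fun i => (k <= i)%N) >> (future k).
Proof.
pose TT := g_sigma_algebraType (rectangles X n t (fun i => (k <= i)%N)).
apply: (@event_ex _ TT) => l; have [kln|nkln] := boolP (k < l <= n)%N; last first.
  by rewrite (_ : [set _ | _] = set0) // -subset0 => w [].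
apply: (@event_and _ TT); first exact: event_cst.
apply: event_lt; first exact: measurable_cst.
apply: measurable_enorm; apply: path_increment_sigma.
  by case/andP: kln => /ltnW -> ->.
by move=> i /andP[].
Qed.

Let m_past k : (k <= n)%N -> measurable (past k).
Proof.
move=> kn; have : <<s rectangles X n t (fun i => (i < k)%N) >> `<=` measurable.
  by apply: smallest_sub; [exact: sigma_algebra_measurable|exact: (rectangles_measurable X_levy)].
by apply; exact: past_sigma.
Qed.

Let m_future k : measurable (future k).
Proof.
have : <<s rectangles X n t (fun i => (k <= i)%N) >> `<=` measurable.
  by apply: smallest_sub; [exact: sigma_algebra_measurable|exact: (rectangles_measurable X_levy)].
by apply; exact: future_sigma.
Qed.

Lemma m_two_moves : measurable (two_moves n t a b).
Proof.
apply: event_ex => -[k l] /=; have [kln|nkln] := boolP (k < l <= n)%N; last first.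
  by rewrite (_ : [set _ | _] = set0) // -subset0 => w [].
have /andP[kl ln] := kln.
have m i : (i <= n)%N -> measurable_coords (fun w => X w (t i)).
  by move=> lin; apply: (levy_coords X_levy); exact: t01.
have kn := leq_trans (ltnW kl) ln.
apply: event_and; first exact: event_cst.
apply: event_and; apply: event_lt; try exact: measurable_cst;
  by apply: measurable_enorm; apply: measurable_coordsB; apply: m.
Qed.

(** The first passage above [a] is decided by the increments before it, the
    second move by the increments after it. *)
Lemma two_moves_le : (P (two_moves n t a b) <= tail (a / 2) * tail (b / 4))%E.
Proof.
have cover : two_moves n t a b `<=` \big[setU/set0]_(k < n.+1) (past k `&` future k).
  move=> w [[k l] /= [/andP[kl ln] [ak bl]]].
  have ex : exists k, a < enorm (X w (t k) - X w (t 0)) by exists k.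
  case: (ex_minnP ex) => k0 ak0 mink0.
  have k0k := mink0 k ak.
  have k0n : (k0 < n.+1)%N by rewrite ltnS (leq_trans k0k) // (leq_trans (ltnW kl)).
  rewrite -(bigcup_mkord n.+1 (fun k => past k `&` future k)); exists k0 => //; split.
    split=> // j jk0; rewrite leNgt; apply/negP => aj.
    by have := mink0 j aj; rewrite leqNgt jk0.
  have [hl|hl] := boolP (b / 2 < enorm (X w (t l) - X w (t k0))).
    by exists l; rewrite ln (leq_ltn_trans k0k kl).
  rewrite -leNgt in hl.
  have hk : b / 2 < enorm (X w (t k) - X w (t k0)).
    have := ler_enorm_dist (X w (t k0)) (X w (t l)) (X w (t k)).
    rewrite (enormB (X w (t k0))); move: bl hl.
    by move: (enorm _) (enorm _) (enorm _) => a1 a2 a3 *; lra.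
  exists k; split => //; rewrite (leq_trans (ltnW kl) ln) andbT ltn_neqAle k0k andbT.
  by apply/eqP => k0E; move: hk; rewrite k0E subrr enorm0 ltNge divr_ge0.
have mpf k : (k < n.+1)%N -> measurable (past k `&` future k).
  by move=> kn; apply: measurableI; [exact: m_past|exact: m_future].
have future_le k : (k < n.+1)%N -> (P (future k) <= tail (b / 4))%E.
  move=> kn; apply: le_measure; rewrite ?inE //; first exact: measurable_snorm.
  move=> w [l [/andP[kl ln] h]] /=.
  by have -> : b / 4 = b / 2 / 2 by [lra]; apply: move_snorm h; exact: t01.
have past_le : (\sum_(k < n.+1) P (past k) <= tail (a / 2))%E.
  rewrite -measure_bigsetU_ord //; last 2 first.
  - by move=> k; exact: (m_past (ltn_ord k)).
  - apply/trivIsetP => i j _ _ ij; rewrite -subset0 => w [[hi ai] [hj aj]].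
    move: ij; rewrite neq_ltn => /orP[ij|ji].
      by have := hj _ ij; rewrite leNgt ai.
    by have := hi _ ji; rewrite leNgt aj.
  apply: le_measure; rewrite ?inE //.
  - by apply: bigsetU_measurable => k _; exact: (m_past (ltn_ord k)).
  - exact: measurable_snorm.
  - rewrite -(bigcup_mkord n.+1 past) => w [k /= kn [_ h]].
    by apply: move_snorm h; exact: t01.
have tail_fin r : tail r \is a fin_num.
  by apply: fin_num_measure; exact: measurable_snorm.
apply: (@le_trans _ _ (\sum_(k < n.+1) P (past k `&` future k))%E).
  apply: (@content_subadditive _ _ _ P _ (fun k => past k `&` future k)) => //.
  exact: m_two_moves.
apply: (@le_trans _ _ (\sum_(k < n.+1) (P (past k) * tail (b / 4)))%E).
  apply: lee_sum => k _.
  have -> : P (past k `&` future k) = (P (past k) * P (future k))%E.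
    refine (@independent_sigma _ _ _ P _ _ _ _ _ _ _ _ _ (past_sigma (ltn_ord k)) (future_sigma (k:=k))).
    - exact: (rectangles_measurable X_levy).
    - exact: (rectangles_measurable X_levy).
    - exact: rectangles_setI.
    - exact: rectangles_setI.
    - move=> A B; apply: (rectangles_independent X_levy t01 t_incr) => i.
      by rewrite ltnNge andNb.
  by rewrite lee_wpmul2l // future_le.
rewrite -ge0_sume_distrl //; apply: lee_wpmul2r past_le.
exact: measure_ge0.
Qed.

End grid.
End two_oscillations.

(** * Paths with a single large move are close to their largest jump *)

Section single_move.
Context {R : realType} {d : nat}.
Implicit Types (x : skorokhod R d) (a s t : R).

(** The negation is an open condition on [s] and [t]: two moves of size more than
    [a], one after the other. *)
Definition single_move a x := forall s t, 0 <= s -> s < t -> t <= 1 ->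
  a < enorm (x s - x 0) -> enorm (x t - x s) <= a.

Lemma jump_le x t (z : 'rV[R]_d.+1) a r : 0 < t <= 1 -> r < t ->
  (forall s, 0 <= s <= 1 -> r < s <= t -> enorm (x s - z) <= a) ->
  enorm (jmp x t) <= a + a.
Proof.
move=> t01 rt h; have t01' : 0 <= t <= 1 by case/andP: t01 => /ltW -> ->.
rewrite jmpE; apply: (@enorm_tri_le _ _ z _ _ a a) => //.
  by apply: h; rewrite ?rt ?lexx.
rewrite enormB; apply: left_lim_le => //; exists r => // s s01 /andP[rs st].
by apply: h; rewrite // rs ltW.
Qed.

(** Let [T] be the first passage above [a].  The path is within [a] of 0 before
    [T] and of its value at [T] afterwards, so all jumps except the one at [T] are
    at most [2 a].  Either that one is the largest jump, or it is at most [2 a] as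
    well and the whole path is small. *)
Lemma single_move_close a x t : 0 < a -> x 0 = 0 -> jmp x 1 = 0 -> single_move a x ->
  0 <= t <= 1 -> enorm (x t - largest_jump x t) <= 6 * a.
Proof.
move=> a0 x0 jmp1 sm t01; rewrite largest_jumpE /= t01 /=.
set J := jmp x (tau x).
have two_small b c : enorm (x t) <= b -> enorm J <= c -> b + c <= 6 * a ->
    enorm (x t - (if tau x <= t then J else 0)) <= 6 * a.
  move=> hb hc bc; apply: le_trans bc; case: ifP => _.
    exact: le_trans (ler_enormB _ _) (lerD hb hc).
  by rewrite subr0 (le_trans hb) // lerDl (le_trans (enorm_ge0 J)).
have [small|] := pselect (forall s, 0 <= s <= 1 -> enorm (x s) <= a).
  apply: (two_small a (a + a)); [exact: small| |by clear -a0; lra].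
  have /andP[tau0 tau1] := tau_itv x.
  apply: (@jump_le x (tau x) 0 a 0); rewrite ?tau0 ?tau1 // => s s01 _.
  by rewrite subr0 small.
move=> /existsNP[s0 /not_implyP[s001 /negP]]; rewrite -ltNge => as0.
(* T is the first passage above a *)
pose E := [set s | 0 <= s <= 1 /\ a < enorm (x s)].
have Es0 : E s0 by [].
have infE : has_inf E by split; [exists s0|exists 0 => s [/andP[]]].
pose T := inf E.
have T0 : 0 <= T by apply: lb_le_inf; [exists s0|move=> s [/andP[]]].
have Ts s : E s -> T <= s by move=> Es; apply: ge_inf => //; case: infE.
have T1 : T <= 1 by apply: le_trans (Ts _ Es0) _; case/andP: s001.
have before s : 0 <= s -> s < T -> enorm (x s) <= a.
  move=> s0' sT; rewrite leNgt; apply/negP => as_.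
  suff : T <= s by rewrite leNgt sT.
  by apply: Ts; split => //; rewrite s0' (le_trans (ltW sT)).
have after s : T <= s -> s <= 1 -> enorm (x s - x T) <= a.
  rewrite le_eqVlt => /predU1P[<- _|Ts' s1]; first by rewrite subrr enorm0 ltW.
  rewrite enormB; apply: right_lim_le; first by rewrite T0 (lt_le_trans Ts').
  move=> D D0.
  have gap : 0 < Num.min D (s - T) by rewrite lt_min D0 subr_gt0.
  have [r [/andP[r0 r1] ar] rT] := inf_adherent gap infE.
  have rs : r < s by rewrite (lt_le_trans rT) // -lerBrDl ge_min lexx orbT.
  exists r; first by rewrite r0.
  have Tr : T <= r by apply: Ts; split => //; rewrite r0.
  split; first by rewrite Tr (lt_le_trans rT) // lerD2l ge_min lexx.
  by rewrite enormB; apply: sm => //; rewrite x0 subr0.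
have Tpos : 0 < T.
  rewrite lt_def T0 andbT; apply/eqP => T00.
  have := after s0; rewrite T00 x0 subr0; case/andP: s001 => -> -> /(_ isT isT).
  by rewrite leNgt as0.
have leftT : enorm (left_lim x T - 0) <= a.
  apply: left_lim_le; first by rewrite Tpos.
  exists 0 => // s _ /andP[s0' sT]; rewrite subr0; apply: before => //; exact: ltW.
have Tlt1 : T < 1.
  rewrite lt_neqAle T1 andbT; apply/eqP => T11.
  have s01 : s0 = 1.
    by apply/le_anti; rewrite -[X in X <= s0]T11 (Ts _ Es0) andbT; case/andP: s001.
  move: as0; rewrite s01 ltNge; move: leftT; rewrite T11 subr0.
  by have := jmpE x 1; rewrite jmp1 => /esym/eqP; rewrite subr_eq0 => /eqP -> ->.
have T01 : 0 < T < 1 by rewrite Tpos.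
have jump_other s : 0 < s <= 1 -> s != T -> enorm (jmp x s) <= a + a.
  move=> /andP[s0' s1]; rewrite neq_lt => /orP[sT|Ts'].
    apply: (@jump_le x s 0 a 0); rewrite ?s0' // => r /andP[r0 _] /andP[_ rs].
    by rewrite subr0 before // (le_lt_trans rs).
  apply: (@jump_le x s (x T) a T); rewrite ?s0' // => r /andP[_ r1] /andP[Tr _].
  by rewrite after // ltW.
have xTJ : enorm (x T - jmp x T) <= a.
  by rewrite jmpE subKr; move: leftT; rewrite subr0.
have [tauT|tauT] := eqVneq (tau x) T.
  rewrite /J tauT; case: ifP => [Tt|/negbT].
    apply: (enorm_tri_le (after t Tt _) xTJ); first by case/andP: t01.
    by clear -a0; lra.
  rewrite -ltNge subr0 => tT; have := before t; case/andP: t01 => -> _ /(_ isT tT).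
  by move=> /le_trans; apply; clear -a0; lra.
have J2 : enorm J <= a + a by apply: jump_other => //; exact: tau_itv.
have JT2 : enorm (jmp x T) <= a + a.
  move: J2 tauT; rewrite /J; case: tauP => [nj|t' [_ _ maxt _]] J2 _.
    by rewrite nj // enorm0 addr_ge0 // ltW.
  exact: le_trans (maxt T T01) J2.
have xT3 : enorm (x T) <= 3 * a.
  have := lerB_enorm (x T) (jmp x T); move: xTJ JT2.
  by clear; move: (enorm _) (enorm _) (enorm _) => b1 b2 b3 *; lra.
apply: (two_small (4 * a) (a + a)) => //; last by clear -a0; lra.
have [tT|Tt] := ltP t T.
  have := before t; case/andP: t01 => -> _ /(_ isT tT).
  by move=> /le_trans; apply; clear -a0; lra.
have := after t Tt; case/andP: t01 => _ -> /(_ isT) h.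
have := lerB_enorm (x t) (x T); move: h xT3; clear.
by move: (enorm _) (enorm _) (enorm _) => b1 b2 b3 *; lra.
Qed.

(** ** Dyadic times *)

Definition dyadic (K i : nat) : R := i%:R / 2 ^+ K.

Lemma dyadic_itv K i : (i <= 2 ^ K)%N -> 0 <= dyadic K i <= 1.
Proof.
move=> iK; rewrite /dyadic divr_ge0 ?exprn_ge0 //= ler_pdivrMr ?exprn_gt0 //.
by rewrite mul1r -natrX ler_nat.
Qed.

Lemma dyadic_step_lt (e : R) : 0 < e -> exists K0, forall K, (K0 <= K)%N -> (2 ^+ K)^-1 < e :> R.
Proof.
move=> e0; have [n hn] := invn_lt e0; exists n => K nK.
apply: le_lt_trans hn; rewrite lef_pV2 ?posrE ?exprn_gt0 //.
by rewrite -natrX ler_nat (leq_ltn_trans nK) // ltn_expl.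
Qed.

Lemma dyadic_right t (e : R) : 0 <= t < 1 -> 0 < e -> exists K0, forall K, (K0 <= K)%N ->
  exists2 k, (k <= 2 ^ K)%N & t < dyadic K k < t + e.
Proof.
move=> /andP[t0 t1] e0.
have m0 : 0 < Num.min e (1 - t) by rewrite lt_min e0 subr_gt0.
have [K0 hK0] := dyadic_step_lt m0; exists K0 => K /hK0; rewrite lt_min => /andP[he h1].
have K2 : 0 < 2 ^+ K :> R by rewrite exprn_gt0.
pose k := (Num.truncn (t * 2 ^+ K)).+1.
have k1 : t * 2 ^+ K < k%:R by exact: truncnS_gt.
have k2 : k%:R <= t * 2 ^+ K + 1.
  by rewrite /k -natr1 lerD2r truncn_le mulr_ge0 // ltW.
have dk : dyadic K k <= t + (2 ^+ K)^-1.
  by rewrite /dyadic ler_pdivrMr // mulrDl mulVf ?gt_eqF.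
exists k.
  have : dyadic K k < 1 by apply: le_lt_trans dk _; rewrite -ltrBrDl.
  rewrite /dyadic ltr_pdivrMr // mul1r -natrX ltr_nat; exact: ltnW.
rewrite (le_lt_trans dk) ?ltrD2l // andbT.
by rewrite /dyadic ltr_pdivlMr.
Qed.

Lemma dyadic_incr K i : (i < 2 ^ K)%N -> dyadic K i <= dyadic K i.+1.
Proof. by move=> _; rewrite /dyadic ler_pM2r ?invr_gt0 ?exprn_gt0 // ler_nat. Qed.

Lemma dyadicS K i : dyadic K.+1 (2 * i) = dyadic K i.
Proof.
rewrite /dyadic natrM exprS invfM mulrACA divff ?mul1r //.
Qed.

(** Right continuity moves two times to the right onto a fine dyadic grid, keeping
    strict inequalities. *)
Lemma single_move_dyadic a x :
  (forall K k l, (k < l <= 2 ^ K)%N ->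
     a < enorm (x (dyadic K k) - x 0) ->
     enorm (x (dyadic K l) - x (dyadic K k)) <= a) ->
  single_move a x.
Proof.
move=> h s t s0 st t1 as_; rewrite leNgt; apply/negP => at_.
pose e := Num.min ((enorm (x s - x 0) - a) / 2) ((enorm (x t - x s) - a) / 2).
have e0 : 0 < e by rewrite lt_min !divr_gt0 // subr_gt0.
have [e1 e2] : e <= (enorm (x s - x 0) - a) / 2 /\ e <= (enorm (x t - x s) - a) / 2.
  by rewrite /e !ge_min !lexx orbT.
have near_ u : 0 <= u < 1 -> forall r, 0 < r -> exists K0, forall K, (K0 <= K)%N ->
    exists2 k, (k <= 2 ^ K)%N & u < dyadic K k < u + r /\ enorm (x (dyadic K k) - x u) < e.
  move=> u01 r r0; have [D D0 hD] := path_local x u e0.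
  have m0 : 0 < Num.min r D by rewrite lt_min r0.
  have [K0 hK0] := dyadic_right u01 m0; exists K0 => K /hK0[k kK /andP[uk kr]].
  have [kr1 kr2] : dyadic K k < u + r /\ dyadic K k < u + D.
    split; apply: lt_le_trans kr _; rewrite lerD2l ge_min lexx ?orbT //.
  exists k => //; split; first by rewrite uk.
  have kD : `|dyadic K k - u| < D by rewrite ger0_norm ?subr_ge0 ?(ltW uk) // ltrBlDl.
  by have [_ /(_ (ltW uk))] := hD _ (dyadic_itv kK) kD.
have s1 : 0 <= s < 1 by rewrite s0 (lt_le_trans st t1).
have ts : 0 < t - s by rewrite subr_gt0.
have [K1 h1] := near_ s s1 _ ts.
have [K2 h2] : exists K0, forall K, (K0 <= K)%N ->
    exists2 k, (k <= 2 ^ K)%N & t <= dyadic K k /\ enorm (x (dyadic K k) - x t) < e.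
  move: t1; rewrite le_eqVlt => /predU1P[->|t1].
    exists 0%N => K _; exists (2 ^ K)%N => //.
    have -> : dyadic K (2 ^ K) = 1 by rewrite /dyadic natrX divff // gt_eqF // exprn_gt0.
    by rewrite subrr enorm0.
  have t01 : 0 <= t < 1 by rewrite (le_trans s0 (ltW st)).
  have [K0 hK0] := near_ t t01 _ ltr01; exists K0 => K /hK0[k kK [/andP[tk _] hk]].
  by exists k => //; split => //; exact: ltW.
have [k kK [/andP[sk ks] hk]] := h1 _ (leq_maxl K1 K2).
have [l lK [tl hl]] := h2 _ (leq_maxr K1 K2).
set K := maxn K1 K2 in k kK sk ks hk l lK tl hl.
have kl : (k < l)%N.
  have : dyadic K k < dyadic K l by apply: lt_le_trans tl; rewrite subrKC in ks.
  by rewrite /dyadic ltr_pM2r ?invr_gt0 ?exprn_gt0 // ltr_nat.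
have ak : a < enorm (x (dyadic K k) - x 0).
  have := ler_enorm_dist (x (dyadic K k)) (x s) (x 0).
  rewrite (enormB (x s) (x (dyadic K k))); move: hk e1 as_; clear.
  by move: (enorm _) (enorm _) (enorm _) => b1 b2 b3 *; lra.
have := h K k l; rewrite kl lK => /(_ isT ak); rewrite leNgt => /negP; apply.
have := ler_enorm_dist (x (dyadic K l)) (x t) (x s).
have := ler_enorm_dist (x (dyadic K k)) (x (dyadic K l)) (x s).
rewrite (enormB (x t) (x (dyadic K l))); move: hk hl e2 at_; clear.
by move: (enorm _) (enorm _) (enorm _) (enorm _) (enorm _) => b1 b2 b3 b4 b5 *; lra.
Qed.

End single_move.

(** * The exceptional event *)

Lemma measure_incr_le {disp : measure_display} {T : measurableType disp} {R : realType}
    (mu : {measure set T -> \bar R}) (F : nat -> set T) (c : \bar R) :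
  (forall n, measurable (F n)) -> nondecreasing_seq F ->
  (forall n, (mu (F n) <= c)%E) -> (mu (\bigcup_n F n) <= c)%E.
Proof.
move=> mF ndF Fc.
have cv := @nondecreasing_cvg_mu _ _ _ mu F mF (bigcupT_measurable F mF) ndF.
rewrite -(cvg_lim _ cv) //; apply: lime_le; first by apply/cvg_ex; eexists; exact: cv.
by near=> n; exact: Fc.
Unshelve. all: by end_near. Qed.

Section exceptional.
Context {R : realType} {d : nat} {disp : measure_display} {Omega : measurableType disp}.
Variables (P : probability Omega R) (X : Omega -> skorokhod R d).
Hypothesis X_levy : levy P X.
Hypothesis mX : measurable_fun setT (X : Omega -> borel (skorokhod R d)).

Let mc t : 0 <= t <= 1 -> measurable_coords (fun w => X w t) := @levy_coords _ _ _ _ _ _ X_levy t.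

Lemma levy_start : measurable [set w | 0 < enorm (X w 0)] /\
  P [set w | 0 < enorm (X w 0)] = 0%E.
Proof.
have m0 : measurable [set w | 0 < enorm (X w 0)].
  apply: event_lt; first exact: measurable_cst.
  by apply/measurable_enorm/mc; rewrite lexx ler01.
split=> //; have [_ [start _]] := X_levy.
have E : [set w | X w 0 = 0] = ~` [set w | 0 < enorm (X w 0)].
  apply/seteqP; split=> w /=; first by move=> ->; rewrite enorm0 ltxx.
  move=> /negP; rewrite -leNgt => h; apply: enorm_eq0; apply/le_anti.
  by rewrite h enorm_ge0.
move: start; rewrite E probability_setC // -(fineK (fin_num_measure P _ m0)).
rewrite -EFinB => -[h]; congr EFin; lra.
Qed.

Lemma measurable_jump_at1_gt e : measurable [set w | e < enorm (jmp (X w) 1)].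
Proof.
rewrite (_ : [set w | _] =
    [set w | exists k : nat, ~ (enorm (jmp (X w) 1 - 0) < e + k.+1%:R^-1)]).
  by apply: event_ex => k; apply: event_not; exact: (measurable_jump_at1 mc).
apply/seteqP; split=> w /=.
  rewrite -subr_gt0 => /invn_lt[k hk]; exists k; rewrite subr0.
  by apply/negP; rewrite -leNgt -lerBrDl ltW.
move=> [k /negP]; rewrite subr0 -leNgt; apply: lt_le_trans.
by rewrite ltrDl invr_gt0.
Qed.

(** If the jump at 1 exceeds [e], then the increments from all times close enough
    to 1 exceed [e / 2], which has small probability by stochastic continuity. *)
Lemma levy_jump_at1_gt e : 0 < e -> P [set w | e < enorm (jmp (X w) 1)] = 0%E.
Proof.
move=> e0; have [_ [_ [_ [_ cont]]]] := X_levy.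
have e20 : 0 < e / 2 by rewrite divr_gt0.
have one : 0 <= (1 : R) <= 1 by rewrite ler01 lexx.
pose F n := [set w | e / 2 < enorm (X w (before1 n) - X w 1)].
have mF n : measurable (F n).
  apply: event_lt; first exact: measurable_cst.
  by apply: measurable_enorm; apply: measurable_coordsB; apply: mc => //; exact: before1_itv.
have small c : 0 < c -> exists N, forall n, (N <= n)%N -> (P (F n) <= c%:E)%E.
  move=> c0; have := cont 1 (e / 2) one e20.
  move=> /(_ [set y | (y < c%:E)%E]) /=.
  have /[swap]/[apply] : nbhs 0%E [set y : \bar R | (y < c%:E)%E].
    by apply: open_nbhs_nbhs; split; [exact: open_ereal_lt_ereal|rewrite /= lte_fin].
  pose away s := [set w | e / 2 < enorm (X w s - X w 1)].
  move=> hc; have /nbhs_ballP[D /= D0 hD] : \forall s \near (1 : R), `[0, 1]%classic s ->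
    (P (away s) < c%:E)%E := hc.
  have [N hN] := invn_lt D0; exists N => n Nn; apply/ltW/hD.
    rewrite /ball /= /before1 subKr ger0_norm ?invr_ge0 //.
    by apply: le_lt_trans hN; rewrite lef_pV2 ?posrE // ler_nat.
  by rewrite /= in_itv /=; exact: before1_itv.
apply/le_anti/andP; split; last exact: measure_ge0.
apply/lee_addgt0Pr => c c0; rewrite add0e.
pose G N := [set w | forall n, (N <= n)%N -> F n w].
have mG N : measurable (G N).
  by apply: event_all => n; apply: event_imp; [exact: event_cst|exact: mF].
have sub : [set w | e < enorm (jmp (X w) 1)] `<=` \bigcup_N G N.
  move=> w /= ew; have [N hN] := increment_before1 (X w) e20.
  exists N => // n /hN h; rewrite /F /= enormB.
  have := lerB_enorm (jmp (X w) 1) (X w 1 - X w (before1 n)).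
  rewrite (enormB (jmp (X w) 1)); move: ew h.
  by move: (enorm _) (enorm _) (enorm _) => a1 a2 a3 *; lra.
apply: (@le_trans _ _ (P (\bigcup_N G N))).
  apply: le_measure; rewrite ?inE //; last exact: bigcupT_measurable.
  exact: measurable_jump_at1_gt.
apply: measure_incr_le => //.
  apply/nondecreasing_seqP => N; apply/subsetPset => w h n Nn; apply: h.
  exact: ltnW.
move=> N; have [M hM] := small c c0.
apply: le_trans (hM (maxn M N) (leq_maxl _ _)); apply: le_measure; rewrite ?inE //.
by move=> w; apply; exact: leq_maxr.
Qed.

Lemma levy_jump_at1 : P [set w | 0 < enorm (jmp (X w) 1)] = 0%E.
Proof.
rewrite (_ : [set w | _] = \bigcup_k [set w | k.+1%:R^-1 < enorm (jmp (X w) 1)]).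
  apply/le_anti/andP; split; last exact: measure_ge0.
  apply: measure_incr_le.
  - by move=> k; exact: measurable_jump_at1_gt.
  - apply/nondecreasing_seqP => k; apply/subsetPset => w /=; apply: le_lt_trans.
    by rewrite lef_pV2 ?posrE // ler_nat.
  - move=> k; have k0 : 0 < k.+1%:R^-1 :> R by rewrite invr_gt0.
    exact: (etrans (congr1 (fun y => (y <= 0)%E) (levy_jump_at1_gt k0)) (lexx _)).
apply/seteqP; split=> w /=.
  by move=> /invn_lt[k hk]; exists k.
by move=> [k _]; apply: lt_trans; rewrite invr_gt0.
Qed.

Let moves (a : R) (K : nat) := two_moves X (2 ^ K) (dyadic K) a a.

(** Besides two large moves, the null events that would spoil the comparison with
    the largest jump: [largest_jump] looks only at jumps in (0,1), and first
    passage is measured from the starting point. *)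
Definition exceptional (a : R) : set Omega := (\bigcup_K moves a K) `|`
  ([set w | 0 < enorm (X w 0)] `|` [set w | 0 < enorm (jmp (X w) 1)]).

Let m_moves a K : 0 <= a -> measurable (moves a K).
Proof.
move=> a0; apply: (m_two_moves X_levy) => // i; first exact: dyadic_itv.
Qed.

Lemma measurable_exceptional a : 0 <= a -> measurable (exceptional a).
Proof.
move=> a0; apply: measurableU.
  by apply: bigcupT_measurable => K; exact: m_moves.
by apply: measurableU; [case: levy_start|exact: measurable_jump_at1_gt].
Qed.

(** Halving the mesh only adds grid times, so the bound on grids passes to the
    increasing union. *)
Lemma exceptional_le a : 0 <= a ->
  (P (exceptional a) <= tail P X (a / 2) * tail P X (a / 4))%E.
Proof.
move=> a0; have [m0 P0] := levy_start.
have mM : measurable (\bigcup_K moves a K).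
  by apply: bigcupT_measurable => K; exact: m_moves.
have m1 := measurable_jump_at1_gt 0.
rewrite measureU0 //; last 2 first.
- exact: measurableU.
- by apply: null_set_setU => //; exact: levy_jump_at1.
apply: measure_incr_le; first by move=> K; exact: m_moves.
- apply/nondecreasing_seqP => K; apply/subsetPset => w [[k l] /= [/andP[kl lK] [hk hl]]].
  exists ((2 * k)%N, (2 * l)%N) => /=; rewrite !dyadicS; split.
    by rewrite ltn_pmul2l // kl expnS leq_pmul2l.
  by move: hk; rewrite /dyadic !mul0r.
- move=> K; apply: (two_moves_le X_levy mX) => // i; first exact: dyadic_itv.
  exact: dyadic_incr.
Qed.

Lemma not_exceptional_close a w t : 0 < a -> ~ exceptional a w -> 0 <= t <= 1 ->
  enorm (X w t - largest_jump (X w) t) <= 6 * a.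
Proof.
move=> a0 nE; have zero (z : 'rV[R]_d.+1) : ~ 0 < enorm z -> z = 0.
  by move=> /negP; rewrite -leNgt => h; apply/enorm_eq0/le_anti; rewrite h enorm_ge0.
apply: single_move_close => //.
- by apply: zero => h; apply: nE; right; left.
- by apply: zero => h; apply: nE; right; right.
- apply: single_move_dyadic => K k l klK ak; rewrite leNgt; apply/negP => al.
  apply: nE; left; exists K => //; exists (k, l) => /=; split => //; split => //.
  by rewrite /dyadic mul0r.
Qed.

End exceptional.

(** * Sets with null boundary *)

Section null_levels.
Context {disp : measure_display} {T : measurableType disp} {R : realType}.
Variable mu : {measure set T -> \bar R}.

(** Uncountably many disjoint sets of positive measure do not fit in a set of
    finite measure. *)
Lemma null_level (A : set T) (S : R -> set T) (a b : R) : a < b ->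
  measurable A -> (mu A < +oo)%E ->
  (forall s, a < s < b -> measurable (S s) /\ S s `<=` A) ->
  (forall s s' p, s < s' -> S s p -> S s' p -> False) ->
  exists2 s, a < s < b & mu (S s) = 0%E.
Proof.
move=> ab mA Afin hS disj; apply: contrapT => none.
pose heavy (k : nat) := [set s | a < s < b /\ (k.+1%:R^-1%:E <= mu (S s))%E].
have fin k : finite_set (heavy k).
  apply: contrapT => /infiniteP/ppcard_leP[f].
  have fh n : heavy k (f n) by exact: funS.
  have mu_f n : ((n%:R * k.+1%:R^-1)%:E <= mu A)%E.
    have sumE : mu (\big[setU/set0]_(i < n) S (f i)) = (\sum_(i < n) mu (S (f i)))%E.
      rewrite measure_bigsetU_ord //.
        by move=> i; case: (fh i) => /hS[].
      apply/trivIsetP => i j _ _ ij; rewrite -subset0 => p [Si Sj].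
      have fij : f i != f j :> R.
        apply/eqP => /(@inj _ _ _ f); rewrite !inE => /(_ I I)/val_inj => e.
        by rewrite e eqxx in ij.
      by move: fij; rewrite neq_lt => /orP[h|h]; [exact: (disj _ _ p h)|exact: (disj _ _ p h)].
    apply: (@le_trans _ _ (mu (\big[setU/set0]_(i < n) S (f i)))).
      rewrite sumE; apply: (@le_trans _ _ (\sum_(i < n) (k.+1%:R^-1)%:E)%E).
        by rewrite sumEFin lee_fin sumr_const card_ord mulr_natl.
      by apply: lee_sum => i _; case: (fh i).
    apply: le_measure; rewrite ?inE //.
      by apply: bigsetU_measurable => i _; case: (fh i) => /hS[].
    rewrite -(bigcup_mkord n (fun i => S (f i))) => p [i _ Sp].
    by case: (fh i) => /hS[_ +] _; apply.
  have Afin' : mu A \is a fin_num by rewrite ge0_fin_numE.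
  have [N hN] : exists N : nat, fine (mu A) * k.+1%:R < N%:R.
    by exists (Num.truncn (fine (mu A) * k.+1%:R)).+1; exact: truncnS_gt.
  have := mu_f N; rewrite -(fineK Afin') lee_fin leNgt => /negP; apply.
  by rewrite ltr_pdivlMr.
have cnt : countable [set` `]a, b[].
  have -> : [set` `]a, b[] = \bigcup_k heavy k.
    apply/seteqP; split=> s /=; rewrite in_itv /=; last by case=> k _ [].
    move=> sab; have [mS _] := hS s sab.
    have S0 : (0 < mu (S s))%E.
      by rewrite lt_def measure_ge0 andbT; apply/eqP => S0; apply: none; exists s.
    have [e e0 eS] : exists2 e, 0 < e & (e%:E <= mu (S s))%E.
      move: S0; case: (mu (S s)) => [r| |//]; first by rewrite lte_fin => r0; exists r.
      by move=> _; exists 1; rewrite ?leey.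
    have [k hk] := invn_lt e0; exists k => //; split=> //.
    by apply: le_trans eS; rewrite lee_fin ltW.
  apply: bigcup_countable => // k _; exact/finite_set_countable.
have := countable_lebesgue_measure0 cnt; rewrite lebesgue_measure_itv /= lte_fin ab.
by rewrite -EFinB => -[] /eqP; rewrite subr_eq0 gt_eqF.
Qed.

End null_levels.

Section thickenings.
Context {R : realType} {d : nat}.
Implicit Types (p q : polar R d) (B : set (polar R d)).

Definition thickening B (e : R) : set (polar R d) :=
  [set p | exists2 q, B q & (polar_dist q p < e%:E)%E].

(** The points at distance exactly [e] from [B]. *)
Definition level B (e : R) : set (polar R d) :=
  (\bigcap_k thickening B (e + k.+1%:R^-1)) `\` thickening B e.

Lemma thickening_mono B e e' : e <= e' -> thickening B e `<=` thickening B e'.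
Proof. by move=> ee p [q Bq qp]; exists q => //; apply: lt_le_trans qp _; rewrite lee_fin. Qed.

Lemma sub_thickening B e : 0 < e -> B `<=` thickening B e.
Proof. by move=> e0 p Bp; exists p => //; exact: polar_dist_self. Qed.

Lemma open_thickening B e : open (thickening B e).
Proof.
rewrite (_ : thickening B e = \bigcup_(q in B) [set p | (polar_dist q p < e%:E)%E]).
  by apply: bigcup_open => q _; exact: polar_ball_open.
by apply/seteqP; split=> p [q Bq qp]; exists q.
Qed.

Lemma measurable_thickening B e : measurable (thickening B e : set (borel (polar R d))).
Proof. by apply: open_measurable_polar; exact: open_thickening. Qed.

Lemma measurable_inv_radius_lt (s : R) :
  measurable ([set p | inv_radius p < s] : set (borel (polar R d))).
Proof. by apply: open_measurable_polar; exact: open_radius. Qed.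

Lemma closed_measurable_polar B : closed B -> measurable (B : set (borel (polar R d))).
Proof.
move=> cB; rewrite -[B]setCK; apply: measurableC; apply: open_measurable_polar.
by rewrite openC.
Qed.

Lemma measurable_level B e : measurable (level B e : set (borel (polar R d))).
Proof.
apply: measurableD; last exact: measurable_thickening.
by apply: bigcapT_measurable => k; exact: measurable_thickening.
Qed.

Lemma level_disjoint B e e' p : e < e' -> level B e p -> level B e' p -> False.
Proof.
move=> ee [h _] [_]; apply; rewrite -subr_gt0 in ee.
have [k hk] := invn_lt ee; apply: (thickening_mono (e := e + k.+1%:R^-1)); last exact: h.
by rewrite -lerBrDl ltW.
Qed.

Lemma polar_nbhs p e : 0 < e -> nbhs p [set q | (polar_dist p q < e%:E)%E].
Proof.
move=> e0; apply: open_nbhs_nbhs; split; first exact: polar_ball_open.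
exact: polar_dist_self.
Qed.

(** In a metric space; balls are neighbourhoods by the triangle inequality. *)
Lemma closureE B : closure B = \bigcap_k thickening B k.+1%:R^-1.
Proof.
apply/seteqP; split=> p.
  move=> cp k _; have k0 : 0 < k.+1%:R^-1 :> R by rewrite invr_gt0.
  have [q [Bq pq]] := cp _ (polar_nbhs p k0).
  by exists q => //; rewrite polar_dist_sym.
move=> h U; rewrite nbhsE => -[V [oV Vp] VU].
have [e e0 he] := (polar_openP V).1 oV p Vp.
have [k hk] := invn_lt e0; have [q Bq qp] := h k I.
exists q; split => //; apply/VU/he; rewrite polar_dist_sym.
by apply: lt_trans qp _; rewrite lte_fin.
Qed.

Lemma boundary_thickening B e :
  closure (thickening B e) `\` interior (thickening B e) `<=` level B e.
Proof.
move=> p [cp np]; split; last first.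
  by move=> Tp; apply: np; apply: open_nbhs_nbhs; split => //; exact: open_thickening.
rewrite closureE in cp; move=> k _; have [q' [q Bq qq'] q'p] := cp k I.
by exists q => //; exact: polar_dist_lt_trans qq' q'p.
Qed.

Lemma boundary_thickeningC B e :
  closure (~` thickening B e) `\` interior (~` thickening B e) `<=` level B e.
Proof.
move=> p [cp np]; split; last first.
  move=> Tp; have nT : nbhs p (thickening B e).
    by apply: open_nbhs_nbhs; split => //; exact: open_thickening.
  by have [q []] := cp _ nT.
move=> k _; apply: contrapT => nT; apply: np.
have k0 : 0 < k.+1%:R^-1 :> R by rewrite invr_gt0.
apply: filterS (polar_nbhs p k0) => q /= pq [q' Bq' q'q]; apply: nT; exists q' => //.
by apply: polar_dist_lt_trans q'q _; rewrite polar_dist_sym.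
Qed.

Lemma thickening_bounded B e : polar_bounded B -> polar_bounded (thickening B e).
Proof.
move=> /polar_boundedP[C hC]; apply/polar_boundedP; exists (C + e) => p [q Bq].
move=> /polar_dist_ltP[+ _]; rewrite distrC => /(le_lt_trans (ler_norm _)).
by have := hC q Bq; lra.
Qed.

(** ** Neighbourhoods of the points at infinite radius *)

Lemma level_radius_boundary (s : R) :
  let O := [set p : polar R d | inv_radius p < s] in
  closure O `\` interior O `<=` [set p | inv_radius p = s].
Proof.
move=> O p [cp np] /=; apply/le_anti/andP; split; last first.
  rewrite leNgt; apply/negP => ps; apply: np.
  by apply: open_nbhs_nbhs; split => //; exact: open_radius.
apply/ler_addgt0Pr => e e0; have [q [/= qs pq]] := cp _ (polar_nbhs p e0).
have qs' : inv_radius q < s by [].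
move: pq => /polar_dist_ltP[/(le_lt_trans (ler_norm _)) + _]; move: qs'; clear.
by move: (inv_radius p) (inv_radius q) => a b *; lra.
Qed.

Lemma measurable_level_radius (s : R) :
  measurable ([set p | inv_radius p = s] : set (borel (polar R d))).
Proof.
rewrite (_ : [set _ | _] = (\bigcap_k [set p : polar R d | inv_radius p < s + k.+1%:R^-1])
   `\` [set p : polar R d | inv_radius p < s]).
  apply: measurableD; last exact: measurable_inv_radius_lt.
  by apply: bigcapT_measurable => k; exact: measurable_inv_radius_lt.
apply/seteqP; split=> p /=.
  move=> ps; split; last by rewrite /= ps ltxx.
  by move=> k _ /=; rewrite ps ltrDl invr_gt0.
move=> [h /negP]; rewrite -leNgt => sp; apply/le_anti; rewrite sp andbT.
rewrite leNgt; apply/negP; rewrite -subr_gt0 => /invn_lt[k hk].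
by have := h k I; rewrite /= ltrBrDl in hk *; move=> /(lt_trans hk); rewrite ltxx.
Qed.

End thickenings.

(** * Regularly varying tails *)

Section tails.
Context {R : realType}.
(** [V] is a tail, [Q s] the limiting mass of the points with inverse radius below
    [s], and [G] the levels at which this mass is continuous. *)
Variables (V Q : R -> R) (a : nat -> R) (G : R -> Prop).
Hypotheses (V_ge0 : forall r, 0 <= V r)
  (V_mono : forall r s, r <= s -> V s <= V r)
  (a_gt0 : forall n, 0 < a n) (a_mono : nondecreasing_seq a)
  (a_inf : a n @[n --> \oo] --> +oo)
  (G_dense : forall r s, 0 < r -> r < s -> exists2 t, r < t < s & G t)
  (Q_mono : forall r s, r <= s -> Q r <= Q s)
  (Q_lim : forall s, 0 < s -> G s -> n%:R * V (a n / s) @[n --> \oo] --> Q s)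
  (Q_pos : exists2 s, 0 < s & 0 < Q s).

Lemma above_seq u : exists n, u < a n.
Proof.
have /cvgryPgt/(_ u)[N _ hN] := a_inf.
by exists N; apply: hN => /=.
Qed.

Lemma eventually_le s e : 0 < s -> G s -> 0 < e ->
  exists N, forall n, (N <= n)%N -> n%:R * V (a n / s) <= Q s + e.
Proof.
move=> s0 gs e0; have /cvgrPdist_le/(_ _ e0)[N _ hN] := Q_lim s0 gs.
exists N => n /hN; rewrite ler_distlC => /andP[_]; by [].
Qed.

Lemma eventually_ge s e : 0 < s -> G s -> 0 < e ->
  exists N, forall n, (N <= n)%N -> Q s - e <= n%:R * V (a n / s).
Proof.
move=> s0 gs e0; have /cvgrPdist_le/(_ _ e0)[N _ hN] := Q_lim s0 gs.
by exists N => n /hN; rewrite ler_distlC => /andP[].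
Qed.

Lemma Q_ge0 s : 0 < s -> 0 <= Q s.
Proof.
move=> s0; have s20 : 0 < s / 2 by rewrite divr_gt0.
have s2s : s / 2 < s by lra.
have [t /andP[st ts] gt_] := G_dense s20 s2s.
have t0 : 0 < t := lt_trans s20 st.
apply: le_trans (Q_mono (ltW ts)); apply/ler_addgt0Pr => e e0.
have [N hN] := eventually_le t0 gt_ e0.
by apply: le_trans (hN N (leqnn _)); rewrite mulr_ge0.
Qed.

(** A limit vanishing at some level would force [a (k n)] to stay below a
    multiple of [a n] not depending on [k], although the mass beyond a fixed
    level is then multiplied by [k]. *)
Lemma Q_gt0 s : 0 < s -> 0 < Q s.
Proof.
move=> s0; rewrite lt_def Q_ge0 // andbT; apply/eqP => Qs0.
have [sp0 sp00 Qsp0] := Q_pos.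
have s20 : 0 < s / 2 by rewrite divr_gt0.
have s2s : s / 2 < s by lra.
have [sg /andP[s2g gs] Gsg] := G_dense s20 s2s.
have sg0 : 0 < sg := lt_trans s20 s2g.
have Qsg : Q sg = 0.
  by apply/le_anti; rewrite Q_ge0 // andbT -Qs0 Q_mono // ltW.
have sp1 : sp0 < sp0 + 1 by rewrite ltrDl.
have [sp /andP[spp _] Gsp] := G_dense sp00 sp1.
have sp_gt0 : 0 < sp := lt_trans sp00 spp.
have Qsp : 0 < Q sp := lt_le_trans Qsp0 (Q_mono (ltW spp)).
pose C := sp / sg; have C0 : 0 < C by rewrite divr_gt0.
have Csp0 : 0 < C * sp by rewrite mulr_gt0.
have Csp1 : C * sp < C * sp + 1 by rewrite ltrDl.
have [t /andP[Ct _] Gt] := G_dense Csp0 Csp1.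
have t0 : 0 < t := lt_trans Csp0 Ct.
have Q20 : 0 < Q sp / 2 by rewrite divr_gt0.
have [N1 h1] := eventually_ge sp_gt0 Gsp Q20.
have [N3 h3] := eventually_le t0 Gt ltr01.
suff bound k : (0 < k)%N -> k%:R * (Q sp / 2) <= Q t + 1.
  have [k hk] : exists k : nat, (Q t + 1) / (Q sp / 2) < k%:R.
    by exists (Num.truncn ((Q t + 1) / (Q sp / 2))).+1; exact: truncnS_gt.
  have k0 : (0 < k)%N.
    rewrite -(ltr_nat R); apply: le_lt_trans hk.
    by rewrite divr_ge0 ?(ltW Q20) // addr_ge0 ?Q_ge0.
  have := bound k k0; rewrite leNgt => /negP; apply.
  by rewrite -ltr_pdivrMr.
move=> k0.
have kQ : 0 < Q sp / 4 / k%:R by rewrite !divr_gt0 // ltr0n.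
have [N2 h2] := eventually_le sg0 Gsg kQ.
pose n := maxn N1 (maxn N2 (maxn N3 1)).
have n1 : (N1 <= n)%N by exact: leq_maxl.
have n2 : (N2 <= n)%N by rewrite /n !leq_max leqnn orbT.
have n3 : (N3 <= n)%N by rewrite /n !leq_max leqnn !orbT.
have nkn : (n <= k * n)%N by rewrite leq_pmull.
have k_gt0 : 0 < k%:R :> R by rewrite ltr0n.
have growth : a (k * n)%N / sp < a n / sg.
  rewrite ltNge; apply/negP => /V_mono Vle.
  have := h1 _ (leq_trans n1 nkn); have := h2 _ n2; rewrite Qsg add0r.
  rewrite ler_pdivlMr // => h2' h1'.
  have : (k * n)%:R * V (a (k * n)%N / sp) <= Q sp / 4.
    apply: le_trans h2'; rewrite natrM mulrC mulrA [X in _ <= X]mulrC mulrA.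
    by rewrite -mulrA mulrC [k%:R * n%:R]mulrC ler_wpM2l // mulr_ge0.
  by move: h1' Qsp; move: (_ * _) (Q sp) => b c *; lra.
have Vkn : V (a n / sp) <= V (a (k * n)%N / t).
  apply: V_mono; rewrite ler_pdivrMr // mulrAC ler_pdivlMr //.
  move: growth; rewrite ltr_pdivrMr // => growth.
  apply: (@le_trans _ _ (a n / sg * sp * sp)); first by rewrite ler_pM2r // ltW.
  have -> : a n / sg * sp * sp = a n * (C * sp) by rewrite /C; ring.
  by rewrite ler_pM2l // ltW.
have := h3 _ (leq_trans n3 nkn); apply: le_trans.
apply: (@le_trans _ _ (k%:R * (n%:R * V (a n / sp)))).
  rewrite ler_pM2l //; apply: le_trans (h1 _ n1).
  by move: (Q sp) => b; lra.
by rewrite natrM mulrA ler_wpM2l // mulr_ge0.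
Qed.

Lemma tail_seq_bounded c : 0 < c ->
  exists K N, 0 < K /\ forall n, (N <= n)%N -> n%:R * V (c * a n) <= K.
Proof.
move=> c0; have c10 : 0 < c^-1 by rewrite invr_gt0.
have c11 : c^-1 < c^-1 + 1 by rewrite ltrDl.
have [s /andP[cs _] gs] := G_dense c10 c11.
have s0 := lt_trans c10 cs.
have [N hN] := eventually_le s0 gs ltr01.
exists (Q s + 1), N; split; first by rewrite ltr_wpDl // Q_ge0.
move=> n /hN; apply: le_trans; rewrite ler_wpM2l // V_mono //.
by rewrite mulrC ler_pM2r // -[c]invrK lef_pV2 ?posrE // ltW.
Qed.

Lemma tail_vanishes e : 0 < e -> exists u0, forall u, u0 <= u -> V u <= e.
Proof.
move=> e0; have [K [N [K0 hN]]] := tail_seq_bounded ltr01.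
have [m hm] : exists m : nat, K / e < m%:R.
  by exists (Num.truncn (K / e)).+1; exact: truncnS_gt.
pose n := maxn N m; exists (a n) => u anu.
have n0 : 0 < n%:R :> R.
  apply: (@lt_le_trans _ _ m%:R); last by rewrite ler_nat leq_maxr.
  by apply: lt_trans hm; rewrite divr_gt0.
apply: (@le_trans _ _ (K / n%:R)).
  rewrite ler_pdivlMr // mulrC; apply: le_trans (hN n (leq_maxl _ _)).
  by rewrite mul1r ler_wpM2l // V_mono.
rewrite ler_pdivrMr // mulrC -ler_pdivrMr // ltW // (lt_le_trans hm) //.
by rewrite ler_nat leq_maxr.
Qed.

(** For [u] between [a n] and [a n.+1], both tails are of order [1/n]. *)
Lemma tail_O c : 0 < c -> exists K u0, 0 < K /\
  forall u, u0 <= u -> 0 < V u /\ V (c * u) <= K * V u.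
Proof.
move=> c0; have [K [N1 [K0 h1]]] := tail_seq_bounded c0.
have hh : 0 < 1 / 2 :> R by rewrite divr_gt0.
have h12 : 1 / 2 < 1 :> R by lra.
have [s /andP[hs s1] gs] := G_dense hh h12.
have s0 : 0 < s := lt_trans hh hs.
have Qs := Q_gt0 s0; have Q20 : 0 < Q s / 2 by rewrite divr_gt0.
have [N2 h2] := eventually_ge s0 gs Q20.
pose M := maxn N1 (maxn N2 1).
exists (4 * K / Q s), (a M); split; first by rewrite divr_gt0 // mulr_gt0.
move=> u Mu; have ex := above_seq u; case: (ex_minnP ex) => m um minm.
have Mm : (M < m)%N.
  by rewrite ltnNge; apply/negP => /a_mono; rewrite leNgt (le_lt_trans Mu um).
case: m um minm Mm => // n um minm Mn; rewrite ltnS in Mn.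
have anu : a n <= u.
  by rewrite leNgt; apply/negP => /minm; rewrite ltnn.
have n1 : (N1 <= n)%N by apply: leq_trans Mn; exact: leq_maxl.
have n2 : (N2 <= n)%N by apply: leq_trans Mn; rewrite /M !leq_max leqnn orbT.
have n0 : (0 < n)%N by apply: leq_trans Mn; rewrite /M !leq_max leqnn !orbT.
have n0' : 0 < n%:R :> R by rewrite ltr0n.
have low : Q s / 2 / n.+1%:R <= V u.
  rewrite ler_pdivrMr // [leRHS]mulrC.
  have := h2 n.+1 (leqW n2); have -> : Q s - Q s / 2 = Q s / 2 by lra.
  move=> /le_trans; apply; rewrite ler_wpM2l // V_mono // (le_trans (ltW um)) //.
  by rewrite ler_pdivlMr // ler_piMr // ltW.
have low' : Q s / 4 / n%:R <= V u.
  apply: le_trans low; have -> : Q s / 2 / n.+1%:R = Q s / 4 * (2 / n.+1%:R) by field; rewrite ?pnatr_eq0.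
  rewrite ler_pM2l ?divr_gt0 // ler_pdivlMr // [leLHS]mulrC ler_pdivrMr //.
  by rewrite -natrM ler_nat mul2n -addnn -addn1 leq_add2l.
have up : V (c * u) <= K / n%:R.
  rewrite ler_pdivlMr // mulrC; apply: le_trans (h1 n n1).
  by rewrite ler_wpM2l // V_mono // ler_pM2l.
split; first by apply: lt_le_trans low'; rewrite !divr_gt0.
apply: le_trans up _; apply: (@le_trans _ _ (4 * K / Q s * (Q s / 4 / n%:R))).
  have -> : 4 * K / Q s * (Q s / 4 / n%:R) = K / n%:R.
    by field; rewrite pnatr_eq0 -lt0n n0 gt_eqF.
  by [].
by rewrite ler_wpM2l // ltW // divr_gt0 // mulr_gt0.
Qed.

End tails.

(** * The tail of a regularly varying process *)

Section regularly_varying.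
Context {R : realType} {d : nat} {disp : measure_display} {Omega : measurableType disp}.
Variables (P : probability Omega R) (X : Omega -> skorokhod R d) (a : nat -> R).
Variable m : {measure set (borel (polar R d)) -> \bar R}.
Hypothesis X_RV : RV P X a m.

Lemma RV_measurable : measurable_fun setT (X : Omega -> borel (skorokhod R d)).
Proof. by case: X_RV. Qed.

Lemma RV_norming_gt0 n : 0 < a n. Proof. by case: X_RV => _ []. Qed.

Lemma RV_fin (B : set (polar R d)) : measurable (B : set (borel (polar R d))) ->
  polar_bounded B -> m B \is a fin_num.
Proof. by case: X_RV => _ _ [_ h] _ _ mB bB; rewrite ge0_fin_numE ?h. Qed.

Lemma measurable_scaled_trace (Z : Omega -> skorokhod R d) (B : set (polar R d)) c :
  measurable_fun setT (Z : Omega -> borel (skorokhod R d)) ->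
  measurable (B : set (borel (polar R d))) ->
  measurable [set w | polar_trace B (sk_scale c (Z w))].
Proof.
move=> mZ mB; have mcZ := measurable_sk_scale c mZ.
have := mcZ measurableT _ (measurable_polar_trace mB).
by rewrite setTI.
Qed.

Lemma RV_cvg (B : set (polar R d)) : measurable (B : set (borel (polar R d))) ->
  polar_bounded B -> m (closure B `\` interior B) = 0%E ->
  n%:R * fine (P [set w | polar_trace B (sk_scale (a n)^-1 (X w))]) @[n --> \oo]
    --> fine (m B).
Proof.
move=> mB bB dB; case: X_RV => _ _ _ _ /(_ B mB bB dB).
rewrite -[X in _ --> X -> _](fineK (RV_fin mB bB)) => /fine_cvg.
apply: cvg_trans; apply: near_eq_cvg; near=> n => /=.
by rewrite fineM //; apply: fin_num_measure; apply: measurable_scaled_trace => //; exact: RV_measurable.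
Unshelve. all: by end_near. Qed.

Lemma boundary_null (B C : set (polar R d)) : measurable (C : set (borel (polar R d))) ->
  closure B `\` interior B `<=` C -> m C = 0%E -> m (closure B `\` interior B) = 0%E.
Proof.
move=> mC BC C0; apply/le_anti/andP; split; last exact: measure_ge0.
rewrite -C0; apply: le_measure; rewrite ?inE //.
apply: measurableD.
  by apply: closed_measurable_polar; exact: closed_closure.
by apply: open_measurable_polar; exact: open_interior.
Qed.

Definition tailV (r : R) : R := fine (tail P X r).
Definition mass (s : R) : R := fine (m [set p | inv_radius p < s]).
Definition good_level (s : R) : Prop := m [set p | inv_radius p = s] = 0%E.

Lemma tailE r : tail P X r = (tailV r)%:E.
Proof.
rewrite /tailV fineK //; apply: fin_num_measure.
by apply: measurable_snorm; exact: RV_measurable.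
Qed.

Lemma tailV_ge0 r : 0 <= tailV r.
Proof. by rewrite -lee_fin -tailE measure_ge0. Qed.

Lemma tailV_mono r s : r <= s -> tailV s <= tailV r.
Proof.
move=> rs; rewrite -lee_fin -!tailE; apply: le_measure; rewrite ?inE.
- by apply: measurable_snorm; exact: RV_measurable.
- by apply: measurable_snorm; exact: RV_measurable.
- by move=> w /=; exact: le_lt_trans.
Qed.

Lemma radius_bounded s : polar_bounded [set p : polar R d | inv_radius p < s].
Proof. by apply/polar_boundedP; exists s => p /= /ltW. Qed.

(** The level sets of the radius are disjoint. *)
Lemma good_level_dense r s : 0 < r -> r < s -> exists2 t, r < t < s & good_level t.
Proof.
move=> r0 rs; have mO := @measurable_inv_radius_lt R d s.
apply: (@null_level _ _ _ m [set p | inv_radius p < s] (fun t => [set p | inv_radius p = t])) => //.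
- by rewrite -ge0_fin_numE ?measure_ge0 // RV_fin //; exact: radius_bounded.
- move=> t /andP[_ ts]; split; first exact: measurable_level_radius.
  by move=> p /= ->.
- by move=> t t' p + /= e1 e2; rewrite -e1 -e2 ltxx.
Qed.

Lemma mass_mono r s : r <= s -> mass r <= mass s.
Proof.
move=> rs; rewrite fine_le ?RV_fin //; try exact: measurable_inv_radius_lt; try exact: radius_bounded.
apply: le_measure; rewrite ?inE; try exact: measurable_inv_radius_lt.
by move=> p /= /lt_le_trans; apply.
Qed.

Lemma trace_radius s n : 0 < s -> [set w | polar_trace [set p | inv_radius p < s]
    (sk_scale (a n)^-1 (X w))] = [set w | a n / s < snorm (X w)].
Proof.
move=> s0; have s0' : 0 < s^-1 by rewrite invr_gt0.
have an := RV_norming_gt0 n.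
have h (x : skorokhod R d) : (s^-1 < snorm (sk_scale (a n)^-1 x)) = (a n / s < snorm x).
  rewrite snorm_scale normfV (ger0_norm (ltW an)) mulrC ltr_pdivlMr //.
  by rewrite mulrC.
apply/seteqP; split=> w /=; rewrite -h.
  by move=> ht; apply/(polar_trace_radius _ s0'); rewrite invrK.
by move=> /(polar_trace_radius _ s0'); rewrite invrK.
Qed.

Lemma tail_cvg s : 0 < s -> good_level s ->
  n%:R * tailV (a n / s) @[n --> \oo] --> mass s.
Proof.
move=> s0 gs; rewrite (_ : (fun n => _) = (fun n => n%:R * fine (P [set w |
    polar_trace [set p | inv_radius p < s] (sk_scale (a n)^-1 (X w))]))).
  apply: RV_cvg; first exact: measurable_inv_radius_lt.
    exact: radius_bounded.
  apply: boundary_null gs; first exact: measurable_level_radius.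
  exact: level_radius_boundary.
by apply/funext => n; rewrite trace_radius.
Qed.

(** The neighbourhoods of infinite radius exhaust the polar space. *)
Lemma mass_pos : exists2 s, 0 < s & 0 < mass s.
Proof.
apply: contrapT => none; case: X_RV => _ _ [mT _] _ _; apply: mT.
have -> : setT = \bigcup_k [set p : polar R d | inv_radius p < k.+1%:R].
  apply/seteqP; split=> // p _; exists (Num.truncn (inv_radius p)) => //=.
  exact: truncnS_gt.
apply/le_anti/andP; split; last exact: measure_ge0.
apply: measure_incr_le.
- by move=> k; exact: measurable_inv_radius_lt.
- apply/nondecreasing_seqP => k; apply/subsetPset => p /= /lt_le_trans; apply.
  by rewrite ler_nat.
- move=> k; rewrite leNgt; apply/negP => h; apply: none; exists k.+1%:R => //.
  by rewrite -lte_fin fineK // RV_fin //; [exact: measurable_inv_radius_lt|exact: radius_bounded].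
Qed.

Lemma RV_tail_seq c : 0 < c ->
  exists K N, 0 < K /\ forall n, (N <= n)%N -> n%:R * tailV (c * a n) <= K.
Proof.
exact: (tail_seq_bounded tailV_ge0 tailV_mono RV_norming_gt0 good_level_dense mass_mono tail_cvg).
Qed.

Lemma RV_tail_vanishes e : 0 < e -> exists u0, forall u, u0 <= u -> tailV u <= e.
Proof.
exact: (tail_vanishes tailV_ge0 tailV_mono RV_norming_gt0 good_level_dense mass_mono tail_cvg).
Qed.

Lemma RV_tail_O c : 0 < c -> exists K u0, 0 < K /\
  forall u, u0 <= u -> 0 < tailV u /\ tailV (c * u) <= K * tailV u.
Proof.
case: X_RV => _ [_ [a_mono a_inf]] _ _ _.
exact: (tail_O tailV_ge0 tailV_mono RV_norming_gt0 a_mono a_inf good_level_dense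
  mass_mono tail_cvg mass_pos).
Qed.

End regularly_varying.

(** * The largest jump of a regularly varying Levy process *)

Section largest_jump_limit.
Context {R : realType} {d : nat} {disp : measure_display} {Omega : measurableType disp}.
Variables (P : probability Omega R) (X : Omega -> skorokhod R d) (a : nat -> R).
Variable m : {measure set (borel (polar R d)) -> \bar R}.
Hypotheses (X_levy : levy P X) (X_RV : RV P X a m).

Let V := tailV P X.
Let Y w := largest_jump (X w).
Let mX : measurable_fun setT (X : Omega -> borel (skorokhod R d)) := RV_measurable X_RV.

Lemma levy_coords01 t : 0 <= t <= 1 -> measurable_coords (fun w => X w t).
Proof. exact: (levy_coords X_levy). Qed.

Lemma RV_measurable_largest_jump :
  measurable_fun setT (Y : Omega -> borel (skorokhod R d)).
Proof. exact: measurable_largest_jump levy_coords01. Qed.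

(** [D / 4] serves for both factors of [exceptional_le]. *)
Lemma exceptional_tail (D u : R) : 0 <= D -> 0 <= u ->
  fine (P (exceptional X (D * u))) <= V (D / 4 * u) * V (D / 4 * u).
Proof.
move=> D0 u0; have Du : 0 <= D * u by exact: mulr_ge0.
have := exceptional_le X_levy mX Du; rewrite !(tailE X_RV) -EFinM.
rewrite -(fineK (fin_num_measure P _ (measurable_exceptional X_levy Du))) lee_fin.
have -> : D * u / 4 = D / 4 * u by ring.
move/le_trans; apply; apply: ler_wpM2r; first exact: (tailV_ge0 X_RV).
apply: (tailV_mono X_RV).
have -> : D / 4 * u = D * u / 4 by ring.
by rewrite ler_wpM2l // lef_pV2 ?posrE // ler_nat.
Qed.

Lemma scaled_close (D u : R) w : 0 < D -> 0 < u -> ~ exceptional X (D * u) w ->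
  J1close (6 * D) (sk_scale u^-1 (X w)) (sk_scale u^-1 (Y w)).
Proof.
move=> D0 u0 nE; apply: J1close_uniform; first by rewrite mulr_ge0 // ltW.
move=> t t01; rewrite /= -scalerBr enormZ normfV (ger0_norm (ltW u0)).
rewrite mulrC ler_pdivrMr // -mulrA.
by apply: not_exceptional_close => //; rewrite mulr_gt0.
Qed.

Let far (e u : R) : set Omega :=
  [set w | (e%:E < J1dist (sk_scale u^-1 (X w)) (sk_scale u^-1 (Y w)))%E].

Lemma far_exceptional (e u : R) : 0 < e -> 0 < u ->
  far e u `<=` exceptional X (e / 6 * u).
Proof.
move=> e0 u0 w fw; apply: contrapT => nE.
have e60 : 0 < e / 6 by rewrite divr_gt0.
have := J1close_dist_le (scaled_close e60 u0 nE).
have -> : 6 * (e / 6) = e by field.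
by move=> /(lt_le_trans fw); rewrite ltxx.
Qed.

Let m_far e u : measurable (far e u).
Proof. exact: (measurable_J1dist_largest_jump levy_coords01). Qed.

Lemma far_tail (e u : R) : 0 < e -> 0 < u ->
  fine (P (far e u)) <= V (e / 24 * u) * V (e / 24 * u).
Proof.
move=> e0 u0; have e60 : 0 <= e / 6 by rewrite divr_ge0 // ltW.
have mE := measurable_exceptional X_levy (mulr_ge0 e60 (ltW u0)).
apply: (@le_trans _ _ (fine (P (exceptional X (e / 6 * u))))).
  rewrite fine_le ?fin_num_measure //; apply: le_measure; rewrite ?inE //.
  exact: far_exceptional.
have := exceptional_tail e60 (ltW u0).
by have -> : e / 6 / 4 = e / 24 by field.
Qed.

(** Of the two factors [V (e / 24 * u)] bounding the probability of the event, one
    is compared with the probability of the condition and the other vanishes. *)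
Lemma cond_far_cvg (e k u0 : R) (B : R -> set Omega) : 0 < e -> 0 < k ->
  (forall u, measurable (B u)) ->
  (forall u, u0 <= u -> k * V u <= fine (P (B u))) ->
  cond_prob P (far e u) (B u) @[u --> +oo] --> 0%E.
Proof.
move=> e0 k0 mB hB.
have e240 : 0 < e / 24 by rewrite divr_gt0.
have [K [u1 [K0 hO]]] := RV_tail_O X_RV e240.
have PB u : u0 <= u -> u1 <= u -> 0 < fine (P (B u)).
  move=> h0 h1; apply: lt_le_trans (hB u h0); rewrite mulr_gt0 //.
  by have [] := hO u h1.
have condE u : u0 <= u -> u1 <= u -> cond_prob P (far e u) (B u) =
    (fine (P (far e u `&` B u)) / fine (P (B u)))%:E.
  move=> h0 h1; have mAB : measurable (far e u `&` B u) by exact: measurableI.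
  rewrite /cond_prob -(fineK (fin_num_measure P _ mAB)).
  rewrite -(fineK (fin_num_measure P _ (mB u))) inver gt_eqF ?PB //.
apply/fine_cvgP; split.
  near=> u; rewrite condE //; near: u; by apply: nbhs_pinfty_ge; rewrite num_real.
apply/cvgrPdist_le => x x0.
have xK : 0 < x * k / K by rewrite divr_gt0 // mulr_gt0.
have [u2 hV] := RV_tail_vanishes X_RV xK.
near=> u.
have u00 : u0 <= u by near: u; by apply: nbhs_pinfty_ge; rewrite num_real.
have u11 : u1 <= u by near: u; by apply: nbhs_pinfty_ge; rewrite num_real.
have upos : 0 < u by near: u; by apply: nbhs_pinfty_gt; rewrite num_real.
have u22 : u2 <= e / 24 * u.
  rewrite mulrC -ler_pdivrMr //; near: u; by apply: nbhs_pinfty_ge; rewrite num_real.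
rewrite sub0r normrN /= condE //=.
rewrite ger0_norm; last by rewrite divr_ge0 // fine_ge0.
rewrite ler_pdivrMr ?PB //.
have [Vu hOu] := hO u u11.
apply: (@le_trans _ _ (fine (P (far e u)))).
  rewrite fine_le ?fin_num_measure //; first exact: measurableI.
  by apply: le_measure; rewrite ?inE //; exact: measurableI.
apply: le_trans (far_tail e0 upos) _.
apply: (@le_trans _ _ (K * V u * (x * k / K))).
  by rewrite ler_pM ?(tailV_ge0 X_RV) // hV.
have -> : K * V u * (x * k / K) = x * (k * V u) by field; rewrite gt_eqF.
by rewrite ler_pM2l // hB.
Unshelve. all: by end_near. Qed.

Lemma snorm_largest_jump w : snorm (Y w) = enorm (jump (X w) (tau (X w))).
Proof.
rewrite /Y largest_jumpE snorm_one_jump ?jump_jmp //.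
by have /andP[/ltW -> ->] := tau_itv (X w).
Qed.

(** Outside [exceptional X (u / 6)] the path is within [u] of its largest jump, so
    that a norm beyond [2 u] comes from a jump beyond [u]; the exceptional event is
    negligible with respect to [V (2 u)]. *)
Lemma largest_jump_tail : exists k u0, 0 < k /\ forall u, u0 <= u ->
  k * V u <= fine (P [set w | u < enorm (jump (X w) (tau (X w)))]).
Proof.
have h2 : 0 < 2^-1 :> R by rewrite invr_gt0.
have c0 : 0 < 6^-1 / 4 :> R by rewrite divr_gt0 // invr_gt0.
have [K2 [u2 [K20 hO2]]] := RV_tail_O X_RV h2.
have [K [u1 [K0 hO]]] := RV_tail_O X_RV c0.
have small : 0 < (2 * K2 * K)^-1 by rewrite invr_gt0 !mulr_gt0.
have [u3 hV] := RV_tail_vanishes X_RV small.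
exists (2 * K2)^-1, (Num.max (Num.max 1 (u3 * 24)) (Num.max u1 u2)).
split; first by rewrite invr_gt0 mulr_gt0.
move=> u; rewrite !ge_max => /andP[/andP[u1' uu3] /andP[uu1 uu2]].
have u0 : 0 < u := lt_le_trans ltr01 u1'.
set B := [set w | _].
have mB : measurable B.
  rewrite /B (_ : [set w | _] = [set w | u < snorm (Y w)]).
    by apply: measurable_snorm; exact: RV_measurable_largest_jump.
  by apply/seteqP; split=> w /=; rewrite snorm_largest_jump.
have D0 : 0 < 6^-1 :> R by rewrite invr_gt0.
have Du0 : 0 <= 6^-1 * u by rewrite mulr_ge0 // ltW.
have mE := measurable_exceptional X_levy Du0.
have mT := measurable_snorm (2 * u) mX.
have sub : [set w | 2 * u < snorm (X w)] `<=` B `|` exceptional X (6^-1 * u).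
  move=> w /= hw; have [|nE] := pselect (exceptional X (6^-1 * u) w); first by right.
  left; rewrite /B /= -snorm_largest_jump.
  have : J1close u (X w) (Y w).
    apply: J1close_uniform; first exact: ltW.
    move=> t t01; have -> : u = 6 * (6^-1 * u) by field.
    by apply: not_exceptional_close => //; rewrite mulr_gt0.
  by move=> /J1close_snorm; move: hw; lra.
have main : V (2 * u) <= fine (P B) + fine (P (exceptional X (6^-1 * u))).
  rewrite -lee_fin EFinD -(tailE X_RV) !fineK ?fin_num_measure //.
  apply: (@le_trans _ _ (P (B `|` exceptional X (6^-1 * u)))).
    by apply: le_measure; rewrite ?inE //; exact: measurableU.
  exact: measureU2.
have exc := exceptional_tail (ltW D0) (ltW u0).
have [Vu hOu] := hO u uu1.
have Vc : V (6^-1 / 4 * u) <= (2 * K2 * K)^-1.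
  apply: hV; have -> : 6^-1 / 4 = 24^-1 :> R by field.
  by rewrite mulrC ler_pdivlMr.
have exc' : fine (P (exceptional X (6^-1 * u))) <= V u * (2 * K2)^-1.
  apply: le_trans exc _; apply: (@le_trans _ _ (K * V u * (2 * K2 * K)^-1)).
    by rewrite ler_pM ?(tailV_ge0 X_RV).
  have -> : K * V u * (2 * K2 * K)^-1 = V u * (2 * K2)^-1.
    by field; rewrite !gt_eqF.
  by [].
have lower : K2^-1 * V u <= V (2 * u).
  have u22 : u2 <= 2 * u by apply: le_trans uu2 _; move: u0; lra.
  have [_] := hO2 _ u22; have -> : 2^-1 * (2 * u) = u by field.
  by rewrite ler_pdivrMl.
have -> : (2 * K2)^-1 * V u = K2^-1 * V u - V u * (2 * K2)^-1.
  by field; rewrite gt_eqF.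
by rewrite lerBlDr (le_trans lower) // (le_trans main) // lerD2l.
Qed.

End largest_jump_limit.

Section largest_jump_RV.
Context {R : realType} {d : nat} {disp : measure_display} {Omega : measurableType disp}.

Variables (P : probability Omega R) (X : Omega -> skorokhod R d) (a : nat -> R).
Variable m : {measure set (borel (polar R d)) -> \bar R}.
Hypotheses (X_levy : levy P X) (X_RV : RV P X a m).

Let V := tailV P X.
Let Y w := largest_jump (X w).
Let mX : measurable_fun setT (X : Omega -> borel (skorokhod R d)) := RV_measurable X_RV.
Let mY : measurable_fun setT (Y : Omega -> borel (skorokhod R d)) :=
  RV_measurable_largest_jump X_levy.

(** The square of a quantity of order [1/n], multiplied by [n]. *)
Lemma exceptional_seq (D e : R) : 0 < D -> 0 < e -> exists N, forall n, (N <= n)%N ->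
  n%:R * fine (P (exceptional X (D * a n))) <= e.
Proof.
move=> D0 e0; have D40 : 0 < D / 4 by rewrite divr_gt0.
have [K [N [K0 hN]]] := RV_tail_seq X_RV D40.
have eK : 0 < e / K by rewrite divr_gt0.
have [u0 hu] := RV_tail_vanishes X_RV eK.
have [M hM] : exists M, forall n, (M <= n)%N -> u0 <= D / 4 * a n.
  case: X_RV => _ [_ [_ /cvgryPge/(_ (u0 / (D / 4)))[M _ hM]]] _ _ _.
  by exists M => n /hM /=; rewrite ler_pdivrMr // mulrC.
exists (maxn N M) => n; rewrite geq_max => /andP[Nn Mn].
have an := RV_norming_gt0 X_RV n.
apply: (@le_trans _ _ (n%:R * (V (D / 4 * a n) * V (D / 4 * a n)))).
  by rewrite ler_wpM2l // (exceptional_tail X_levy X_RV) // ltW.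
rewrite mulrA; have -> : e = K * (e / K) by field; rewrite gt_eqF.
by rewrite ler_pM ?mulr_ge0 ?(tailV_ge0 X_RV) ?hN ?hu ?hM.
Qed.

Lemma scaled_close_seq (D : R) : 0 < D -> exists2 D', 0 < D' & forall n w,
  ~ exceptional X (D' * a n) w ->
  J1close D (sk_scale (a n)^-1 (X w)) (sk_scale (a n)^-1 (Y w)).
Proof.
move=> D0; exists (D / 6); first by rewrite divr_gt0.
move=> n w nE; have -> : D = 6 * (D / 6) by field.
apply: scaled_close nE; first by rewrite divr_gt0.
exact: RV_norming_gt0 X_RV n.
Qed.

Let sandwich (b y x1 x2 t1 t2 e1 e2 e : R) : y <= x1 + e1 -> x2 <= y + e2 ->
  e1 <= e / 3 -> e2 <= e / 3 -> t2 - e / 3 <= x2 -> x1 <= t1 + e / 3 ->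
  t1 <= b + e / 3 -> b - e / 3 <= t2 -> b - e <= y <= b + e.
Proof. by move=> *; apply/andP; split; lra. Qed.

Section one_set.
Variable B : set (polar R d).
Hypotheses (mB : measurable (B : set (borel (polar R d)))) (bB : polar_bounded B)
  (dB : m (closure B `\` interior B) = 0%E).

Let traceX (C : set (polar R d)) n : set Omega :=
  [set w | polar_trace C (sk_scale (a n)^-1 (X w))].
Let traceY (C : set (polar R d)) n : set Omega :=
  [set w | polar_trace C (sk_scale (a n)^-1 (Y w))].

Let m_traceX C n : measurable (C : set (borel (polar R d))) -> measurable (traceX C n).
Proof. exact: measurable_scaled_trace. Qed.

Let m_traceY C n : measurable (C : set (borel (polar R d))) -> measurable (traceY C n).
Proof. exact: measurable_scaled_trace. Qed.

Let m_exc n (D : R) : 0 < D -> measurable (exceptional X (D * a n)).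
Proof.
move=> D0; apply: (measurable_exceptional X_levy).
by rewrite mulr_ge0 ?ltW // (RV_norming_gt0 X_RV).
Qed.

Lemma bounded_radius : exists2 r, 0 < r & forall p, B p -> inv_radius p <= r^-1.
Proof.
have [C hC] := (polar_boundedP B).1 bB.
exists (Num.max C 1)^-1; first by rewrite invr_gt0 lt_max ltr01 orbT.
by move=> p /hC pC; rewrite invrK le_max pC.
Qed.

(** Outside the exceptional event the two scaled paths are uniformly close, so
    their polar images are close: [B] keeps these away from the origin. *)
Lemma traceY_sub (e : R) : 0 < e -> exists2 D, 0 < D & forall n,
  traceY B n `<=` traceX (thickening B e) n `|` exceptional X (D * a n).
Proof.
move=> e0; have [r r0 hr] := bounded_radius.
have [D1 D10 hD1] := @polar_of_transfer R d _ _ r0 e0.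
have [D D0 hD] := scaled_close_seq D10.
exists D => // n w [p Bp Yp].
have [|nE] := pselect (exceptional X (D * a n) w); first by right.
left; have [q Xq pq] := hD1 _ _ p (J1close_sym (hD n w nE)) Yp (hr p Bp).
by exists q => //; exists p.
Qed.

Lemma traceX_sub (e : R) : 0 < e -> exists2 D, 0 < D & forall n,
  traceX (~` thickening (~` B) e) n `<=` traceY B n `|` exceptional X (D * a n).
Proof.
move=> e0; have [r r0 hr] := bounded_radius.
have [D1 D10 hD1] := @polar_of_transfer R d _ _ r0 e0.
have [D D0 hD] := scaled_close_seq D10.
exists D => // n w [p nTp Xp].
have [|nE] := pselect (exceptional X (D * a n) w); first by right.
have Bp : B p by apply: contrapT => nBp; apply: nTp; exact: sub_thickening.
left; have [q Yq pq] := hD1 _ _ p (hD n w nE) Xp (hr p Bp).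
exists q => //; apply: contrapT => nBq; apply: nTp; exists q => //.
by rewrite polar_dist_sym.
Qed.

Let mB_fin : m B \is a fin_num. Proof. exact: (RV_fin X_RV). Qed.

Let m_int : measurable (interior B : set (borel (polar R d))).
Proof. by apply: open_measurable_polar; exact: open_interior. Qed.

Let m_clo : measurable (closure B : set (borel (polar R d))).
Proof. by apply: closed_measurable_polar; exact: closed_closure. Qed.

Let measure_closure : (m (closure B) <= m (interior B))%E.
Proof.
have cE : closure B = interior B `|` (closure B `\` interior B).
  apply/seteqP; split=> p; last first.
    by case=> [/interior_subset/subset_closure|[]].
  by move=> cp; have [ip|ip] := pselect (interior B p); [left|right].
apply: (@le_trans _ _ (m (interior B) + m (closure B `\` interior B))%E).
  by rewrite {1}cE; apply: measureU2 => //; exact: measurableD.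
by rewrite dB adde0.
Qed.

(** The thickenings decrease to the closure of [B], which has the mass of [B]; all
    but countably many of them have a null boundary. *)
Lemma outer_approx (e : R) : 0 < e -> exists2 D, 0 < D &
  m (level B D) = 0%E /\ fine (m (thickening B D)) <= fine (m B) + e.
Proof.
move=> e0; have mT k := measurable_thickening B k.+1%:R^-1.
have bT D : polar_bounded (thickening B D) by exact: thickening_bounded.
have fT D : m (thickening B D) \is a fin_num.
  by apply: (RV_fin X_RV) => //; exact: measurable_thickening.
have cv : m (thickening B k.+1%:R^-1) @[k --> \oo] --> m (closure B).
  rewrite closureE; apply: nonincreasing_cvg_mu => //.
  - by rewrite -ge0_fin_numE.
  - exact: bigcapT_measurable.
  - apply/nonincreasing_seqP => k; apply/subsetPset; apply: thickening_mono.
    by rewrite lef_pV2 ?posrE // ler_nat.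
have le_clo : (m (closure B) <= m B)%E.
  apply: le_trans measure_closure _; apply: le_measure; rewrite ?inE //.
  exact: interior_subset.
have [k hk] : exists k : nat, (m (thickening B k.+1%:R^-1) < m B + e%:E)%E.
  have lt_e : (m (closure B) < m B + e%:E)%E.
    by apply: le_lt_trans le_clo _; rewrite lteDl // lte_fin.
  have [N _ hN] := cv _ (open_ereal_lt' lt_e).
  by exists N; exact: (hN N (leqnn N)).
have k0 : 0 < k.+1%:R^-1 :> R by rewrite invr_gt0.
have [D /andP[D0 Dk] lD] : exists2 D, 0 < D < k.+1%:R^-1 & m (level B D) = 0%E.
  apply: (@null_level _ _ _ m (thickening B k.+1%:R^-1) (level B)) => //.
  - by rewrite -ge0_fin_numE.
  - move=> D /andP[_]; rewrite -subr_gt0 => /invn_lt[j hj].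
    split; first exact: measurable_level.
    move=> p [h _]; apply: (thickening_mono (e := D + j.+1%:R^-1)); last exact: h.
    by rewrite -lerBrDl ltW.
  - by move=> s s' p; exact: level_disjoint.
exists D => //; split=> //; rewrite -lee_fin EFinD !fineK //.
apply: le_trans (ltW hk); apply: le_measure; rewrite ?inE //.
  exact: measurable_thickening.
by apply: thickening_mono; exact: ltW.
Qed.

(** The complements of the thickenings of [~` B] increase to a set containing the
    interior of [B], which has the mass of [B]. *)
Lemma inner_approx (e : R) : 0 < e -> exists2 D, 0 < D &
  m (level (~` B) D) = 0%E /\ fine (m B) - e <= fine (m (~` thickening (~` B) D)).
Proof.
move=> e0; pose A D := ~` thickening (~` B) D.
pose Ak (k : nat) := A k.+1%:R^-1.
have mA D : measurable (A D : set (borel (polar R d))).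
  by apply: measurableC; exact: measurable_thickening.
have AB D : 0 < D -> A D `<=` B.
  by move=> D0 p nT; apply: contrapT => nB; apply: nT; exact: sub_thickening.
have fA D : 0 < D -> m (A D) \is a fin_num.
  move=> D0; rewrite ge0_fin_numE //; apply: (@le_lt_trans _ _ (m B)).
    by apply: le_measure; rewrite ?inE //; exact: AB.
  by rewrite -ge0_fin_numE.
have ge_int : (m B <= m (interior B))%E.
  apply: le_trans measure_closure; apply: le_measure; rewrite ?inE //.
  exact: subset_closure.
have [k hk] : exists k : nat, (m B - e%:E < m (Ak k))%E.
  apply: contrapT => none.
  have le_k k : (m (Ak k) <= m B - e%:E)%E.
    by rewrite leNgt; apply/negP => h; apply: none; exists k.
  have : (m (\bigcup_k Ak k) <= m B - e%:E)%E.
    apply: measure_incr_le => //; first by move=> k; exact: mA.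
    apply/nondecreasing_seqP => k; apply/subsetPset.
    apply: subsetC; apply: thickening_mono.
    by rewrite lef_pV2 ?posrE // ler_nat.
  have : (m B <= m (\bigcup_k Ak k))%E.
    apply: le_trans ge_int _; apply: le_measure; rewrite ?inE //.
      by apply: bigcupT_measurable => k; exact: mA.
    move=> p; rewrite /interior nbhsE => -[U [oU Up] UB].
    have [r r0 hr] := (polar_openP U).1 oU p Up.
    have [k hk] := invn_lt r0; exists k => // -[q nBq qp]; apply/nBq/UB/hr.
    by rewrite polar_dist_sym; apply: lt_trans qp _; rewrite lte_fin.
  move=> /le_trans h /h; rewrite -(fineK mB_fin) -EFinB lee_fin.
  by rewrite lerBrDr -subr_ge0 opprD addrA subrr sub0r oppr_ge0 leNgt e0.
have k0 : 0 < k.+1%:R^-1 :> R by rewrite invr_gt0.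
have [D /andP[D0 Dk] lD] : exists2 D, 0 < D < k.+1%:R^-1 & m (level (~` B) D) = 0%E.
  apply: (@null_level _ _ _ m B (level (~` B))) => //.
  - by rewrite -ge0_fin_numE.
  - move=> D /andP[D0 _]; split; first exact: measurable_level.
    by move=> p [_]; exact: AB.
  - by move=> s s' p; exact: level_disjoint.
exists D => //; split=> //; rewrite -lee_fin EFinB !fineK ?fA //.
apply: le_trans (ltW hk) _; apply: le_measure; rewrite ?inE //; [exact: mA|exact: mA|].
by apply: subsetC; apply: thickening_mono; exact: ltW.
Qed.

Let scaled_le (A C E : set Omega) (n : nat) : measurable A -> measurable C ->
  measurable E -> A `<=` C `|` E ->
  n%:R * fine (P A) <= n%:R * fine (P C) + n%:R * fine (P E).
Proof.
move=> mA mC mE ACE; rewrite -mulrDr ler_wpM2l // -lee_fin EFinD.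
rewrite !fineK ?fin_num_measure //.
apply: le_trans (measureU2 _ _ _) => //; apply: le_measure; rewrite ?inE //.
exact: measurableU.
Qed.

Lemma largest_jump_cvg :
  n%:R * fine (P (traceY B n)) @[n --> \oo] --> fine (m B).
Proof.
apply/cvgrPdist_le => e e0; have e30 : 0 < e / 3 by rewrite divr_gt0.
have [D1 D10 [l1 h1]] := outer_approx e30.
have [D2 D20 [l2 h2]] := inner_approx e30.
have [E1 E10 s1] := traceY_sub D10.
have [E2 E20 s2] := traceX_sub D20.
have [N1 x1] := exceptional_seq E10 e30.
have [N2 x2] := exceptional_seq E20 e30.
have mT1 := measurable_thickening B D1.
have mT2 : measurable (~` thickening (~` B) D2 : set (borel (polar R d))).
  by apply: measurableC; exact: measurable_thickening.
have c1 : n%:R * fine (P (traceX (thickening B D1) n)) @[n --> \oo] -->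
    fine (m (thickening B D1)).
  apply: (RV_cvg X_RV) => //; first exact: thickening_bounded.
  exact: boundary_null (measurable_level B D1) (@boundary_thickening _ _ B D1) l1.
have c2 : n%:R * fine (P (traceX (~` thickening (~` B) D2) n)) @[n --> \oo] -->
    fine (m (~` thickening (~` B) D2)).
  apply: (RV_cvg X_RV) => //.
    have [C hC] := (polar_boundedP B).1 bB; apply/polar_boundedP; exists C => p nT.
    by apply: hC; apply: contrapT => nB; apply: nT; exact: sub_thickening.
  exact: boundary_null (measurable_level _ D2) (@boundary_thickeningC _ _ _ D2) l2.
have /cvgrPdist_le/(_ _ e30)[M1 _ y1] := c1.
have /cvgrPdist_le/(_ _ e30)[M2 _ y2] := c2.
exists (maxn (maxn N1 N2) (maxn M1 M2)) => // n /=.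
rewrite !geq_max => /andP[/andP[n1 n2] /andP[n3 n4]].
have up := scaled_le n (m_traceY n mB) (m_traceX n mT1)
  (m_exc n E10) (s1 n).
have low := scaled_le n (m_traceX n mT2) (m_traceY n mB)
  (m_exc n E20) (s2 n).
have := y1 n n3; have := y2 n n4; have := x1 n n1; have := x2 n n2.
rewrite !ler_distlC => z1 z2 /andP[z3 _] /andP[_ z4].
exact: sandwich up low z2 z1 z3 z4 h1 h2.
Qed.

End one_set.

Lemma RV_largest_jump : RV P Y a m.
Proof.
case: (X_RV) => _ ha hm hinf _; split => //.
move=> B mB bB dB; have mBfin := RV_fin X_RV mB bB.
rewrite -(fineK mBfin); apply/fine_cvgP; split.
  near=> n; rewrite fin_numM // fin_num_measure //.
  exact: measurable_scaled_trace.
apply: cvg_trans (largest_jump_cvg mB bB dB); apply: near_eq_cvg; near=> n => /=.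
by rewrite fineM //; apply: fin_num_measure; apply: measurable_scaled_trace.
Unshelve. all: by end_near. Qed.

End largest_jump_RV.

Theorem theorem3p3 (R : realType) (d : nat)
    (disp : measure_display) (Omega : measurableType disp)
    (P : probability Omega R) (X : Omega -> skorokhod R d) (a : nat -> R)
    (m : {measure set (borel (polar R d)) -> \bar R})
    (X_levy : levy P X) (X_RV : RV P X a m) :
  (forall e : R, 0 < e ->
     cond_prob P
       [set w | e%:E < J1dist (sk_scale u^-1 (X w))
                              (sk_scale u^-1 (largest_jump (X w)))]%E
       [set w | u%:E < supnorm (X w)]%E
     @[u --> +oo] --> 0%E) /\
  (forall e : R, 0 < e ->
     cond_prob P
       [set w | e%:E < J1dist (sk_scale u^-1 (X w))
                              (sk_scale u^-1 (largest_jump (X w)))]%E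
       [set w | u < enorm (jump (X w) (tau (X w)))]
     @[u --> +oo] --> 0%E) /\
  RV P (fun w => largest_jump (X w)) a m.
Proof.
have mX := RV_measurable X_RV.
have snormE u : [set w | (u%:E < supnorm (X w))%E] = [set w | u < snorm (X w)].
  by apply/seteqP; split=> w /=; rewrite supnormE lte_fin.
split; [|split; last exact: RV_largest_jump].
- move=> e e0; apply: (cond_far_cvg X_levy X_RV (k := 1) (u0 := 0)) => //.
    by move=> u; rewrite snormE; exact: (measurable_snorm _ mX).
  by move=> u _; rewrite snormE mul1r.
- move=> e e0; have [k [u0 [k0 h]]] := largest_jump_tail X_levy X_RV.
  apply: (cond_far_cvg X_levy X_RV e0 k0) h => u.
  have -> : [set w | u < enorm (jump (X w) (tau (X w)))] =
      [set w | u < snorm (largest_jump (X w))].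
    by apply/seteqP; split=> w /=; rewrite snorm_largest_jump.
  exact: (measurable_snorm _ (RV_measurable_largest_jump X_levy)).
Qed.
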